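(* Let $\mathbb{K}=\mathbb{C}$ or $\mathbb{K}=\mathbb{R}$, and let $I\subset\mathbb{K}[x_1,\dots,x_n]$ be a $B_n$-invariant ideal containing a polynomial $P$ with homogeneous component of highest degree $P_d$ and a monomial $m$ of $P_d$, written as $m=\prod_{i\in I_1}x_i^{2k_i}\prod_{i\in I_2}x_i^{2r_i+1}$ ($I_1\cap I_2=\emptyset$, $k_i\ge1$, $r_i\ge0$), such that $\mathrm{wt}(P_d)+d_1+d_2\le n$ where $d_1=\sum_{i\in I_1}k_i$, $d_2=\sum_{i\in I_2}r_i$. Let $(\lambda,\mu)=\Gamma^*(m)$ and $R_I=\mathbb{K}[x_1,\dots,x_n]/I$. Then, as a $\mathbb{K}[B_n]$-module, $R_I$ contains no irreducible submodule isomorphic to $W_{(\lambda,\mu)}$. Moreover, with $\tilde I=I\cap\mathbb{K}[x_1,\dots,x_n]^{B_n}$ and $R_{\tilde I}=\mathbb{K}[x_1,\dots,x_n]^{B_n}/\tilde I$, $R_I$ is a finite $R_{\tilde I}$-module generated by at most $\sum_{(\vartheta,\omega)\in\mathrm{BP}_n,\ (\vartheta,\omega)\not\unlhd(\lambda,\mu)}s_{\vartheta,\omega}^2$ elements.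
   Context: $B_n$ acts on $\mathbb{K}[x_1,\dots,x_n]$ by permutations of variables and sign changes $x_i\mapsto-x_i$; $\mathbb{K}[x_1,\dots,x_n]^{B_n}$ is the invariant ring; $I$ is $B_n$-invariant if stable under this action. $\mathrm{wt}(P_d)$ is the number of variables appearing in $P_d$. With $\ell=|I_1|$, $s=|I_2|$, let $(\lambda'_1,\dots,\lambda'_\ell)$ and $(\mu'_1,\dots,\mu'_s)$ be the $k_i$, resp. $r_i$, sorted non-increasingly; $\tilde\lambda=(\lambda'_1+1,\dots,\lambda'_\ell+1,1,\dots,1)$ with $n-(\ell+s+d_1+d_2)$ trailing ones, $\tilde\mu=(\mu'_1+1,\dots,\mu'_s+1)$, and $\Gamma^*(m)=(\tilde\lambda^\perp,\tilde\mu^\perp)$ (conjugate partitions). A bipartition of $n$ is a pair of partitions of total size $n$; $\mathrm{BP}_n$ is their set. For a bipartition $(\alpha,\beta)$, a bitableau of that shape fills the two Young diagrams with $1,\dots,n$ each once; with $\Delta_{(i_1,\dots,i_r)}(\mathbf{y})=\prod_{j<k}(y_{i_j}-y_{i_k})$, its Specht polynomial is $\mathrm{sp}_{(T,S)}(\mathbf{x})=\prod_i\Delta_{T_i}(\mathbf{x}^2)\prod_j\Delta_{S_j}(\mathbf{x}^2)\prod_{k\in S}x_k$ ($T_i,S_j$ columns, $\mathbf{x}^2=(x_1^2,\dots,x_n^2)$). $W_{(\alpha,\beta)}$ is the $\mathbb{K}$-span of all Specht polynomials of shape $(\alpha,\beta)$; these are the pairwise non-isomorphic irreducible $B_n$-representations,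 and $s_{\alpha,\beta}=\dim W_{(\alpha,\beta)}$. Bidominance: $(\vartheta,\omega)\unlhd(\lambda,\mu)$ iff for all $k\ge1$, $\sum_{j\le k}(\vartheta_j+\omega_j)\le\sum_{j\le k}(\lambda_j+\mu_j)$ and $\sum_{j\le k-1}(\vartheta_j+\omega_j)+\vartheta_k\le\sum_{j\le k-1}(\lambda_j+\mu_j)+\lambda_k$. *)

(* Defs.v *)
From HB Require Import structures.
From mathcomp Require Import all_boot all_order all_algebra all_fingroup.
From mathcomp Require Import generic_quotient ring_quotient.
From mathcomp Require Import boolp classical_sets reals.
From mathcomp Require Import mpoly complex.

Set Implicit Arguments.
Unset Strict Implicit.
Unset Printing Implicit Defensive.

Import GRing.Theory.
Local Open Scope ring_scope.
Local Open Scope quotient_scope.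

(* Possibly improper ideals of a commutative ring, and their quotients.  The    *)
(* library's idealr/{ideal_quot _} exclude the unit ideal; here the quotient    *)
(* is a comPzRingType, hence may be the zero ring.                              *)
HB.mixin Record isIdeal (R : comNzRingType) (S : R -> bool) := {
  idealM_subproof : forall a, {in S, forall u, a * u \in S}
}.

#[short(type="ideal")]
HB.structure Definition Ideal (R : comNzRingType) :=
  {S of GRing.ZmodClosed R S & isIdeal R S}.

Section QuotientRing.
Variables (R : comNzRingType) (I : ideal R).

Lemma idealM a u : u \in I -> a * u \in I.
Proof. exact: idealM_subproof. Qed.

Definition quot_ring : Type := Quotient.quot I.
HB.instance Definition _ := GRing.Zmodule.on quot_ring.

Definition qproj (p : R) : quot_ring := \pi_(Quotient.quot I) p.
Definition qrepr (x : quot_ring) : R := repr (x : Quotient.quot I).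

Lemma qreprK : cancel qrepr qproj.
Proof. by move=> x; rewrite /qproj /qrepr reprK. Qed.

Lemma qprojE p q : (qproj p = qproj q) <-> p - q \in I.
Proof.
rewrite (Quotient.idealrBE I).
by split=> [h|/eqP h]; [apply/eqP|]; apply: h.
Qed.

Lemma qreprE p : qrepr (qproj p) - p \in I.
Proof. by apply/qprojE; rewrite qreprK. Qed.

Lemma qproj_zmod : zmod_morphism qproj.
Proof. by move=> p q; rewrite /qproj; apply: raddfB. Qed.
HB.instance Definition _ := GRing.isZmodMorphism.Build R quot_ring qproj qproj_zmod.

Definition qone : quot_ring := qproj 1.
Definition qmul (x y : quot_ring) : quot_ring := qproj (qrepr x * qrepr y).

Lemma qmulE p q : qmul (qproj p) (qproj q) = qproj (p * q).
Proof.
apply/qprojE; set p' := qrepr _; set q' := qrepr _.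
have -> : p' * q' - p * q = q' * (p' - p) + p * (q' - q).
  by rewrite !mulrBr [q' * p']mulrC [q' * p]mulrC addrA subrK.
by rewrite rpredD ?idealM ?qreprE.
Qed.

Lemma qmulA : associative qmul.
Proof.
move=> x y z; rewrite -[x]qreprK -[y]qreprK -[z]qreprK.
by rewrite !qmulE mulrA.
Qed.

Lemma qmulC : commutative qmul.
Proof. by move=> x y; rewrite -[x]qreprK -[y]qreprK !qmulE mulrC. Qed.

Lemma qmul1 : left_id qone qmul.
Proof. by move=> x; rewrite -[x]qreprK /qone qmulE mul1r. Qed.

Lemma qmulD : left_distributive qmul +%R.
Proof.
move=> x y z; rewrite -[x]qreprK -[y]qreprK -[z]qreprK.
by rewrite -raddfD !qmulE mulrDl raddfD.
Qed.

HB.instance Definition _ :=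
  GRing.Zmodule_isComPzRing.Build quot_ring qmulA qmulC qmul1 qmulD.

Lemma qproj_monoid : monoid_morphism qproj.
Proof. by split=> // p q; rewrite -qmulE. Qed.
HB.instance Definition _ :=
  GRing.isMonoidMorphism.Build R quot_ring qproj qproj_monoid.

End QuotientRing.

Section QuotientVectorSpace.
Variables (K : fieldType) (n : nat) (I : ideal {mpoly K[n]}).

Definition qscale (a : K) (x : quot_ring I) : quot_ring I :=
  qproj I (a *: qrepr x).

Lemma qscaleE a p : qscale a (qproj I p) = qproj I (a *: p).
Proof.
apply/qprojE; rewrite -scalerBr -mul_mpolyC.
by rewrite idealM ?qreprE.
Qed.

Lemma qscaleA a b x : qscale a (qscale b x) = qscale (a * b) x.
Proof. by rewrite -[x]qreprK !qscaleE scalerA. Qed.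

Lemma qscale1 : left_id 1 qscale.
Proof. by move=> x; rewrite -[x]qreprK qscaleE scale1r. Qed.

Lemma qscaleDr : right_distributive qscale +%R.
Proof.
move=> a x y; rewrite -[x]qreprK -[y]qreprK.
by rewrite -raddfD !qscaleE scalerDr raddfD.
Qed.

Lemma qscaleDl x : {morph qscale^~ x : a b / a + b}.
Proof. by move=> a b; rewrite -[x]qreprK !qscaleE scalerDl raddfD. Qed.

HB.instance Definition _ := GRing.Zmodule_isLmodule.Build K (quot_ring I)
  qscaleA qscale1 qscaleDr qscaleDl.

End QuotientVectorSpace.

(* A K[G]-module structure on a K-vector space, not necessarily of finite       *)
(* dimension, with G acting on the left.                                        *)
Record repn (gT : finGroupType) (K : fieldType) (V : lmodType K) := Repn {
  repn_act :> gT -> V -> V;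
  repn_linear : forall g, linear (repn_act g);
  repn1 : forall v, repn_act 1%g v = v;
  repnM : forall g h v, repn_act (g * h)%g v = repn_act g (repn_act h v)
}.

Section Modules.
Variables (gT : finGroupType) (K : fieldType).

Definition lin_span (V : lmodType K) (A : set V) : set V :=
  [set v | exists d (c : 'I_d -> K) (e : 'I_d -> V),
     (forall i, A (e i)) /\ v = \sum_i c i *: e i].

Definition is_basis (V : lmodType K) (U : set V) d (e : 'I_d -> V) : Prop :=
  [/\ forall i, U (e i),
      forall c : 'I_d -> K, \sum_i c i *: e i = 0 -> forall i, c i = 0
    & forall v, U v -> exists c : 'I_d -> K, v = \sum_i c i *: e i].

(* Meaningful for finite-dimensional subspaces U; 0 by default otherwise.       *)
Definition lin_dim (V : lmodType K) (U : set V) : nat :=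
  xget 0%N [set d : nat | exists e : 'I_d -> V, is_basis U e].

Definition submodule (V : lmodType K) (rho : repn gT V) (U : set V) : Prop :=
  [/\ U 0,
      forall (a : K) u v, U u -> U v -> U (a *: u + v)
    & forall g u, U u -> U (rho g u)].

Definition irreducible (V : lmodType K) (rho : repn gT V) (U : set V) : Prop :=
  [/\ submodule rho U,
      exists2 u, U u & u != 0
    & forall U', submodule rho U' -> (U' `<=` U)%classic ->
        U' = [set 0]%classic \/ U' = U].

(* Only the restriction of f to U1 matters.                                     *)
Definition mod_iso (V1 V2 : lmodType K) (rho1 : repn gT V1) (rho2 : repn gT V2)
    (U1 : set V1) (U2 : set V2) : Prop :=
  exists f : V1 -> V2,
    [/\ forall (a : K) u v, U1 u -> U1 v -> f (a *: u + v) = a *: f u + f v,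
        forall g u, U1 u -> f (rho1 g u) = rho2 g (f u),
        forall u v, U1 u -> U1 v -> f u = f v -> u = v
      & (f @` U1)%classic = U2].

End Modules.

Definition generated_by_at_most (A : pzRingType) (M : lmodType A) (N : nat) :=
  exists2 s : seq M, (size s <= N)%N &
    forall x : M, exists c : nat -> A, x = \sum_(i < size s) c i *: s`_i.

(* (s, e) stands for the signed permutation x_i |-> (-1)^(e i) x_(s i).  The    *)
(* product is composition, right factor first.                                  *)
Definition hyperoct (n : nat) : Type := ('S_n * {ffun 'I_n -> bool})%type.
HB.instance Definition _ n := Finite.on (hyperoct n).

Section Hyperoctahedral.
Variable n : nat.
Implicit Types g h : hyperoct n.

Definition hyp_one : hyperoct n := (1%g, [ffun _ => false]).
Definition hyp_mul g h : hyperoct n :=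
  ((h.1 * g.1)%g, [ffun i => h.2 i (+) g.2 (h.1 i)]).
Definition hyp_inv g : hyperoct n :=
  ((g.1)^-1%g, [ffun i => g.2 ((g.1)^-1%g i)]).

Lemma hyp_mulA : associative hyp_mul.
Proof.
move=> g h k; congr pair; rewrite /= ?mulgA //.
by apply/ffunP=> i; rewrite !ffunE /= permM addbA.
Qed.

Lemma hyp_mul1 : left_id hyp_one hyp_mul.
Proof.
case=> s e; congr pair; rewrite /= ?mulg1 //.
by apply/ffunP=> i; rewrite !ffunE addbF.
Qed.

Lemma hyp_mulV : left_inverse hyp_one hyp_inv hyp_mul.
Proof.
case=> s e; congr pair; rewrite /= ?mulgV //.
by apply/ffunP=> i; rewrite !ffunE /= permK addbb.
Qed.

HB.instance Definition _ :=
  Finite_isGroup.Build (hyperoct n) hyp_mulA hyp_mul1 hyp_mulV.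

End Hyperoctahedral.

Section PolynomialAction.
Variables (K : fieldType) (n : nat).
Local Notation poly := {mpoly K[n]}.
Implicit Types g h : hyperoct n.

Definition pact g (p : poly) : poly :=
  p \mPo [tuple (-1) ^+ (g.2 i) * 'X_(g.1 i) | i < n].

Lemma pact_linear g : linear (pact g).
Proof. by move=> a p q; rewrite /pact linearP. Qed.
HB.instance Definition _ g := GRing.isLinear.Build K poly poly _ (pact g)
  (pact_linear g).

Lemma pact_monoid g : monoid_morphism (pact g).
Proof. by rewrite /pact; split=> [|p q]; rewrite ?rmorph1 ?rmorphM. Qed.
HB.instance Definition _ g := GRing.isMonoidMorphism.Build poly poly (pact g)
  (pact_monoid g).

Lemma pactX g i : pact g 'X_i = (-1) ^+ (g.2 i) * 'X_(g.1 i).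
Proof. by rewrite /pact comp_mpolyXU -tnth_nth tnth_mktuple. Qed.

Lemma pact1 p : pact 1%g p = p.
Proof.
rewrite -[RHS]comp_mpoly_id; congr (_ \mPo _); apply: eq_mktuple => i.
by rewrite /= ffunE perm1 expr0 mul1r.
Qed.

Lemma pactM g h p : pact (g * h)%g p = pact g (pact h p).
Proof.
rewrite (mpolyE p) (linear_sum (pact (g * h)%g)) (linear_sum (pact h)).
rewrite (linear_sum (pact g)); apply: eq_bigr => m _.
have pZ u (a : K) q : pact u (a *: q) = a *: pact u q by rewrite linearZ.
rewrite /= !pZ.
congr (_ *: _); rewrite mpolyXE_id !rmorph_prod /=.
apply: eq_bigr => i _; rewrite !rmorphXn /= !pactX rmorphM /= pactX.
rewrite rmorph_sign /= mulrA -signr_addb permM; congr ((_ * _) ^+ _).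
by rewrite ffunE.
Qed.

Definition poly_repn : repn (hyperoct n) {mpoly K[n]} :=
  Repn pact_linear pact1 pactM.

Definition hyp_invariant : {pred poly} := fun p => [forall g, pact g p == p].

Lemma hyp_invariantP p :
  reflect (forall g, pact g p = p) (p \in hyp_invariant).
Proof. exact: 'forall_eqP. Qed.

Lemma hyp_invariant_subring : subring_closed hyp_invariant.
Proof.
split=> [|p q /hyp_invariantP hp /hyp_invariantP hq
         |p q /hyp_invariantP hp /hyp_invariantP hq].
- by apply/hyp_invariantP => g; rewrite rmorph1.
- by apply/hyp_invariantP => g; rewrite rmorphB /= hp hq.
- by apply/hyp_invariantP => g; rewrite rmorphM /= hp hq.
Qed.
HB.instance Definition _ :=
  GRing.isSubringClosed.Build poly hyp_invariant hyp_invariant_subring.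

Definition inv_ring : Type := {p : poly | p \in hyp_invariant}.
HB.instance Definition _ := SubType.on inv_ring.
HB.instance Definition _ := Choice.on inv_ring.
HB.instance Definition _ := [SubChoice_isSubComNzRing of inv_ring by <:].

Definition hyp_stable (I : {pred poly}) : Prop :=
  forall g p, p \in I -> pact g p \in I.

End PolynomialAction.

Section QuotientAction.
Variables (K : fieldType) (n : nat) (I : ideal {mpoly K[n]}).

Definition qact g (x : quot_ring I) : quot_ring I := qproj I (pact g (qrepr x)).

Hypothesis I_stable : hyp_stable I.

Lemma qactE g p : qact g (qproj I p) = qproj I (pact g p).
Proof. by apply/qprojE; rewrite -linearB /= I_stable ?qreprE. Qed.

Lemma qact_linear g : linear (qact g).
Proof.
move=> a x y; rewrite -[x]qreprK -[y]qreprK.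
rewrite -[a *: _]/(qscale a _) qscaleE -raddfD !qactE linearP raddfD /=.
by rewrite -qscaleE.
Qed.

Lemma qact1 x : qact 1%g x = x.
Proof. by rewrite -[x]qreprK qactE pact1. Qed.

Lemma qactM g h x : qact (g * h)%g x = qact g (qact h x).
Proof. by rewrite -[x]qreprK !qactE pactM. Qed.

Definition quot_repn : repn (hyperoct n) (quot_ring I) :=
  Repn qact_linear qact1 qactM.

End QuotientAction.

(* The ideal I :&: K[x]^(B_n) of the invariant ring, and K[x]/I as a module     *)
(* over the quotient of the invariant ring by it.                               *)
Section InvariantQuotient.
Variables (K : fieldType) (n : nat) (I : ideal {mpoly K[n]}).

Definition inv_ideal : {pred inv_ring K n} := fun p => val p \in I.

Lemma inv_ideal_zmod : zmod_closed inv_ideal.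
Proof.
split=> [|p q hp hq]; rewrite unfold_in ?rmorph0 ?rpred0 //.
by rewrite rmorphB rpredB.
Qed.
HB.instance Definition _ :=
  GRing.isZmodClosed.Build (inv_ring K n) inv_ideal inv_ideal_zmod.

Lemma inv_idealM a : {in inv_ideal, forall u, a * u \in inv_ideal}.
Proof. by move=> u hu; rewrite unfold_in rmorphM idealM. Qed.
HB.instance Definition _ := isIdeal.Build (inv_ring K n) inv_ideal inv_idealM.

Definition inv_quot : Type := quot_ring inv_ideal.
HB.instance Definition _ := GRing.ComPzRing.on inv_quot.

Definition inv_quot_map (a : inv_quot) : quot_ring I := qproj I (val (qrepr a)).

Lemma inv_quot_mapE p : inv_quot_map (qproj inv_ideal p) = qproj I (val p).
Proof. by apply/qprojE; rewrite -rmorphB; apply: (qreprE inv_ideal p). Qed.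

Definition quot_over_inv : Type := quot_ring I.
HB.instance Definition _ := GRing.Zmodule.on quot_over_inv.

Definition inv_scale (a : inv_quot) (x : quot_over_inv) : quot_over_inv :=
  inv_quot_map a * (x : quot_ring I).

Lemma inv_scaleA a b x : inv_scale a (inv_scale b x) = inv_scale (a * b) x.
Proof.
rewrite /inv_scale mulrA; congr (_ * _); rewrite -[a]qreprK -[b]qreprK.
by rewrite -[in RHS](rmorphM (qproj inv_ideal)) !inv_quot_mapE !rmorphM.
Qed.

Lemma inv_scale1 : left_id 1 inv_scale.
Proof.
move=> x; rewrite /inv_scale -[1]/(qproj inv_ideal 1) inv_quot_mapE.
by rewrite !rmorph1 mul1r.
Qed.

Lemma inv_scaleDr : right_distributive inv_scale +%R.
Proof. by move=> a x y; rewrite /inv_scale mulrDr. Qed.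

Lemma inv_scaleDl x : {morph inv_scale^~ x : a b / a + b}.
Proof.
move=> a b; rewrite /inv_scale -[a]qreprK -[b]qreprK -raddfD.
by rewrite !inv_quot_mapE !raddfD mulrDl.
Qed.

HB.instance Definition _ := GRing.Zmodule_isLmodule.Build inv_quot quot_over_inv
  inv_scaleA inv_scale1 inv_scaleDr inv_scaleDl.

End InvariantQuotient.

Definition is_partition (s : seq nat) : bool := sorted geq s && (0%N \notin s).

Definition is_bipartition (n : nat) (ab : seq nat * seq nat) : bool :=
  [&& is_partition ab.1, is_partition ab.2 & (sumn ab.1 + sumn ab.2 == n)%N].

Definition seqs_upto (n : nat) : seq (seq nat) :=
  [seq map val (tval t) | k <- iota 0 n.+1, t <- enum {: k.-tuple 'I_n.+1}].

Definition BP (n : nat) : seq (seq nat * seq nat) :=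
  undup [seq ab <- [seq (a, b) | a <- seqs_upto n, b <- seqs_upto n]
        | is_bipartition n ab].

Lemma mem_seqs_upto n s : is_partition s -> (sumn s <= n)%N -> s \in seqs_upto n.
Proof.
move=> /andP[_ s0] le_sn.
have size_le : (size s <= n)%N.
  apply: leq_trans le_sn; elim: s s0 => //= x s IHs.
  rewrite inE negb_or eq_sym -lt0n => /andP[x0 /IHs le_s].
  exact: (leq_add x0 le_s).
have lt_s i : i \in s -> (i < n.+1)%N.
  rewrite ltnS => si; apply: leq_trans le_sn.
  elim: s si {s0 size_le} => //= x s IHs; rewrite inE.
  by case/predU1P=> [->|/IHs /leq_trans->] //; rewrite ?leq_addr ?leq_addl.
have sz : size (map (inord : nat -> 'I_n.+1) s) == size s by rewrite size_map.
apply/allpairsPdep; exists (size s), (Tuple sz); split.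
- by rewrite mem_iota.
- by rewrite mem_enum.
- rewrite /= -map_comp -[LHS]map_id; apply/eq_in_map => i /lt_s lt_i.
  by rewrite /= inordK.
Qed.

Lemma mem_BP n ab : (ab \in BP n) = is_bipartition n ab.
Proof.
rewrite mem_undup mem_filter andb_idr //.
case: ab => a b /and3P[/= pa pb /eqP def_n]; apply/allpairsP; exists (a, b).
by split; rewrite //= mem_seqs_upto // -def_n ?leq_addr ?leq_addl.
Qed.

Lemma uniq_BP n : uniq (BP n).
Proof. exact: undup_uniq. Qed.

Definition conj_part (s : seq nat) : seq nat :=
  [seq count (fun x => j < x)%N s | j <- iota 0 (head 0%N s)].

(* Parts are indexed from 0 here, so k stands for k + 1 in the usual            *)
(* 1-based formulation; nth pads partitions with zeros.                         *)
Definition bidominated (to lm : seq nat * seq nat) : Prop :=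
  forall k : nat,
    (\sum_(j < k.+1) (nth 0 to.1 j + nth 0 to.2 j) <=
     \sum_(j < k.+1) (nth 0 lm.1 j + nth 0 lm.2 j))%N /\
    (\sum_(j < k) (nth 0 to.1 j + nth 0 to.2 j) + nth 0 to.1 k <=
     \sum_(j < k) (nth 0 lm.1 j + nth 0 lm.2 j) + nth 0 lm.1 k)%N.

Section Specht.
Variables (K : fieldType) (n : nat).

(* A tableau is the list of its rows, from top to bottom; `columns` reads each  *)
(* column from top to bottom.                                                   *)
Definition is_bitableau (ab : seq nat * seq nat)
    (TS : seq (seq 'I_n) * seq (seq 'I_n)) : bool :=
  [&& shape TS.1 == ab.1, shape TS.2 == ab.2
    & perm_eq (flatten TS.1 ++ flatten TS.2) (enum 'I_n)].

Definition columns (T : seq (seq 'I_n)) : seq (seq 'I_n) :=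
  [seq pmap (fun r => onth r j) T | j <- iota 0 (head 0%N (shape T))].

Definition Delta (c : seq 'I_n) (y : 'I_n -> {mpoly K[n]}) : {mpoly K[n]} :=
  \prod_(j < size c) \prod_(k < size c | (j < k)%N)
    (y (tnth (in_tuple c) j) - y (tnth (in_tuple c) k)).

Definition specht (TS : seq (seq 'I_n) * seq (seq 'I_n)) : {mpoly K[n]} :=
  (\prod_(c <- columns TS.1) Delta c (fun i => 'X_i ^+ 2)) *
  (\prod_(c <- columns TS.2) Delta c (fun i => 'X_i ^+ 2)) *
  \prod_(k <- flatten TS.2) 'X_k.

Definition specht_mod (ab : seq nat * seq nat) : set {mpoly K[n]} :=
  lin_span [set p | exists2 TS, is_bitableau ab TS & p = specht TS]%classic.

Definition top_component (P : {mpoly K[n]}) : {mpoly K[n]} :=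
  pihomog mdeg (msize P).-1 P.

Definition wt (p : {mpoly K[n]}) : nat :=
  #|[set i : 'I_n | has (fun m : 'X_{1..n} => m i != 0%N) (msupp p)]|.

End Specht.

Arguments specht_mod K n ab : clear implicits.

(* The bipartition attached to                                                  *)
(*   prod_(i in I1) x_i^(2 k_i) * prod_(i in I2) x_i^(2 r_i + 1).               *)
Section GammaStar.
Variables (n : nat) (I1 I2 : {set 'I_n}) (k r : 'I_n -> nat).

Definition lambda_tilde : seq nat :=
  [seq x.+1 | x <- sort geq [seq k i | i <- enum I1]] ++
  nseq (n - (#|I1| + #|I2| + \sum_(i in I1) k i + \sum_(i in I2) r i)) 1%N.

Definition mu_tilde : seq nat :=
  [seq x.+1 | x <- sort geq [seq r i | i <- enum I2]].

Definition Gamma_star : seq nat * seq nat :=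
  (conj_part lambda_tilde, conj_part mu_tilde).

End GammaStar.

(* Main.v *)
Require Import Defs.
From HB Require Import structures.
From mathcomp Require Import all_boot all_order all_algebra all_fingroup.
From mathcomp Require Import boolp classical_sets reals.
From mathcomp Require Import mpoly complex.
From mathcomp Require Import zify ring.

Set Implicit Arguments.
Unset Strict Implicit.
Unset Printing Implicit Defensive.

Import GRing.Theory.
Local Open Scope ring_scope.

Local Notation "m # s" := [multinom m (s i) | i < _]
  (at level 40, left associativity, format "m # s").

(** Antisymmetrizing a polynomial over the column group of a bitableau gives a
    multiple of its Specht polynomial.  A submodule of R_I isomorphic to W_Gamma*(m)
    contains a nonzero vector alternating under such a column group, and lifting and
    antisymmetrizing it shows that it vanishes as soon as the Specht polynomials of
    shape Gamma*(m) are in I.  For one bitableau this follows by antisymmetrizing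
    x^a P: the weight condition provides enough variables outside P_d to complete
    each variable of m to a column of k_i + 1 or r_i + 1 boxes, and x^a m survives.
    Moving boxes between columns, again by antisymmetrization, puts in I the Specht
    polynomials of all the shapes dominated by Gamma*(m).

    K[x] is spanned over the invariants by the orbit of a single polynomial h0.
    Modulo the antisymmetrizers of larger degree, the antisymmetrizer of a bitableau
    is a multiple of a matrix coefficient operator of its Specht module; hence by
    descending induction on the degree the group algebra is spanned, modulo
    operators sending h0 to I, by the matrix coefficients of the Specht modules of
    the shapes not dominated by Gamma*(m): s^2 operators for each shape. *)

(** * Column groups and Specht polynomials *)

(** Up to sign, a Specht polynomial depends only on the sets of entries of the columns of its two
    tableaux; bitableaux are therefore handled as column labellings, and rows appear only when
    shapes are compared. Bidominance interleaves two families of inequalities. Giving a column of s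
    boxes the key 2s or 2s+1, according to its tableau, merges them: the number [psi] of boxes whose
    exponent in a leading monomial is at least k is complementary to a partial sum of the first
    family for k even, of the second for k odd. Bidominance becomes the pointwise comparison of the
    functions [psi], and an elementary move of boxes adds to [psi] the indicator of an interval or
    of one parity class in it. The descending induction rests on two facts about degrees: an
    antisymmetrizer kills every polynomial of degree smaller than that of its Specht polynomial, and
    in a Garnir relation a box moves to a column at least as long, which raises that degree. Some
    scalars must be shown nonzero by positivity, although the field may be the complex numbers; they
    are traced back to sums of squares of integers. *)

Section Action.
Variables (K : fieldType) (n : nat).
Local Notation poly := {mpoly K[n]}.
Local Notation G := (hyperoct n).
Implicit Types (g h : G) (p q : poly) (m : 'X_{1..n}).

Definition flip_sign (w : 'I_n -> bool) g : K := \prod_i (-1) ^+ (g.2 i && w i).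

Definition mnm_sign g m : K := flip_sign (fun i => odd (m i)) g.

Lemma flip_sign_sq w g : flip_sign w g * flip_sign w g = 1.
Proof.
rewrite -big_split big1 //= => i _.
by rewrite -signr_addb addbb.
Qed.

Lemma flip_signM w g h :
  flip_sign w (g * h)%g =
  flip_sign w h * flip_sign (fun i => w ((h.1^-1)%g i)) g.
Proof.
rewrite /flip_sign [X in _ = _ * X](reindex_inj (@perm_inj _ h.1)) -big_split.
apply: eq_bigr => i _ /=; rewrite ffunE permK -signr_addb; congr (_ ^+ _).
by case: (w i); rewrite ?andbT ?andbF.
Qed.

Lemma flip_sign1 w : flip_sign w 1%g = 1.
Proof. by rewrite /flip_sign big1 // => i _; rewrite ffunE. Qed.

Lemma pact_mnm g m : pact g 'X_[m] = mnm_sign g m *: 'X_[m#(g.1^-1)%g].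
Proof.
rewrite /pact comp_mpolyX (mpolyXE _ g.1) -mul_mpolyC /mnm_sign /flip_sign rmorph_prod.
rewrite -big_split; apply: eq_bigr => i _ /=.
rewrite tnth_mktuple exprMn mnmE permK rmorphXn rmorphN rmorph1.
rewrite -exprM -signr_odd oddM; congr (_ ^+ _ * _).
by rewrite oddb.
Qed.

Lemma mcoeff_pact g p m : (pact g p)@_m = mnm_sign g (m#(g.1)) * p@_(m#(g.1)).
Proof.
elim/mpolyind: p => [|c m' p _ _ IHp]; first by rewrite linear0 !mcoeff0 mulr0.
rewrite linearP /= !mcoeffD !mcoeffZ IHp pact_mnm mulrDr; congr (_ + _).
rewrite mcoeffZ !mcoeffX [RHS]mulrCA; congr (_ * _).
have -> : (m'#(g.1^-1)%g == m)%MM = (m' == m#(g.1))%MM.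
  by apply/eqP/eqP => [<-|->]; rewrite -mpermM ?mulgV ?mulVg mperm1.
by case: eqP => [<-|_]; rewrite ?mulr0.
Qed.

Lemma msize_pact g p : (msize (pact g p) <= msize p)%N.
Proof.
rewrite msizeE; apply/bigmax_leqP_seq => m hm _.
have : m#(g.1) \in msupp p.
  rewrite mcoeff_msupp; move: hm; rewrite mcoeff_msupp mcoeff_pact.
  by apply: contraNneq => ->; rewrite mulr0.
by move/msize_mdeg_lt; rewrite mdeg_mperm.
Qed.

Lemma meval_pact g p (v : 'I_n -> K) :
  (pact g p).@[v] = p.@[fun i => (-1) ^+ g.2 i * v (g.1 i)].
Proof.
rewrite /pact comp_mpoly_meval; apply: meval_eq => i.
by rewrite tnth_mktuple mevalM mevalXU rmorphXn rmorphN1.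
Qed.

Lemma pactK g : cancel (pact g) (pact (K := K) g^-1%g).
Proof. by move=> p; rewrite -pactM mulVg pact1. Qed.

End Action.

Section ColumnGroup.
Variables (K : fieldType) (n : nat).
Local Notation poly := {mpoly K[n]}.
Local Notation G := (hyperoct n).
Implicit Types (g h : G) (p q : poly) (f : 'I_n -> 'I_n) (o : 'I_n -> bool).

(* A pair (f, o) encodes the columns of a bitableau: f i is the column of i, and
   o c tells whether column c belongs to the second tableau. *)
Definition colgrp f : {set G} := [set g : G | [forall i, f (g.1 i) == f i]].

Lemma colgrpP f g : reflect (forall i, f (g.1 i) = f i) (g \in colgrp f).
Proof. by rewrite inE; apply: 'forall_eqP. Qed.

Lemma colgrp1 f : 1%g \in colgrp f.
Proof. by apply/colgrpP => i; rewrite perm1. Qed.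

Lemma colgrpM f g h : g \in colgrp f -> h \in colgrp f -> (g * h)%g \in colgrp f.
Proof.
by move=> /colgrpP hg /colgrpP hh; apply/colgrpP => i; rewrite permM hg hh.
Qed.

Lemma colgrpV f g : g \in colgrp f -> (g^-1)%g \in colgrp f.
Proof.
by move=> /colgrpP hg; apply/colgrpP => i; rewrite -[in RHS](permKV g.1 i) hg.
Qed.

Lemma colgrpMl f g h : g \in colgrp f -> ((g * h)%g \in colgrp f) = (h \in colgrp f).
Proof.
move=> hg; apply/idP/idP => hh; last exact: colgrpM.
by rewrite -(mulKg g h) colgrpM ?colgrpV.
Qed.

Lemma colgrpMr f g h : g \in colgrp f -> ((h * g)%g \in colgrp f) = (h \in colgrp f).
Proof.
move=> hg; apply/idP/idP => hh; last exact: colgrpM.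
by rewrite -(mulgK g h) colgrpM ?colgrpV.
Qed.

(** The character by which [colgrp f] acts on the Specht polynomial: a sign change at a box counts
    only in the second tableau, where the variable divides the polynomial to an odd power. *)
Definition colchar f o g : K := (-1) ^+ (g.1 : bool) * flip_sign K (o \o f) g.

Lemma colchar1 f o : colchar f o 1%g = 1.
Proof. by rewrite /colchar odd_perm1 flip_sign1 mulr1. Qed.

Lemma colchar_sq f o g : colchar f o g * colchar f o g = 1.
Proof. by rewrite /colchar mulrACA flip_sign_sq -signr_addb addbb mulr1. Qed.

Lemma flip_sign_col f o g h : h \in colgrp f ->
  flip_sign K (fun i => (o \o f) ((h.1^-1)%g i)) g = flip_sign K (o \o f) g.
Proof.
move=> /colgrpV /colgrpP hh; apply: eq_bigr => i _ /=.
by rewrite (hh i).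
Qed.

Lemma colcharM f o g h : h \in colgrp f ->
  colchar f o (g * h)%g = colchar f o g * colchar f o h.
Proof.
move=> hh; rewrite /colchar flip_signM flip_sign_col // odd_permM.
rewrite signr_addb; move: ((-1) ^+ h.1) ((-1) ^+ g.1) => a b.
by move: (flip_sign _ _ h) (flip_sign _ _ g) => c d; ring.
Qed.

Lemma colcharV f o g : g \in colgrp f -> colchar f o g^-1%g = colchar f o g.
Proof.
move=> hg; have := colcharM o g^-1%g hg; rewrite mulVg colchar1 => /esym h1.
by rewrite -[LHS]mulr1 -(colchar_sq f o g) mulrA h1 mul1r.
Qed.

Definition alt f o p := \sum_(g in colgrp f) colchar f o g *: pact g p.

Definition antisym f o p :=
  forall g, g \in colgrp f -> pact g p = colchar f o g *: p.

Lemma alt_is_linear f o : linear (alt f o).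
Proof.
move=> a p q; rewrite /alt scaler_sumr -big_split; apply: eq_bigr => g _ /=.
by rewrite linearP /= scalerDr !scalerA mulrC.
Qed.
HB.instance Definition _ f o :=
  GRing.isLinear.Build K poly poly _ (alt f o) (alt_is_linear f o).

Lemma alt_antisym f o p : antisym f o (alt f o p).
Proof.
move=> h hh; rewrite /alt linear_sum scaler_sumr.
rewrite [RHS](reindex_inj (mulgI h)).
apply: eq_big => [g|g hg]; first by rewrite colgrpMl.
rewrite linearZ /= -pactM colcharM // !scalerA mulrA colchar_sq mul1r //.
Qed.

Lemma alt_of_antisym f o p :
  antisym f o p -> alt f o p = #|colgrp f|%:R *: p.
Proof.
move=> hp; rewrite /alt (eq_bigr (fun=> p)) => [|g hg].
  by rewrite sumr_const scaler_nat.
by rewrite hp // scalerA colchar_sq scale1r.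
Qed.

Lemma alt_pact f o h p :
  h \in colgrp f -> alt f o (pact h p) = colchar f o h *: alt f o p.
Proof.
move=> hh; rewrite /alt scaler_sumr [RHS](reindex_inj (mulIg h)).
apply: eq_big => [g|g hg]; first by rewrite colgrpMr.
by rewrite -pactM colcharM // scalerA mulrCA colchar_sq mulr1.
Qed.

Lemma antisymZ f o c p : antisym f o p -> antisym f o (c *: p).
Proof. by move=> hp g hg; rewrite linearZ /= hp // !scalerA mulrC. Qed.

Lemma pact_alt g f o p :
  pact g (alt f o p) = alt (fun i => f ((g.1^-1)%g i)) o (pact g p).
Proof.
set f' := fun i => _.
have hK h : ((h ^ g^-1)%g \in colgrp f') = (h \in colgrp f).
  have E i : (h ^ g^-1)%g.1 i = g.1 (h.1 ((g.1^-1)%g i)).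
    by rewrite conjgE invgK /= !permM.
  apply/colgrpP/colgrpP => hh i; last by rewrite /f' E permK hh.
  by have := hh (g.1 i); rewrite /f' E !permK.
rewrite /alt linear_sum /= [RHS](reindex_inj (@conjg_inj _ g^-1%g)).
apply: eq_big => [h|h hh]; first by rewrite hK.
rewrite linearZ /= -!pactM conjgE invgK -!mulgA mulVg mulg1; congr (_ *: _).
(* The two factorizations [g * h = (h ^ g^-1) * g] give the same sign, which relates the character
   at [h] to the one at its conjugate. *)
have e1 := flip_signM K (o \o f) (h ^ g^-1)%g g.
have := flip_signM K (o \o f) g h; rewrite flip_sign_col //.
have -> : (g * h)%g = (h ^ g^-1 * g)%g.
  by rewrite conjgE invgK -!mulgA mulVg mulg1.
rewrite e1 mulrC => /(congr1 (fun x => x * flip_sign K (o \o f) g)).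
rewrite -!mulrA flip_sign_sq !mulr1 => e2; rewrite /colchar; congr (_ * _).
  by rewrite !odd_permM odd_permV addbAC addbb.
by rewrite -e2 conjgE invgK.
Qed.

End ColumnGroup.

(* phi t stands for the reduction modulo l t. *)
Lemma prod_dvd_of_vanish (R : idomainType) (T : eqType) (s : seq T) (l : T -> R)
    (phi : T -> R -> R) (hM : forall t, {morph phi t : x y / x * y}) :
  uniq s ->
  (forall t p, t \in s -> phi t p = 0 -> exists q, p = l t * q) ->
  {in s &, forall t u, t != u -> phi t (l u) != 0} ->
  forall p, {in s, forall t, phi t p = 0} -> exists q, p = (\prod_(t <- s) l t) * q.
Proof.
elim: s => [|t s IHs] /=; first by move=> _ _ _ p _; exists p; rewrite big_nil mul1r.
move=> /andP[tNs us] ker ne p hp.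
have [q def_p] := ker t p (mem_head _ _) (hp t (mem_head _ _)).
have [|||r def_q] := IHs us _ _ q.
- by move=> u r us'; apply: ker; rewrite inE us' orbT.
- by move=> u v hu hv; apply: ne; rewrite inE ?hu ?hv orbT.
- move=> u hu; have := hp u; rewrite inE hu orbT => /(_ isT).
  rewrite def_p hM => /eqP; rewrite mulf_eq0 => /orP[/eqP h|/eqP //].
  have tu : u != t by apply: contraNneq tNs => <-.
  have hu' : u \in t :: s by rewrite inE hu orbT.
  by have := ne u t hu' (mem_head _ _) tu; rewrite h eqxx.
by exists r; rewrite big_cons -mulrA -def_q.
Qed.

(** * Vanishing on hyperplanes and divisibility by the Specht polynomial *)

Section Divisibility.
Variables (K : fieldType) (n : nat).
Local Notation poly := {mpoly K[n]}.
Local Notation G := (hyperoct n).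
Implicit Types (g h : G) (p q : poly) (f : 'I_n -> 'I_n) (o : 'I_n -> bool).

Lemma mpoly_rmorph_ext (S : pzRingType) (F F' : {rmorphism poly -> S}) :
  (forall c, F c%:MP = F' c%:MP) -> (forall i, F 'X_i = F' 'X_i) -> F =1 F'.
Proof.
move=> hC hX; elim/mpolyind => [|c m p _ _ IHp]; first by rewrite !rmorph0.
rewrite -mul_mpolyC !rmorphD !rmorphM /= IHp hC mpolyXE_id !rmorph_prod /=.
by congr (_ * _ + _); apply: eq_bigr => i _; rewrite !rmorphXn /= hX.
Qed.

Lemma rmorph_congr (F : {rmorphism poly -> poly}) (l : poly) :
  (forall c, F c%:MP = c%:MP) -> (forall i, exists q, 'X_i - F 'X_i = l * q) ->
  forall p, exists q, p - F p = l * q.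
Proof.
move=> FC FX; pose D q := exists r, q - F q = l * r.
have DM q r : D q -> D r -> D (q * r).
  move=> [a ha] [b hb]; exists (q * b + a * F r).
  rewrite rmorphM mulrDr [l * (q * b)]mulrCA -hb mulrA -ha.
  by rewrite mulrBr mulrBl addrA subrK.
have DC c : D c%:MP by exists 0; rewrite FC subrr mulr0.
elim/mpolyind => [|c m q _ _ [r hr]]; first by exists 0; rewrite rmorph0 subrr mulr0.
have [r' hr'] : D (c *: 'X_[m]).
  rewrite -mul_mpolyC; apply: (DM _ _ (DC c)).
  rewrite mpolyXE_id; elim/big_ind: _ => // [|i _].
    by rewrite -mpolyC1; apply: DC.
  elim: (m i) => [|e IHe]; first by rewrite expr0 -mpolyC1; apply: DC.
  by rewrite exprS; apply: DM => //; apply: FX.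
by exists (r' + r); rewrite rmorphD /= mulrDr -hr -hr' opprD addrACA.
Qed.

(* The index (i, j, b) with i < j encodes the hyperplane x_i = (-1)^b x_j, and
   (i, i, false) encodes x_i = 0. *)
Definition hyp_rhs (t : 'I_n * 'I_n * bool) : poly :=
  if t.1.1 == t.1.2 then 0 else (-1) ^+ t.2 * 'X_t.1.2.

Definition hyp_form t : poly := 'X_t.1.1 - hyp_rhs t.

Definition hyp_subst (t : 'I_n * 'I_n * bool) (p : poly) : poly :=
  p \mPo [tuple if k == t.1.1 then hyp_rhs t else 'X_k | k < n].

Lemma hyp_substX t k :
  hyp_subst t 'X_k = if k == t.1.1 then hyp_rhs t else 'X_k.
Proof. by rewrite /hyp_subst comp_mpolyXU -tnth_nth tnth_mktuple. Qed.

HB.instance Definition _ t := GRing.RMorphism.copy (hyp_subst t)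
  (comp_mpoly [tuple if k == t.1.1 then hyp_rhs t else 'X_k | k < n]).

Lemma hyp_subst_ker t p : hyp_subst t p = 0 -> exists q, p = hyp_form t * q.
Proof.
have [||q] := @rmorph_congr (hyp_subst t) (hyp_form t) _ _ p.
- by move=> c; apply: comp_mpolyC.
- move=> k; rewrite /= hyp_substX; case: eqP => [->|_]; first by exists 1; rewrite mulr1.
  by exists 0; rewrite subrr mulr0.
by move=> + h0; rewrite /= h0 subr0 => ->; exists q.
Qed.

(** A point of the hyperplane [t] that lies on no other hyperplane [x_i = 0] or [x_i = ± x_j]: the
    coordinates [k + 1] have distinct nonzero absolute values. It is integral so that the check can
    be made in [int]. *)
Definition hyp_pt (t : 'I_n * 'I_n * bool) (k : 'I_n) : int :=
  if k == t.1.1 then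
    (if t.1.1 == t.1.2 then 0 else (-1) ^+ t.2 * (t.1.2).+1%:Z)
  else k.+1%:Z.

Lemma meval_hyp_subst t p : let v k := (hyp_pt t k)%:~R in
  (hyp_subst t p).@[v] = p.@[v].
Proof.
move=> v; rewrite comp_mpoly_meval; apply: meval_eq => k.
rewrite tnth_mktuple /v /hyp_pt /hyp_rhs.
case: (boolP (k == t.1.1)) => hk; last by rewrite mevalXU (negPf hk).
case: (boolP (t.1.1 == t.1.2)) => hj; first by rewrite meval0.
rewrite mevalM rmorphXn rmorphN1 mevalXU (eq_sym t.1.2) (negPf hj).
by rewrite rmorphM rmorphXn rmorphN1.
Qed.

(** The conditions [i < j] and [~~ t.2] select one code for each hyperplane, so that distinct codes
    have coprime forms. *)
Definition in_hyp f o (t : 'I_n * 'I_n * bool) :=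
  if t.1.1 == t.1.2 then ~~ t.2 && o (f t.1.1)
  else (t.1.1 < t.1.2)%N && (f t.1.1 == f t.1.2).

Hypothesis K0 : [pchar K] =i pred0.

Lemma intr_eq0_pchar0 (z : int) : (z%:~R == 0 :> K) = (z == 0).
Proof.
have /pcharf0P hK := K0.
case: z => k; first by rewrite -pmulrn hK.
by rewrite NegzE mulrNz oppr_eq0 -pmulrn hK.
Qed.

Lemma hyp_subst_neq0 f o t u : in_hyp f o t -> in_hyp f o u -> t != u ->
  hyp_subst t (hyp_form u) != 0.
Proof.
move=> ht hu tu; pose v k : K := (hyp_pt t k)%:~R.
apply/eqP => /(congr1 (meval v)); rewrite meval0 meval_hyp_subst -/v.
have -> : (hyp_form u).@[v] = (hyp_pt t u.1.1 - (if u.1.1 == u.1.2 then 0 else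
     (-1) ^+ u.2 * hyp_pt t u.1.2))%:~R.
  rewrite mevalB mevalXU rmorphB /= /hyp_rhs; congr (_ - _).
  case: eqP => _; rewrite ?meval0 // mevalM rmorphXn rmorphN1 mevalXU.
  by rewrite rmorphM rmorphXn rmorphN1.
apply/eqP; rewrite intr_eq0_pchar0 {v}; move: ht hu tu; rewrite /in_hyp /hyp_pt.
case: t u => [[i j] b] [[i' j'] b'] /=; rewrite !xpair_eqE /=.
move: (o (f i)) (o (f i')) (f i == f j) (f i' == f j') => o1 o2 e1 e2.
rewrite -!val_eqE /=; move: (nat_of_ord i) (nat_of_ord j) (nat_of_ord i') (nat_of_ord j').
move=> {}i {}j {}i' {}j'.
case: (eqVneq i j) => ?; case: (eqVneq i' j') => ?; case: (eqVneq i' i) => ?;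
  case: (eqVneq j' i) => ?; case: (eqVneq j j') => ? /=;
  case: b b' => [] [] /=; rewrite ?expr1 ?expr0; lia.
Qed.

(** The reflection fixing the hyperplane is in the column group with character -1, while the
    substitution does not see it; hence the reduction equals its opposite. *)
Lemma hyp_subst_antisym f o t p : in_hyp f o t -> antisym f o p -> hyp_subst t p = 0.
Proof.
move=> ht ap; pose g : G := (tperm t.1.1 t.1.2,
  [ffun i => if t.1.1 == t.1.2 then i == t.1.1
             else t.2 && ((i == t.1.1) || (i == t.1.2))]).
have hg : g \in colgrp f.
  apply/colgrpP => i /=; move: ht; rewrite /in_hyp; case: eqP => [-> _|_ /andP[_ /eqP e]].
    by rewrite tperm1 perm1.
  by case: tpermP => [->|->|].
have cg : colchar K f o g = -1.
  rewrite /colchar odd_tperm /flip_sign; move: ht; rewrite /in_hyp.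
  case: eqP => [e /andP[/negPf b ot]|/eqP ne /andP[lt /eqP ef]].
    rewrite expr0 mul1r (bigD1 t.1.1) //= !ffunE e !eqxx /= -e ot expr1 big1 ?mulr1 //.
    by move=> i /negPf ni; rewrite ffunE ni.
  rewrite expr1 (bigD1 t.1.1) //= (bigD1 t.1.2) /=; last by rewrite eq_sym.
    rewrite big1.
    rewrite mulr1 !ffunE (negPf ne) !eqxx orbT andbT /= ef -signr_addb addbb.
    by rewrite expr0 mulr1.
  move=> i /andP[/negPf n1 /negPf n2].
  by rewrite ffunE (negPf ne) n1 n2 andbF.
have e : hyp_subst t (pact g p) = hyp_subst t p.
  apply: (@mpoly_rmorph_ext _ (hyp_subst t \o pact g) (hyp_subst t)) => [c|i] /=.
    by rewrite /pact comp_mpolyC.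
  rewrite pactX rmorphM rmorphXn rmorphN1 /= !hyp_substX !ffunE /hyp_rhs.
  case: (t.1.1 =P t.1.2) => [e|/eqP ne].
    by rewrite -e tperm1 perm1; case: eqP; rewrite ?mulr0 // expr0 mul1r.
  case: (tpermP t.1.1 t.1.2 i) => [->|->|/eqP/negPf-> /eqP/negPf->].
  - by rewrite eqxx (eq_sym t.1.2) (negPf ne) /= andbT.
  - rewrite !eqxx (eq_sym t.1.2) (negPf ne) /= andbT mulrA -signr_addb addbb.
    by rewrite expr0 mul1r.
  - by rewrite andbF expr0 mul1r.
move: e; rewrite ap // cg scaleN1r rmorphN => /eqP.
rewrite eq_sym -addr_eq0 -mulr2n -mulr_natl mulf_eq0 => /orP[|/eqP //].
have /pcharf0P h2 := K0.
by rewrite -mpolyC_nat mpolyC_eq0 h2.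
Qed.

Definition spl f o : poly :=
  (\prod_(i < n) \prod_(j < n | (i < j)%N && (f i == f j)) ('X_i ^+ 2 - 'X_j ^+ 2)) *
  \prod_(i | o (f i)) 'X_i.

Lemma spl_hyp f o : spl f o = \prod_(t | in_hyp f o t) hyp_form t.
Proof.
rewrite big_mkcond /= -(pair_bigA _ (fun ij b => if in_hyp f o (ij, b) then hyp_form (ij, b) else 1)) /=.
rewrite -(pair_bigA _ (fun i j => \prod_b if in_hyp f o (i, j, b) then hyp_form (i, j, b) else 1)) /=.
rewrite /spl [X in _ * X]big_mkcond -big_split; apply: eq_bigr => i _ /=.
rewrite [RHS](bigD1 i) //= [RHS]mulrC; congr (_ * _); last first.
  rewrite big_bool /in_hyp /hyp_form /hyp_rhs /= !eqxx /= mul1r subr0.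
  by [].
rewrite big_mkcond (bigD1 i) //= ltnn mul1r.
apply: eq_bigr => j /negPf ji; rewrite big_bool /in_hyp /hyp_form /hyp_rhs /= (eq_sym i) ji /=.
case: ifP => _; last by rewrite mulr1.
by rewrite expr1 expr0 mulN1r mul1r opprK subr_sqr mulrC.
Qed.

Lemma spl_dvd f o p : antisym f o p -> exists q, p = spl f o * q.
Proof.
move=> ap.
have [t|||||q ->] := @prod_dvd_of_vanish poly _ (enum (in_hyp f o)) hyp_form hyp_subst _ _ _ _ p.
- exact: rmorphM.
- exact: enum_uniq.
- by move=> t r _; apply: hyp_subst_ker.
- by move=> t u; rewrite !mem_enum; apply: hyp_subst_neq0.
- by move=> t; rewrite mem_enum => ht; apply: hyp_subst_antisym ap.
by exists q; rewrite spl_hyp big_enum.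
Qed.

Definition spldeg f o : nat :=
  (\sum_(i < n) \sum_(j < n | (i < j)%N && (f i == f j)) 2 + \sum_(i < n | o (f i)) 1)%N.

Lemma char0_natr k : (k%:R == 0 :> K) = (k == 0%N).
Proof. by have /pcharf0P := K0. Qed.

Lemma msize_prod (I : finType) (P : pred I) (F : I -> poly) (d : I -> nat) :
  (forall i, P i -> msize (F i) = (d i).+1) ->
  msize (\prod_(i | P i) F i) = (\sum_(i | P i) d i).+1.
Proof.
move=> hF; elim/big_rec2: _ => [|i a q Pi IH]; first exact: msize1.
have nz r e : msize r = e.+1 -> r != 0 :> poly.
  by move=> h; rewrite -msize_poly_eq0 h.
by rewrite msizeM ?(nz _ _ IH) ?(nz _ _ (hF _ Pi)) // hF // IH addSn addnS.
Qed.

Lemma msize_sqrB (i j : 'I_n) : i != j -> msize ('X_i ^+ 2 - 'X_j ^+ 2 : poly) = 3.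
Proof.
move=> ij; apply/eqP; rewrite eqn_leq; apply/andP; split.
  apply: leq_trans (msizeD_le _ _) _; rewrite msizeN !mpolyXn !msizeX.
  by rewrite !mdegMn !mdeg1 maxnn.
have : (U_(i) *+ 2)%MM \in msupp ('X_i ^+ 2 - 'X_j ^+ 2 : poly).
  rewrite mcoeff_msupp mcoeffB !mpolyXn !mcoeffX eqxx.
  rewrite [X in _ - (nat_of_bool X)%:R](_ : _ = false) ?subr0 ?oner_eq0 //.
  apply/eqP => /(congr1 (fun m : 'X_{1..n} => m i)).
  by rewrite !mulmnE !mnm1E eqxx eq_sym (negPf ij).
by move/msize_mdeg_lt; rewrite mdegMn mdeg1.
Qed.

Lemma msize_spl f o : msize (spl f o) = (spldeg f o).+1.
Proof.
have h1 : msize (\prod_(i < n) \prod_(j < n | (i < j)%N && (f i == f j))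
   ('X_i ^+ 2 - 'X_j ^+ 2) : poly) = (\sum_(i < n) \sum_(j < n | (i < j)%N && (f i == f j)) 2).+1.
  apply: msize_prod => i _; apply: msize_prod => j /andP[ij _].
  by rewrite msize_sqrB //; apply: contraTneq ij => ->; rewrite ltnn.
have h2 : msize (\prod_(i < n | o (f i)) 'X_i : poly) = (\sum_(i < n | o (f i)) 1).+1.
  by apply: msize_prod => i _; rewrite msizeX mdeg1.
by rewrite /spl msizeM -?msize_poly_eq0 ?h1 ?h2 // addSn addnS.
Qed.

Lemma spl_neq0 f o : spl f o != 0.
Proof. by rewrite -msize_poly_eq0 msize_spl. Qed.

(** The quotient by the Specht polynomial has degree at most 0. *)
Lemma antisym_spl f o p : antisym f o p -> (msize p <= (spldeg f o).+1)%N ->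
  exists c, p = c *: spl f o.
Proof.
move=> /spl_dvd[q ->]; have [->|q0] := eqVneq q 0.
  by exists 0; rewrite mulr0 scale0r.
rewrite msizeM ?spl_neq0 // msize_spl addSn /= -addn1 leq_add2l.
by move/msize1_polyC ->; exists (q@_0); rewrite mulrC mul_mpolyC.
Qed.

Lemma antisym_eq0 f o p : antisym f o p -> (msize p <= spldeg f o)%N -> p = 0.
Proof.
move=> /spl_dvd[q ->]; have [->|q0] := eqVneq q 0; first by rewrite mulr0.
rewrite msizeM ?spl_neq0 // msize_spl addSn /=.
by move: q0; rewrite -msize_poly_eq0 -lt0n => q0;
  rewrite -[X in (_ <= X)%N]addn0 leq_add2l leqNgt q0.
Qed.

Lemma msize_sum_le (I : Type) (r : seq I) (P : pred I) (F : I -> poly) d :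
  (forall i, P i -> (msize (F i) <= d)%N) -> (msize (\sum_(i <- r | P i) F i) <= d)%N.
Proof.
move=> hF; elim/big_ind: _ => // [|p q hp hq]; first by rewrite msize0.
by apply: leq_trans (msizeD_le _ _) _; rewrite geq_max hp.
Qed.

Lemma msize_alt f o p : (msize (alt f o p) <= msize p)%N.
Proof.
apply: msize_sum_le => g _.
by apply: leq_trans (msizeZ_le _ _) _; apply: msize_pact.
Qed.

Lemma alt_spl f o p : (msize p <= (spldeg f o).+1)%N ->
  exists c, alt f o p = c *: spl f o.
Proof.
move=> hp; apply: antisym_spl; first exact: alt_antisym.
exact: leq_trans (msize_alt _ _ _) hp.
Qed.

Lemma alt_eq0 f o p : (msize p <= spldeg f o)%N -> alt f o p = 0.
Proof.
move=> hp; apply: antisym_eq0; first exact: alt_antisym.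
exact: leq_trans (msize_alt _ _ _) hp.
Qed.

End Divisibility.

(** * Leading monomials and moves of boxes *)

Section Exponents.
Variables (K : fieldType) (n : nat).
Local Notation poly := {mpoly K[n]}.
Local Notation G := (hyperoct n).
Hypothesis K0 : [pchar K] =i pred0.
Implicit Types (g h : G) (p q : poly) (f : 'I_n -> 'I_n) (o : 'I_n -> bool) (m : 'X_{1..n}).

Definition fiber f (c : 'I_n) : {set 'I_n} := [set i | f i == c].

(* The exponents of a monomial of the Specht polynomial of a column labelling:
   in an even column they are 0, 2, 4, ..., in an odd one 1, 3, 5, ... *)
Definition col_exps f o (m : 'X_{1..n}) :=
  [/\ forall i, odd (m i) = o (f i),
      forall i j, f i = f j -> m i = m j -> i = j
    & forall i, (m i < 2 * #|fiber f (f i)| + o (f i))%N].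

Definition below f (i : 'I_n) := #|[set j : 'I_n | (j < i)%N && (f j == f i)]|.

Definition std_exps f o : 'X_{1..n} := [multinom (2 * below f i + o (f i))%N | i < n].

Lemma below_lt f i j : f i = f j -> (i < j)%N -> (below f i < below f j)%N.
Proof.
move=> e ij; apply: proper_card; apply/properP; split.
  by apply/fintype.subsetP => k; rewrite !inE e => /andP[/ltn_trans-> //].
by exists i; rewrite !inE ?ltnn // ij e eqxx.
Qed.

Lemma below_inj f i j : f i = f j -> below f i = below f j -> i = j.
Proof.
move=> e e2; case: (ltngtP i j) => [ij|ij|/val_inj //].
  by have := below_lt e ij; rewrite e2 ltnn.
by have := below_lt (esym e) ij; rewrite e2 ltnn.
Qed.

Lemma below_fiber f i : (below f i < #|fiber f (f i)|)%N.
Proof.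
apply: proper_card; apply/properP; split.
  by apply/fintype.subsetP => k; rewrite !inE => /andP[].
by exists i; rewrite !inE ?ltnn ?eqxx.
Qed.

Lemma std_col_exps f o : col_exps f o (std_exps f o).
Proof.
split=> [i|i j e|i]; rewrite !mnmE.
- by rewrite oddD mul2n odd_double oddb.
- by rewrite e => h; apply: (below_inj e); lia.
- by have := below_fiber f i; lia.
Qed.

(** By cardinality, [e] is a bijection from [A] onto the initial segment. *)
Lemma sum_inj_lt (I : finType) (A : {set I}) (e : I -> nat) :
  {in A &, injective e} -> {in A, forall i, (e i < #|A|)%N} ->
  (\sum_(i in A) e i = \sum_(0 <= v < #|A|) v)%N.
Proof.
move=> einj elt; rewrite -big_enum -(big_map e predT id) /=; apply: perm_big.
rewrite /index_iota subn0; apply: uniq_perm; rewrite ?iota_uniq //.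
  by rewrite map_inj_in_uniq ?enum_uniq // => i j; rewrite !mem_enum; apply: einj.
have u : uniq [seq e i | i <- enum A].
  by rewrite map_inj_in_uniq ?enum_uniq // => i j; rewrite !mem_enum; apply: einj.
have sub : {subset [seq e i | i <- enum A] <= iota 0 #|A|}.
  move=> v hv; case/mapP: hv => i; rewrite mem_enum => hi ->.
  by rewrite mem_iota elt.
have sz : (size (iota 0 #|A|) <= size [seq e i | i <- enum A])%N.
  by rewrite size_iota size_map -cardE.
by have [_ E] := uniq_min_size u sub sz; apply: E.
Qed.

Lemma sum_col_exps f o m : col_exps f o m ->
  mdeg m = (\sum_(c : 'I_n) (\sum_(0 <= v < #|fiber f c|) 2 * v + #|fiber f c| * o c))%N.
Proof.
case=> par inj lt; rewrite mdegE.
rewrite (eq_bigr (fun i => 2 * (m i)./2 + o (f i))%N) => [|i _]; last first.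
  by have := odd_double_half (m i); rewrite par; lia.
rewrite (partition_big f xpredT) //=; apply: eq_bigr => c _.
have E : (fun i => f i == c) =1 (fun i => i \in fiber f c) by move=> i; rewrite inE.
rewrite (eq_bigl _ _ E) big_split /= -!big_distrr /=; congr (2 * _ + _)%N.
  apply: (@sum_inj_lt _ (fiber f c) (fun i => (m i)./2)) => [i j|i].
    rewrite !inE => /eqP hi /eqP hj h; apply: inj; first by rewrite hi hj.
    by rewrite -(odd_double_half (m i)) -(odd_double_half (m j)) !par hi hj h.
  rewrite inE => /eqP hi; have := lt i; rewrite hi.
  by have := odd_double_half (m i); rewrite par hi; lia.
rewrite (eq_bigr (fun=> o c : nat)) => [|i]; first by rewrite sum_nat_const.
by rewrite inE => /eqP->.
Qed.

Lemma mdeg_std f o : mdeg (std_exps f o) = spldeg f o.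
Proof.
rewrite mdegE (eq_bigr (fun i => 2 * below f i + o (f i))%N) => [|i _]; last by rewrite mnmE.
rewrite big_split /=; congr addn; last by rewrite [RHS]big_mkcond; apply: eq_bigr => i _;
  case: (o _).
rewrite -big_distrr /= (exchange_big_dep xpredT) //= big_distrr /=.
apply: eq_bigr => i _; rewrite sum_nat_const mulnC; congr (_ * _)%N.
by apply: eq_card => j; rewrite !inE.
Qed.

(** In each column the exponents are a permutation of the standard ones, so the degree is the same
    for all these monomials. *)
Lemma mdeg_col_exps f o m : col_exps f o m -> mdeg m = spldeg f o.
Proof.
by move=> hm; rewrite -mdeg_std (sum_col_exps hm) (sum_col_exps (std_col_exps f o)).
Qed.

(** On a monomial with the parities of the tableaux, the sign changes act by the character itself;
    only the signature of the permutation is left. *)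
Lemma colchar_sign f o g m : (forall i, odd (m i) = o (f i)) ->
  colchar K f o g * mnm_sign K g m = (-1) ^+ (g.1 : bool).
Proof.
move=> par; rewrite /colchar /mnm_sign -mulrA.
rewrite [X in _ * (_ * X)](_ : _ = flip_sign K (o \o f) g).
  by rewrite flip_sign_sq mulr1.
by apply: eq_bigr => i _ /=; rewrite par.
Qed.

Lemma odd_mperm f o g m : (forall i, odd (m i) = o (f i)) -> g \in colgrp f ->
  forall i, odd ((m#(g.1)) i) = o (f i).
Proof. by move=> par /colgrpP hg i; rewrite mnmE par hg. Qed.

Lemma mcoeff_alt f o p m : (forall i, odd (m i) = o (f i)) ->
  (alt f o p)@_m = \sum_(g in colgrp f) (-1) ^+ (g.1 : bool) * p@_(m#(g.1)).
Proof.
move=> par; rewrite /alt raddf_sum; apply: eq_bigr => g hg /=.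
by rewrite mcoeffZ mcoeff_pact mulrA (colchar_sign _ (odd_mperm par hg)).
Qed.

Lemma alt_mnm f o m : (forall i, odd (m i) = o (f i)) ->
  alt f o 'X_[m] = \sum_(g in colgrp f) (-1) ^+ (g.1 : bool) *: 'X_[m#(g.1^-1)%g] :> poly.
Proof.
move=> par; apply: eq_bigr => g hg.
by rewrite pact_mnm scalerA (colchar_sign g par).
Qed.

(** The exponents within a column are distinct, so only pure sign changes bring the monomial back,
    each with coefficient 1: the coefficient is a positive integer. *)
Lemma alt_mnm_coeff f o m : col_exps f o m -> (alt f o 'X_[m] : poly)@_m != 0.
Proof.
case=> par inj _; rewrite mcoeff_alt //.
rewrite (eq_bigr (fun g : G => (g.1 == 1%g)%:R)) => [|g /colgrpP hg].
  rewrite -natr_sum (char0_natr K0) -lt0n (bigD1 1%g) ?colgrp1 //= eqxx.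
  exact: leq_addr.
rewrite mcoeffX; have [->|ne] := eqVneq g.1 1%g.
  by rewrite mperm1 eqxx odd_perm1 mulr1.
rewrite (_ : (m == _)%MM = false) ?mulr0 //; apply: contra_neqF ne => /eqP e.
apply/permP => i; rewrite perm1; apply: inj => //.
by rewrite [in RHS]e mnmE.
Qed.

Lemma alt_mnm_spl f o m : col_exps f o m ->
  exists2 c, c != 0 & alt f o 'X_[m] = c *: spl K f o.
Proof.
move=> hm; have [|c hc] := @alt_spl K n K0 f o 'X_[m].
  by rewrite msizeX (mdeg_col_exps hm).
exists c => //; apply: contraNneq (alt_mnm_coeff hm) => c0.
by rewrite hc c0 scale0r mcoeff0.
Qed.

Lemma spl_antisym f o : antisym f o (spl K f o).
Proof.
have [c c0 /(congr1 (fun p => c^-1 *: p))] := alt_mnm_spl (std_col_exps f o).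
by rewrite scalerA mulVf // scale1r => <-; apply/antisymZ/alt_antisym.
Qed.

Lemma pact_spl g f o :
  exists2 c, c != 0 & pact g (spl K f o) = c *: spl K (fun i => f ((g.1^-1)%g i)) o.
Proof.
set f' := (fun i => f _); have h0 := std_col_exps f o.
have hm : col_exps f' o ((std_exps f o)#(g.1^-1)%g).
  have [par inj lt] := h0; split=> [i|i j|i]; rewrite !(mnmE _ i) ?mnmE.
  - by have := par ((g.1^-1)%g i); rewrite mnmE.
  - move=> e h; apply: (@perm_inj _ (g.1^-1)%g); apply: inj e _.
    by rewrite !mnmE.
  - have := lt ((g.1^-1)%g i); rewrite mnmE => /leq_trans; apply.
    rewrite leq_add2r leq_pmul2l // -(card_imset _ (@perm_inj _ g.1)) subset_leq_card //.
    by apply/fintype.subsetP => _ /imsetP[j + ->]; rewrite !inE /f' permK.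
have [c c0 hc] := alt_mnm_spl h0; have [d d0 hd] := alt_mnm_spl hm.
exists (c^-1 * mnm_sign K g (std_exps f o) * d).
  rewrite !mulf_neq0 ?invr_eq0 //; have := flip_sign_sq K (fun i => odd (std_exps f o i)) g.
  by apply: contra_eq_neq => h; rewrite /mnm_sign in h; rewrite h mul0r eq_sym oner_eq0.
rewrite -scalerA -scalerA -hd -[in LHS](scale1r (spl K f o)) -(mulVf c0) -scalerA -hc.
by rewrite linearZ /= pact_alt pact_mnm linearZ.
Qed.

Lemma spldeg_relabel (s : 'S_n) f o : spldeg (fun i => f (s i)) o = spldeg f o.
Proof.
have [c c0 hc] := pact_spl ((s^-1)%g, [ffun=> false]) f o.
have := congr1 (fun p : poly => msize p) hc; rewrite /= msizeZ // msize_spl //.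
set g : G := (_, _) => h.
have : msize (pact g (spl K f o)) = (spldeg f o).+1.
  rewrite -(msize_spl K); apply/eqP; rewrite eqn_leq msize_pact /=.
  by rewrite -[X in (msize X <= _)%N](pactK g) msize_pact.
by rewrite h invgK => -[].
Qed.

Lemma spl_alt_mnm f o m : col_exps f o m ->
  exists2 c, c != 0 & spl K f o = c *: alt f o 'X_[m].
Proof.
move=> /alt_mnm_spl[c c0 ->]; exists c^-1; first by rewrite invr_eq0.
by rewrite scalerA mulVf // scale1r.
Qed.

Section InIdeal.
Variable (I : ideal poly).
Hypothesis hI : hyp_stable I.

Lemma idealZ c p : p \in I -> c *: p \in I.
Proof. by rewrite -mul_mpolyC; apply: idealM. Qed.

Lemma alt_ideal f o p : p \in I -> alt f o p \in I.
Proof. by move=> hp; apply: rpred_sum => g _; apply: idealZ; apply: hI. Qed.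

Lemma idealZ_inv c p : c != 0 -> c *: p \in I -> p \in I.
Proof. by move=> c0 /(idealZ c^-1); rewrite scalerA mulVf // scale1r. Qed.

(** The criterion behind every membership in [I] obtained by antisymmetrizing: for degree reasons
    the antisymmetrization is a scalar multiple of the Specht polynomial, and a single coefficient
    shows the scalar to be nonzero. *)
Lemma spl_coef_ideal f o p m : p \in I -> (msize p <= (spldeg f o).+1)%N ->
  (alt f o p)@_m != 0 -> spl K f o \in I.
Proof.
move=> /(alt_ideal f o) + hs; have [c ->] := alt_spl K0 hs.
rewrite mcoeffZ mulf_eq0 => + /norP[c0 _]; exact: idealZ_inv.
Qed.

(** * Moving a set of boxes to another column *)

Section Move.
Variables (f : 'I_n -> 'I_n) (o : 'I_n -> bool) (c1 c2 : 'I_n) (X : {set 'I_n}).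
Hypotheses (c12 : c1 != c2) (hX : X \subset fiber f c2).
Let f2 i := if i \in X then c1 else f i.
Let rk (i : 'I_n) := #|[set j : 'I_n | [&& (j < i)%N, f j == f i & (j \in X) == (i \in X)]]|.
Let B := #|fiber f c1|.
Let B' := #|fiber f c2 :\: X|.
Hypothesis up : (2 * B' + o c2 <= 2 * B + o c1)%N.
(** The shift from the lowest free exponent above the boxes left in [c2] to the lowest free exponent
    above column [c1]. In [mf] the set [X] takes the top exponents of [c2], so multiplying by the
    monomial of [a] puts [X] exactly on top of [c1]. *)
Let h := (2 * B + o c1 - (2 * B' + o c2))%N.
Let a : 'X_{1..n} := [multinom (if i \in X then h else 0)%N | i < n].
Let mf : 'X_{1..n} :=
  [multinom (2 * (rk i + (if i \in X then B' else 0)) + o (f i))%N | i < n].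

Let fX i : i \in X -> f i = c2.
Proof. by move/(fintype.subsetP hX); rewrite inE => /eqP. Qed.

Let cardX : #|fiber f c2| = (#|X| + B')%N.
Proof. by rewrite -(cardsID X (fiber f c2)) (finset.setIidPr hX). Qed.

Let cardf2 : #|fiber f2 c1| = (B + #|X|)%N.
Proof.
rewrite -(cardsID X) addnC; congr addn; apply: eq_card => i; rewrite !inE /f2.
  by case: ifP => [/fX->|]; rewrite ?eqxx // eq_sym (negPf c12).
by case: ifP; rewrite ?eqxx ?andbF.
Qed.

Let cardf2' c : c != c1 -> #|fiber f2 c| = #|fiber f c :\: X|.
Proof.
move=> hc; apply: eq_card => i; rewrite !inE /f2.
by case: ifP => //=; rewrite eq_sym (negPf hc).
Qed.

Let rk_lt i : (rk i < if i \in X then #|X| else #|fiber f (f i) :\: X|)%N.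
Proof.
case: ifP => hi; apply: proper_card; apply/properP; split.
- by apply/fintype.subsetP => j; rewrite !inE hi eqb_id => /and3P[].
- by exists i; rewrite // inE ltnn.
- by apply/fintype.subsetP => j; rewrite !inE hi eqbF_neg => /and3P[_ -> ->].
- by exists i; rewrite !inE ?ltnn // hi eqxx.
Qed.

Let rk_inj i j : f i = f j -> (i \in X) = (j \in X) -> rk i = rk j -> i = j.
Proof.
have lt k l : f k = f l -> (k \in X) = (l \in X) -> (k < l)%N -> (rk k < rk l)%N.
  move=> e1 e2 kl; apply: proper_card; apply/properP; split.
    apply/fintype.subsetP => t; rewrite !inE e1 e2 => /and3P[lt -> ->].
    by rewrite (ltn_trans lt kl).
  by exists k; rewrite !inE ?ltnn // kl e1 e2 !eqxx.
move=> e1 e2 e3; case: (ltngtP i j) => [ij|ij|/val_inj //].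
  by have := lt i j e1 e2 ij; rewrite e3 ltnn.
by have := lt j i (esym e1) (esym e2) ij; rewrite e3 ltnn.
Qed.

Let mfE i : mf i = (2 * (rk i + (if i \in X then B' else 0)) + o (f i))%N.
Proof. by rewrite mnmE. Qed.

Let amfE i : (a + mf)%MM i =
  (2 * (rk i + (if i \in X then B else 0)) + o (f2 i))%N.
Proof.
rewrite mnmDE mfE mnmE /f2; case: ifP => // /fX->.
by move: up; rewrite /h; lia.
Qed.

Let mf_exps : col_exps f o mf.
Proof.
split=> [i|i j e|i]; rewrite !mfE.
- by rewrite oddD mul2n odd_double oddb.
- rewrite e => hm; have hr : (rk i + (if i \in X then B' else 0) =
  rk j + (if j \in X then B' else 0))%N by lia.
  have := rk_lt i; have := rk_lt j; move: hr.
  case: (boolP (i \in X)) => hi; case: (boolP (j \in X)) => hj.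
  + by move=> hr _ _; apply: rk_inj; rewrite ?hi ?hj //; lia.
  + by rewrite -e (fX hi) -/B'; lia.
  + by rewrite e (fX hj) -/B'; lia.
  + by move=> hr _ _; apply: rk_inj; rewrite ?(negPf hi) ?(negPf hj) //; lia.
- have := rk_lt i; case: (boolP (i \in X)) => hi; first by rewrite (fX hi) cardX; lia.
  by have := subset_leq_card (subsetDl (fiber f (f i)) X); lia.
Qed.

Let amf_exps : col_exps f2 o (a + mf)%MM.
Proof.
split=> [i|i j e|i]; rewrite !amfE.
- by rewrite oddD mul2n odd_double oddb.
- rewrite e => hm; have hr : (rk i + (if i \in X then B else 0) =
  rk j + (if j \in X then B else 0))%N by lia.
  have := rk_lt i; have := rk_lt j; move: hr e; rewrite /f2.
  case: (boolP (i \in X)) => hi; case: (boolP (j \in X)) => hj.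
  + by move=> hr _ _ _; apply: rk_inj; rewrite ?hi ?hj ?fX //; lia.
  + move=> hr <-; have := subset_leq_card (subsetDl (fiber f c1) X); rewrite -/B; lia.
  + move=> hr ->; have := subset_leq_card (subsetDl (fiber f c1) X); rewrite -/B; lia.
  + by move=> hr e _ _; apply: rk_inj; rewrite ?(negPf hi) ?(negPf hj) //; lia.
- have := rk_lt i; rewrite /f2; case: (boolP (i \in X)) => hi; first by rewrite cardf2; lia.
  have := subset_leq_card (subsetDl (fiber f (f i)) X).
  have [->|ne] := eqVneq (f i) c1; first by rewrite cardf2 -/B; lia.
  by rewrite cardf2'; lia.
Qed.

(** Size estimates on the exponents force both permutations to preserve [X]; the equality of
    exponents then holds without the shift, and injectivity within columns identifies [s] with
    [t]. *)
Let move_uniq (s t : 'S_n) : (forall i, f (s i) = f i) -> (forall i, f2 (t i) = f2 i) ->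
  (forall i, a i + mf (s i) = (a + mf)%MM (t i))%N -> s = t.
Proof.
move=> hs ht hst.
have ltB i : f i = c1 -> i \notin X -> (rk i < B)%N.
  move=> e hi; have := rk_lt i; rewrite (negPf hi) e.
  by have := subset_leq_card (subsetDl (fiber f c1) X); rewrite -/B; lia.
have tX i : i \in X -> t i \in X.
  move=> hi; apply/negPn/negP => hti.
  have [_ inj _] := amf_exps.
  (* t maps the part of the column outside X into itself, hence X too *)
  have sub : [set t j | j in fiber f c1] \subset fiber f c1.
    apply/fintype.subsetP => _ /imsetP[j + ->]; rewrite !inE => /eqP hj.
    have jX : j \notin X by apply: contraNN c12 => /fX; rewrite hj => ->.
    have := ht j; rewrite /f2 (negPf jX) hj; case: ifP => [tjX _|_ ->] //.
    have := hst j; rewrite amfE mfE mnmE (negPf jX) tjX.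
    have sjX : s j \notin X by apply: contraNN c12 => /fX; rewrite hs hj => ->.
    by rewrite (negPf sjX) /f2 tjX hs hj; have := @ltB (s j); rewrite hs hj => /(_ erefl sjX); lia.
  have /eqP E : [set t j | j in fiber f c1] == fiber f c1.
    by rewrite eqEcard sub card_imset ?leqnn //; apply: perm_inj.
  have := ht i; rewrite /f2 hi (negPf hti) => fti.
  have : t i \in fiber f c1 by rewrite inE fti.
  rewrite -E => /imsetP[j hj /perm_inj e]; move: hj; rewrite -e inE (fX hi) => /eqP h1.
  by move: c12; rewrite h1 eqxx.
have tXE i : (t i \in X) = (i \in X).
  have E : [set t j | j in X] = X.
    apply/eqP; rewrite eqEcard card_imset ?leqnn ?andbT; last exact: perm_inj.
    by apply/fintype.subsetP => _ /imsetP[j hj ->]; apply: tX.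
  apply/idP/idP => [|/tX //]; rewrite -{1}E => /imsetP[j hj /perm_inj-> //].
(* Otherwise the exponent at [s i] is below [2 * B' + o c2], and after the shift [h] still below
   every exponent of [X] in column [c1]. *)
have sX i : i \in X -> s i \in X.
  move=> hi; apply/negPn/negP => hsi.
  have := hst i; rewrite amfE mfE mnmE tXE hi (negPf hsi) hs (fX hi) /f2 tXE hi.
  have := rk_lt (s i); rewrite (negPf hsi) hs (fX hi) -/B'.
  by move: up; rewrite /h; lia.
have sXE i : (s i \in X) = (i \in X).
  have E : [set s j | j in X] = X.
    apply/eqP; rewrite eqEcard card_imset ?leqnn ?andbT; last exact: perm_inj.
    by apply/fintype.subsetP => _ /imsetP[j hj ->]; apply: sX.
  apply/idP/idP => [|/sX //]; rewrite -{1}E => /imsetP[j hj /perm_inj-> //].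
apply/permP => i; have [_ inj _] := amf_exps; apply: inj.
  by rewrite ht /f2 sXE hs.
by rewrite -hst mnmDE !(mnmE _ i) [in LHS]mnmE sXE.
Qed.

Lemma move_ideal : spl K f o \in I -> spl K f2 o \in I.
Proof.
have [c c0 ->] := spl_alt_mnm mf_exps; move=> /(idealZ_inv c0) hin.
apply: (@spl_coef_ideal f2 o ('X_[a] * alt f o 'X_[mf]) (a + mf)%MM).
- exact: idealM.
- rewrite -(mdeg_col_exps amf_exps) mdegD.
  have -> : 'X_[a] * alt f o 'X_[mf] =
    \sum_(g in colgrp f) (-1) ^+ (g.1 : bool) *: 'X_[a + mf#(g.1^-1)%g] :> poly.
    have [par _ _] := mf_exps; rewrite alt_mnm // mulr_sumr; apply: eq_bigr => g _.
    by rewrite -scalerAr mpolyXD.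
  apply: msize_sum_le => g _; apply: leq_trans (msizeZ_le _ _) _.
  by rewrite msizeX mdegD mdeg_mperm.
have [par _ _] := mf_exps; have [par2 _ _] := amf_exps.
rewrite mcoeff_alt // alt_mnm //.
(* By [move_uniq] the two signatures cancel in every contributing pair, so the coefficient counts
   pairs, among them the pair of identities. *)
pose D (s t : G) : nat := ((a + mf#(s.1^-1)%g)%MM == (a + mf)%MM#(t.1)).
rewrite (eq_bigr (fun t : G => (\sum_(s in colgrp f) D s t)%:R)) => [|t /colgrpP ht].
  rewrite -natr_sum (char0_natr K0) -lt0n (bigD1 1%g) ?colgrp1 //=.
  rewrite (bigD1 1%g) ?colgrp1 //= /D invg1.
  by rewrite (_ : _ == _) //; apply/eqP/mnmP => i; rewrite !(mnmDE, mnmE) !perm1.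
rewrite mulr_sumr raddf_sum /= mulr_sumr natr_sum; apply: eq_bigr => s /colgrpV/colgrpP hs /=.
rewrite -scalerAr mcoeffZ -mpolyXD mcoeffX mulrA -signr_addb /D.
case: eqP => [e|_]; last by rewrite mulr0.
rewrite -(@move_uniq (s.1^-1)%g t.1) // ?odd_permV ?addbb ?mulr1 // => i.
by move/mnmP: e => /(_ i); rewrite mnmDE !(mnmE _ i).
Qed.

End Move.

End InIdeal.

End Exponents.

(* A column of key u has u./2 boxes, of exponents u - 2, u - 4, ...; hence
   psi u k is the number of boxes of exponent at least k. *)
(** * Chains of moves *)

Section Keys.
Variable L : finType.
Implicit Types (u t : L -> nat).

Definition psi u k := (\sum_c (u c - k)./2)%N.
Definition above u k := #|[set c | (k <= u c)%N]|.

Lemma psiSS u k : psi u k = (psi u k.+2 + above u k.+2)%N.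
Proof.
rewrite /above -sum1dep_card big_mkcond -big_split; apply: eq_bigr => c _ /=.
by case: leqP; lia.
Qed.

Lemma above_le u k l : (k <= l)%N -> (above u l <= above u k)%N.
Proof.
move=> kl; apply/subset_leq_card/fintype.subsetP => c; rewrite !inE.
exact: leq_trans.
Qed.

Lemma psi_large u k : (forall c, u c <= k)%N -> psi u k = 0%N.
Proof. by move=> h; apply: big1 => c _; have := h c; lia. Qed.

Lemma above_between u k l : (above u l < above u k)%N ->
  exists2 c, (k <= u c)%N & (u c < l)%N.
Proof.
move=> h; have : ~~ ([set c | (k <= u c)%N] \subset [set c | (l <= u c)%N]).
  by apply: contraTN h => /subset_leq_card; rewrite -leqNgt.
by case/subsetPn => c; rewrite !inE -ltnNge; exists c.
Qed.

Lemma above_between2 u k l : (above u l + 2 <= above u k)%N ->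
  exists x y, [/\ x != y, (k <= u y)%N, (u y <= u x)%N & (u x < l)%N].
Proof.
move=> h; have kl : (k <= l)%N.
  by case: leqP => // /ltnW/(above_le u); lia.
have : (1 < #|[set c | (k <= u c)%N] :\: [set c | (l <= u c)%N]|)%N.
  rewrite cardsD (finset.setIidPr _); first by rewrite /above in h; lia.
  by apply/fintype.subsetP => c; rewrite !inE; apply: leq_trans.
case/card_gt1P => x [y []]; rewrite !inE -!ltnNge => /andP[x1 x2] /andP[y1 y2] xy.
case: (leqP (u y) (u x)) => [le|/ltnW le]; first by exists x, y.
by exists y, x; rewrite eq_sym.
Qed.

(** The alternatives are the elementary moves, each with its effect on [psi]. First, a box goes from
    [b] to a column [a] of the same parity at least as long: keys [u a + 2] and [u b - 2]. Second,
    for opposite parities, the keys become [u a + 1] and [u b - 1]. Third, an even column becomes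
    odd: key [u a + 1]. *)
Lemma key_move u t :
  (forall k, psi u k <= psi t k)%N -> psi u 0 = psi t 0 ->
  (exists k, psi u k != psi t k) ->
  [\/ exists a b, [/\ a != b, odd (u a) = odd (u b), (2 <= u b <= u a)%N
        & forall k, (psi u k + ((u b).-1 <= k <= u a) <= psi t k)%N],
      exists a b, [/\ odd (u a) = ~~ odd (u b), (2 <= u b < u a)%N
        & forall k, (psi u k + [&& odd k == odd (u b), u b <= k & k < u a] <= psi t k)%N]
    | exists a, [/\ ~~ odd (u a), (2 <= u a)%N
        & forall k, (psi u k + (odd k && (k < u a)) <= psi t k)%N]].
Proof.
move=> le e0 [K0 neK0]; pose z k := psi u k == psi t k.
have zP k : ~~ z k -> (psi u k < psi t k)%N by rewrite ltn_neqAle le andbT.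
have addb_le (b : bool) k : (b -> ~~ z k) -> (psi u k + b <= psi t k)%N.
  by case: b => [/(_ isT)/zP|_]; rewrite ?addn1 ?addn0.
have z0 : z 0%N by rewrite /z e0.
pose M := (\max_c u c + \max_c t c)%N.
have zM k : (M <= k)%N -> z k.
  move=> hk; rewrite /z !psi_large // => c; apply: leq_trans hk.
    by apply: leq_trans (leq_bigmax c) (leq_addl _ _).
  by apply: leq_trans (leq_bigmax c) (leq_addr _ _).
have up k : z k -> ~~ z k.+2 -> (above t k.+2 < above u k.+2)%N.
  by move=> /eqP + /zP; rewrite (psiSS u) (psiSS t); lia.
have dn k : ~~ z k -> z k.+2 -> (above u k.+2 < above t k.+2)%N.
  by move=> /zP + /eqP; rewrite (psiSS u) (psiSS t); lia.
have eqz k : z k -> z k.+2 -> above u k.+2 = above t k.+2.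
  by move=> /eqP + /eqP; rewrite (psiSS u) (psiSS t); lia.
(* With two consecutive strict inequalities, take the maximal interval of strict inequalities around
   them. Since [psi] drops by [above] over two steps, comparing [above] at its ends gives two
   columns with keys inside, to which the first or the second move applies. *)
case: (pselect (exists k, ~~ z k && ~~ z k.+1)) => [[k1 /andP[nz1 nz2]]|iso].
  have ea : exists k, z k && (k <= k1)%N by exists 0%N; rewrite z0.
  have ba k : z k && (k <= k1)%N -> (k <= k1)%N by case/andP.
  case: (ex_maxnP ea ba) => a /andP[za ak1] amax.
  have eb : exists k, z k && (k1 < k)%N by exists (M + k1).+1; rewrite zM; lia.
  case: (ex_minnP eb) => b /andP[zb bk1] bmin.
  have nz k : (a < k < b)%N -> ~~ z k.
    move=> /andP[ak kb]; apply/negP => zk; case: (leqP k k1) => h.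
      by have := amax k; rewrite zk h => /(_ isT); lia.
    by have := bmin k; rewrite zk h => /(_ isT); lia.
  have ak2 : (a < k1)%N by rewrite ltn_neqAle ak1 andbT; apply: contraNneq nz1 => <-.
  have bk2 : (k1.+1 < b)%N by rewrite ltn_neqAle bk1 andbT; apply: contraNneq nz2 => ->.
  have [b' def_b] : exists b', b = b'.+2 by exists b.-2; lia.
  have h1 := up a za (nz a.+2 _); have h2 := dn b' (nz b' _).
  rewrite def_b in zb nz bk2 h2 *.
  have [|x [y [xy y1 yx x1]]] := @above_between2 u a.+2 b'.+2.
    have := h1; have := h2 _ zb; have := @above_le t a.+2 b'.+2; lia.
  have [e|ne] := eqVneq (odd (u x)) (odd (u y)).
    constructor 1; exists x, y; split=> // [|k]; first by lia.
    by apply: addb_le => h; apply: nz; lia.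
  constructor 2; exists x, y; split=> [||k].
  - by move: ne; case: (odd (u x)) (odd (u y)) => [] [].
  - suff : u x != u y by lia.
    by apply: contraNneq ne => ->.
  - by apply: addb_le => /and3P[_ h3 h4]; apply: nz; lia.
have iso' k : ~~ z k -> z k.+1 by move=> h; apply/negPn/negP => h'; apply: iso; exists k; rewrite h.
have iso'' k : ~~ z k.+1 -> z k by move=> h; apply/negPn/negP => h'; apply: iso; exists k;
  rewrite h'.
(* Strict inequalities are now isolated, so follow the run through [K0] by steps of 2. Equality at
   the neighbours of an end of the run yields a column whose key is exactly determined by that
   end. *)
have K1 : (0 < K0)%N by case: K0 neK0 => //; rewrite e0 eqxx.
have eb : exists j, z (K0 + 2 * j)%N by exists M; apply: zM; lia.
case: (ex_minnP eb) => [[|j] zj jmin]; first by move: zj; rewrite muln0 addn0 /z (negPf neK0).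
have nzb i : (i <= j)%N -> ~~ z (K0 + 2 * i)%N.
  by move=> ij; apply/negP => /jmin; lia.
have [b def_b] : exists b, (K0 + 2 * j = b.+1)%N by exists (K0 + 2 * j).-1; lia.
have nb : ~~ z b.+1 by rewrite -def_b; apply: nzb.
have zb : z b.+3 by rewrite (_ : b.+3 = (K0 + 2 * j.+1)%N) //; lia.
have [c c1 c2] : exists2 c, (b.+2 <= u c)%N & (u c < b.+3)%N.
  apply: above_between; rewrite (eqz b (iso'' _ nb) (iso' _ nb)).
  by apply: leq_trans (dn _ nb zb) _; apply: above_le.
have {c1 c2} uc : u c = b.+2 by lia.
case: (pselect (exists i, (2 * i <= K0)%N && z (K0 - 2 * i)%N)) => [ea|noa].
  case: (ex_minnP ea) => [[|i] /andP[iK zi] imin].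
    by move: zi; rewrite muln0 subn0 /z (negPf neK0).
  have nza l : (l <= i)%N -> ~~ z (K0 - 2 * l)%N.
    by move=> li; apply/negP => zl; have := imin l; rewrite zl; lia.
  pose a := (K0 - 2 * i.+1)%N; have na : ~~ z a.+2.
    by rewrite (_ : a.+2 = (K0 - 2 * i)%N) ?nza // /a; lia.
  have [d d1 d2] : exists2 d, (a.+2 <= u d)%N & (u d < a.+3)%N.
    apply: above_between; rewrite (eqz a.+1 (iso'' _ na) (iso' _ na)).
    by apply: leq_ltn_trans (up _ zi na); apply: above_le.
  have {d1 d2} ud : u d = a.+2 by lia.
  have par : odd b = ~~ odd a.
    have -> : b = (a + 2 * (i + j) + 1)%N by rewrite /a; lia.
    by rewrite addn1 /= oddD mul2n odd_double addbF.
  constructor 2; exists c, d; rewrite uc ud; split=> [||k].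
  - by rewrite /= par.
  - by rewrite /a; lia.
  apply: addb_le => /and3P[/eqP hk h1 h2].
  have {}hk : odd k = odd K0.
    by rewrite hk /= negbK /a oddB ?mul2n ?odd_double ?addbF //; lia.
  case: (leqP k K0) => h.
    have -> : k = (K0 - 2 * ((K0 - k)./2))%N by lia.
    by apply: nza; rewrite /a in h1; lia.
  have -> : k = (K0 + 2 * ((k - K0)./2))%N by lia.
  by apply: nzb; lia.
(* The run never meets an equality going down. As equality holds at 0, it consists of odd numbers
   and reaches 1, which is the range of the third move. *)
have oK : odd K0.
  apply/negPn/negP => eK; apply: noa; exists (K0./2).
  by rewrite (_ : (K0 - _)%N = 0%N) ?z0; lia.
constructor 3; exists c; rewrite uc; split=> // [|k].
  by rewrite /= negbK; have : odd (K0 + 2 * j) by [rewrite oddD mul2n odd_double oK]; rewrite def_b.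
apply: addb_le => /andP[hk h2]; case: (leqP k K0) => h.
  apply/negP => zk; apply: noa; exists ((K0 - k)./2).
  have -> : (K0 - 2 * (K0 - k)./2)%N = k by lia.
  by rewrite zk andbT; lia.
have -> : k = (K0 + 2 * ((k - K0)./2))%N by lia.
by apply: nzb; lia.
Qed.

End Keys.

Lemma perm_of_fibers (n : nat) (A : eqType) (f g : 'I_n -> A) :
  (forall a, #|[set i | f i == a]| = #|[set i | g i == a]|) ->
  exists s : 'S_n, forall i, f i = g (s i).
Proof.
move=> h; have : perm_eq [tuple f i | i < n] [tuple g i | i < n].
  have E (k : 'I_n -> A) a : count_mem a [tuple k i | i < n] = #|[set i | k i == a]|.
    rewrite /= count_map -size_filter cardsE cardE /enum_mem; congr size.
    by rewrite -filter_predI; apply: eq_filter => i; rewrite !inE ?andbT.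
  by apply/seq.allP => a _; apply/eqP; rewrite [LHS]E [RHS]E.
case/tuple_permP => s /= e; exists s => i.
have {}e : [seq f i | i <- enum 'I_n] = [seq g (s i) | i <- enum 'I_n].
  by rewrite e; apply: eq_map => j; rewrite tnth_mktuple.
by move/eq_in_map: e => /(_ i); apply; rewrite mem_enum.
Qed.

Section Chain.
Variables (K : fieldType) (n : nat).
Local Notation poly := {mpoly K[n]}.
Local Notation G := (hyperoct n).
Hypothesis K0 : [pchar K] =i pred0.
Variable I : ideal poly.
Hypothesis hI : hyp_stable I.
Implicit Types (f : 'I_n -> 'I_n) (o : 'I_n -> bool).

Definition key f o (c : 'I_n) := (2 * #|fiber f c| + o c)%N.

Lemma key_half f o c : (key f o c)./2 = #|fiber f c|.
Proof. by rewrite /key; case: (o c); lia. Qed.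

Lemma key_odd f o c : odd (key f o c) = o c.
Proof. by rewrite /key oddD mul2n odd_double oddb. Qed.

Lemma sum_fibers f : (\sum_c #|fiber f c|)%N = n.
Proof.
rewrite -[RHS]card_ord -[in RHS]sum1_card [RHS](partition_big f xpredT) //=.
apply: eq_bigr => c _; rewrite -sum1_card; apply: eq_bigl => i.
by rewrite inE.
Qed.

Lemma psi0 f o : psi (key f o) 0 = n.
Proof. by rewrite -[RHS](sum_fibers f); apply: eq_bigr => c _; rewrite subn0 key_half. Qed.

(** By [psiSS], [psi] determines the multiset of keys that are at least 2, that is the shape;
    labellings of the same shape are conjugate under permutations of the variables. *)
Lemma spl_relabel_ideal f o f' o' :
  (forall k, psi (key f o) k = psi (key f' o') k) ->
  spl K f o \in I -> spl K f' o' \in I.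
Proof.
move=> e hs; pose u := key f o; pose t := key f' o'.
have eab k : (2 <= k)%N -> above u k = above t k.
  case: k => [|[|k]] // _; have := psiSS u k; have := psiSS t k.
  by have := e k; have := e k.+2; rewrite -/u -/t; lia.
(* Keys 0 and 1 both describe an empty column and are identified, since [psi] does not separate
   them. *)
pose z (v : 'I_n -> nat) c := if (v c < 2)%N then 0%N else v c.
have cz v k : (2 <= k)%N -> #|[set c | z v c == k]| = (above v k - above v k.+1)%N.
  move=> k2; rewrite /above -[in RHS](cardsID [set c | (k.+1 <= v c)%N] [set c | (k <= v c)%N]).
  rewrite (finset.setIidPr _); last by apply/fintype.subsetP => c; rewrite !inE => /ltnW.
  by rewrite addKn; apply: eq_card => c; rewrite !inE /z; case: ltnP; lia.
have cz0 v : #|[set c | z v c == 0%N]| = (n - above v 2)%N.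
  rewrite -[X in (X - _)%N]card_ord -(cardsC [set c | (2 <= v c)%N]) addKn.
  by apply: eq_card => c; rewrite !inE /z; case: ltnP; lia.
have [pi hpi] : exists s : 'S_n, forall c, z u c = z t (s c).
  apply: perm_of_fibers => k; case: k => [|[|k]].
  - by rewrite !cz0 eab.
  - have z1 v c : (z v c == 1%N) = false by rewrite /z; case: ltnP => // ?; lia.
    by apply: eq_card => c; rewrite !inE !z1.
  - by rewrite !cz ?eab.
have zf v c : z v c = 0%N -> (v c)./2 = 0%N by rewrite /z; case: ltnP; lia.
have [s hs2] : exists s : 'S_n, forall i, pi (f i) = f' (s i).
  apply: perm_of_fibers => c.
  have -> : #|[set i | pi (f i) == c]| = #|fiber f ((pi^-1)%g c)|.
    apply: eq_card => i; rewrite !inE.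
    by apply/eqP/eqP => [<-|->]; rewrite ?permK ?permKV.
  rewrite -/(fiber f' c) -(key_half f o) -(key_half f' o') -/u -/t.
  have := hpi ((pi^-1)%g c); rewrite permKV.
  rewrite /z; move: (u _) (t c) => x y.
  by case: (ltnP x 2) => ?; case: (ltnP y 2) => ?; lia.
have ho i : o' (f' (s i)) = o (f i).
  have h2 : (2 <= u (f i))%N.
    have : (0 < #|fiber f (f i)|)%N by apply/card_gt0P; exists i; rewrite inE.
    by rewrite /u /key; lia.
  rewrite -hs2 -(key_odd f o) -(key_odd f' o') -/u -/t.
  have := hpi (f i); rewrite /z; move: (u (f i)) (t (pi (f i))) h2 => x y h2.
  by case: (ltnP x 2) => ?; case: (ltnP y 2) => ?; lia.
have [c c0 hc] := pact_spl K0 (s, [ffun=> false]) f o.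
have := hI (s, [ffun=> false]) hs; rewrite hc => /(idealZ_inv c0).
have -> // : spl K (fun i => f (((s, [ffun=> false]) : G).1^-1%g i)) o = spl K f' o'.
have eo i : o (f ((s^-1)%g i)) = o' (f' i) by rewrite -ho permKV.
rewrite /spl /=; congr (_ * _); last by apply: eq_bigl.
apply: eq_bigr => i _; apply: eq_bigl => j; congr (_ && _).
by rewrite -[in RHS](permKV s i) -[in RHS](permKV s j) -!hs2 (inj_eq perm_inj).
Qed.

Lemma card_fiber_move f (c1 c2 c : 'I_n) (X : {set 'I_n}) : c1 != c2 ->
  X \subset fiber f c2 ->
  #|fiber (fun i => if i \in X then c1 else f i) c| =
  (#|fiber f c| + (c == c1) * #|X| - (c == c2) * #|X|)%N.
Proof.
move=> c12 hX; have fX i : i \in X -> f i = c2.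
  by move/(fintype.subsetP hX); rewrite inE => /eqP.
have [->|n1] := eqVneq c c1.
  rewrite (negPf c12) mul0n mul1n subn0 -(cardsID X) addnC; congr addn; apply: eq_card => i;
    rewrite !inE.
    case: ifP => /=; rewrite ?eqxx //; rewrite ?andbT //.
    by move/fX->; rewrite eq_sym (negPf c12).
  by case: ifP; rewrite ?eqxx ?andbF.
rewrite mul0n addn0; have [->|n2] := eqVneq c c2.
  rewrite mul1n -[in RHS](cardsID X (fiber f c2)) (finset.setIidPr hX) addKn.
  by apply: eq_card => i; rewrite !inE; case: ifP => //=; rewrite (negPf c12).
rewrite mul0n subn0; apply: eq_card => i; rewrite !inE; case: ifP => // /fX->.
by rewrite eq_sym (negPf n1) eq_sym (negPf n2).
Qed.

Lemma psi_change (L : finType) (u v : L -> nat) (a b : L) k : a != b ->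
  (forall c, c != a -> c != b -> v c = u c) ->
  (psi v k + ((u a - k)./2 + (u b - k)./2) =
   psi u k + ((v a - k)./2 + (v b - k)./2))%N.
Proof.
move=> ab h; rewrite /psi (bigD1 a) //= (bigD1 b) 1?eq_sym //=.
rewrite [in RHS](bigD1 a) //= [in RHS](bigD1 b) 1?eq_sym //=.
rewrite (eq_bigr (fun c => (u c - k)./2)) => [|c /andP[ca cb]]; last by rewrite h.
by lia.
Qed.

Lemma subset_of_card (T : finType) (A : {set T}) k : (k <= #|A|)%N ->
  exists2 X : {set T}, X \subset A & #|X| = k.
Proof.
move=> hk; exists [set x in take k (enum A)].
  by apply/fintype.subsetP => x; rewrite inE => /mem_take; rewrite mem_enum.
rewrite cardsE; have /card_uniqP -> : uniq (take k (enum A)) by rewrite take_uniq ?enum_uniq.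
by rewrite size_takel -?cardE.
Qed.

Lemma spl_move_ideal f o c1 c2 x : c1 != c2 -> (x <= #|fiber f c2|)%N ->
  (key f o c2 - 2 * x <= key f o c1)%N -> spl K f o \in I ->
  exists f', [/\ spl K f' o \in I, key f' o c1 = (key f o c1 + 2 * x)%N,
    key f' o c2 = (key f o c2 - 2 * x)%N
    & forall c, c != c1 -> c != c2 -> key f' o c = key f o c].
Proof.
move=> c12 hx up hs; have [X sX cX] := subset_of_card hx.
exists (fun i => if i \in X then c1 else f i); rewrite /key !(card_fiber_move _ c12 sX).
rewrite !eqxx [c2 == c1]eq_sym (negPf c12) cX; split; [|lia|lia|].
  apply: (move_ideal K0 hI c12 sX _ hs); rewrite cardsD (finset.setIidPr sX) cX.
  by move: up; rewrite /key; lia.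
by move=> c n1 n2; rewrite (card_fiber_move _ c12 sX) (negPf n1) (negPf n2); lia.
Qed.

(** Induction on the total defect of [psi]: as long as it is positive, [key_move] provides a move
    that stays below the target and decreases it. *)
Lemma spl_ideal_up f o f' o' :
  (forall k, psi (key f o) k <= psi (key f' o') k)%N ->
  spl K f o \in I -> spl K f' o' \in I.
Proof.
(* Keys are at most [2 * n + 1], hence [psi] vanishes from [M] on and the defect is a finite sum. *)
pose M := (2 * n).+2; pose t := key f' o'.
have keyM g p c : (key g p c < M)%N.
  have : (#|fiber g c| <= n)%N by rewrite -[X in (_ <= X)%N]card_ord max_card.
  by rewrite /key /M; case: (p c); lia.
move: {2}(\sum_(k < M) (psi t k - psi (key f o) k))%N.+1 (ltnSn (\sum_(k < M) (psi t k - psi (key f o) k))%N) => d.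
elim: d f o => // d IHd f o hd le hs; pose u := key f o.
case: (pselect (exists k, psi u k != psi t k)) => [ne|eq]; last first.
  apply: spl_relabel_ideal hs => k; apply/eqP/negPn/negP => h.
  by apply: eq; exists k.
have step g p k : spl K g p \in I -> (forall k, psi (key g p) k <= psi t k)%N ->
   (forall k, psi u k <= psi (key g p) k)%N -> (k < M)%N -> (psi u k < psi (key g p) k)%N ->
   spl K f' o' \in I.
  move=> hg leg geg kM lt; apply: (IHd g p) => //.
  rewrite -ltnS; apply: leq_trans hd;
    rewrite ltnS (bigD1 (Ordinal kM)) // [X in (_ < X)%N](bigD1 (Ordinal kM)) //=.
  rewrite -addSn; apply: leq_add; first by have := leg k; rewrite -/u; lia.
  by apply: leq_sum => i _; apply: leq_sub2l; apply: geg.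
have e0 : psi u 0 = psi t 0 by rewrite !psi0.
case: (@key_move _ u t le e0 ne) => [[a [b [ab par /andP[b2 ba] h]]]|[a [b [par /andP[b2 ba] h]]]|[a [ev a2 h]]].
- have [||g [hg ga gb gc]] := @spl_move_ideal f o a b 1%N ab _ _ hs.
  + by move: b2; rewrite /u /key; case: (o b); lia.
  + by rewrite -/u; lia.
  have E k : psi (key g o) k = (psi u k + ((u b).-1 <= k <= u a))%N.
    have := psi_change k ab gc; rewrite ga gb -/u.
    move: ba b2; rewrite -/u; case: leqP; case: leqP => /=; lia.
  apply: (step g o (u a)) => // [k|k||]; rewrite ?E ?keyM //; first exact: leq_addr.
  by move: ba; lia.
- have ab : a != b by apply: contraTneq ba => ->; rewrite ltnn.
  (* Columns keep their tableau in a move of boxes, so the wanted keys are obtained in the opposite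
     order: moving [x] boxes gives [u a + 1] to [b] and [u b - 1] to [a]. *)
  pose x := ((u a).+1 - u b)./2.
  have hx : (2 * x = (u a).+1 - u b)%N by move: par; rewrite /x; lia.
  have [|||g [hg gb ga gc]] := @spl_move_ideal f o b a x _ _ _ hs.
  + by rewrite eq_sym.
  + by move: hx b2; rewrite /u /key; case: (o a); lia.
  + by rewrite -/u; lia.
  have {}gc c : c != a -> c != b -> key g o c = u c by move=> h1 h2; apply: gc.
  have E k : psi (key g o) k = (psi u k + [&& odd k == odd (u b), u b <= k & k < u a])%N.
    have := psi_change k ab gc; rewrite ga gb -/u hx.
    have -> : (u b + ((u a).+1 - u b) = (u a).+1)%N by lia.
    have -> : (u a - ((u a).+1 - u b) = (u b).-1)%N by lia.
    by move: (psi _ k) (psi _ k) par => p1 p2 par; case: eqP; case: leqP; case: ltnP => /=; lia.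
  apply: (step g o (u b)) => // [k|k||]; rewrite ?E ?keyM //; first exact: leq_addr.
  by rewrite eqxx leqnn ba addn1.
(* Passing column [a] to the second tableau multiplies the Specht polynomial by the variables of
   that column. *)
pose p c := (c == a) || o c.
have gc c : c != a -> key f p c = u c by move=> /negPf ca; rewrite /u /key /p ca.
have ga : key f p a = (u a).+1.
  by move: ev; rewrite /u key_odd /key /p eqxx => /negPf->; lia.
have hp : spl K f p \in I.
  suff -> : spl K f p = (\prod_(i in fiber f a) 'X_i) * spl K f o by apply: idealM.
  rewrite /spl mulrCA; congr (_ * _); rewrite (bigID (fun i => i \in fiber f a)) /=.
  have oa : o a = false by move: ev; rewrite /u key_odd => /negPf.
  by congr (_ * _); apply: eq_bigl => i; rewrite !inE /p;
    case: (eqVneq (f i) a) => [->|_] /=; rewrite ?oa ?andbT ?andbF.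
have E k : psi (key f p) k = (psi u k + (odd k && (k < u a)))%N.
  have e : (\sum_(c | c != a) (key f p c - k)./2 = \sum_(c | c != a) (u c - k)./2)%N.
    by apply: eq_bigr => c ca; rewrite gc.
  rewrite /psi (bigD1 a) //= [in RHS](bigD1 a) //= e ga.
  by move: (\sum_(c | _) _)%N => S; case: ltnP; case: (boolP (odd k)) => /=; lia.
apply: (step f p 1%N) => // [k|k|]; rewrite ?E //; first exact: leq_addr.
by rewrite a2 addn1.
Qed.

End Chain.

(** * The Specht polynomial of the leading monomial *)

Lemma map_nth_index (T : eqType) (s t : seq T) : uniq s -> (size t <= size s)%N ->
  [seq nth z t (index z s) | z <- s] = t ++ drop (size t) s.
Proof.
move=> us ts; case: s us ts => [|x0 s] us ts.
  by case: t ts.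
apply: (@eq_from_nth _ x0) => [|i]; rewrite size_map.
  by rewrite size_cat size_drop subnKC.
move=> hi; rewrite (nth_map x0) // index_uniq // nth_cat; case: ltnP => h.
  by apply: set_nth_default.
by rewrite nth_drop subnKC // nth_default.
Qed.

Lemma card_set_count (T : finType) (A : eqType) (S : {set T}) (f : T -> A) a :
  #|[set z in S | f z == a]| = count_mem a [seq f z | z <- enum S].
Proof.
rewrite count_map -size_filter cardsE cardE; congr size.
rewrite /enum_mem -filter_predI; apply: eq_filter => z.
by rewrite !inE andbC.
Qed.

Section Base.
Variables (K : fieldType) (n : nat).
Local Notation poly := {mpoly K[n]}.
Local Notation G := (hyperoct n).
Hypothesis K0 : [pchar K] =i pred0.
Variable I : ideal poly.
Hypothesis hI : hyp_stable I.

Lemma mcoeff_pihomog d (p : poly) m :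
  (pihomog mdeg d p)@_m = if mdeg m == d then p@_m else 0.
Proof.
elim/mpolyind: p => [|c m' p _ _ IHp]; first by rewrite linear0 !mcoeff0 if_same.
rewrite linearP /= pihomogX !mcoeffD IHp !mcoeffZ mcoeffX.
case: (eqVneq (mdeg m') d) => [e|ne]; rewrite ?mcoeffX ?mcoeff0.
  case: (eqVneq m' m) => [<-|_]; first by rewrite e eqxx.
  by rewrite mulr0 !add0r.
case: (eqVneq m' m) => [<-|_]; first by rewrite (negPf ne) mulr0 addr0.
by case: ifP => _ //; rewrite mulr0 addr0.
Qed.

Variables (P : poly) (m : 'X_{1..n}) (I1 I2 : {set 'I_n}) (k r : 'I_n -> nat).
Hypotheses (hP : P \in I) (hm : m \in msupp (top_component P)).
Hypothesis hdisj : [disjoint I1 & I2].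
Hypothesis hk : forall i, i \in I1 -> (1 <= k i)%N.
Hypothesis m1 : forall i, i \in I1 -> m i = (2 * k i)%N.
Hypothesis m2 : forall i, i \in I2 -> m i = (2 * r i + 1)%N.
Hypothesis m0 : forall i, i \notin I1 :|: I2 -> m i = 0%N.
Hypothesis hwt : (wt (top_component P) + \sum_(i in I1) k i + \sum_(i in I2) r i <= n)%N.

Let W := [set i : 'I_n | has (fun m : 'X_{1..n} => m i != 0%N) (msupp (top_component P))].
Let C := ~: W.
Let e (i : 'I_n) := if i \in I1 then k i else if i \in I2 then r i else 0%N.
(** The first variables of [C] go to the columns listed in [t], and the default value [z] in [f]
    leaves each remaining one alone in its own column. The weight condition says that [C] is at
    least as long as [t]. *)
Let t := flatten [seq nseq (e i) i | i <- enum 'I_n].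
Let f z := if z \in C then nth z t (index z (enum C)) else z.
Let o c := c \in I2.

Let I12 i : i \in I2 -> i \in I1 = false.
Proof. by move=> h; apply: (disjointFl hdisj). Qed.

Let mE i : m i = (2 * e i + o i)%N.
Proof.
rewrite /e /o; case: (boolP (i \in I1)) => h1.
  by rewrite m1 // (disjointFr hdisj h1) addn0.
case: (boolP (i \in I2)) => h2; first by rewrite m2.
by rewrite m0 // inE (negPf h1).
Qed.

Let eW i : i \in I1 :|: I2 -> i \in W.
Proof.
move=> hi; rewrite inE; apply/hasP; exists m => //.
move: hi; rewrite inE => /orP[h|h]; first by rewrite m1 //; have := hk h; lia.
by rewrite m2 // addn1.
Qed.

Let eC i : i \in C -> e i = 0%N.
Proof.
rewrite inE => hi; rewrite /e; case: ifP => h1; first by rewrite eW // inE h1 in hi.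
by case: ifP => h2 //; rewrite eW // inE h2 orbT in hi.
Qed.

Let oC i : i \in C -> o i = false.
Proof.
by rewrite inE => hi; apply: contraNF hi => h; apply: eW; rewrite inE -/(o i) h orbT.
Qed.

Let sum_e : (\sum_i e i = \sum_(i in I1) k i + \sum_(i in I2) r i)%N.
Proof.
rewrite [X in (_ = X + _)%N]big_mkcond [X in (_ = _ + X)%N]big_mkcond -big_split.
apply: eq_bigr => i _; rewrite /e /=; case: ifP => h1; last by rewrite add0n.
by rewrite (disjointFr hdisj h1) addn0.
Qed.

Let size_t : (size t <= size (enum C))%N.
Proof.
rewrite -cardE size_flatten /shape -map_comp sumnE big_map big_enum /=.
rewrite (eq_bigr e) => [|i _]; last by rewrite size_nseq.
rewrite sum_e; have := cardsC W; rewrite card_ord -/C; move: hwt; rewrite /wt -/W.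
by move=> h1 h2; rewrite -(leq_add2l #|W|) h2 addnA.
Qed.

Let count_t c : count_mem c t = e c.
Proof.
rewrite count_flatten -map_comp sumnE big_map big_enum /= (bigD1 c) //=.
rewrite count_nseq /= eqxx mul1n big1 ?addn0 // => i /negPf ic.
by rewrite count_nseq /= ic.
Qed.

Let fW i : i \in W -> f i = i.
Proof. by move=> hi; rewrite /f inE hi. Qed.

Let fC : [seq f z | z <- enum C] = t ++ drop (size t) (enum C).
Proof.
rewrite -map_nth_index ?enum_uniq //; apply/eq_in_map => z.
by rewrite mem_enum /f => ->.
Qed.

Let cardfC c : #|[set z in C | f z == c]| =
  (e c + count_mem c (drop (size t) (enum C)))%N.
Proof. by rewrite card_set_count fC count_cat count_t. Qed.

Let countC c : c \in W -> count_mem c (drop (size t) (enum C)) = 0%N.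
Proof.
move=> hc; apply/count_memPn; apply: contraL hc => /mem_drop.
by rewrite mem_enum inE.
Qed.

Let card_fiberW c : c \in W -> #|fiber f c| = (e c).+1.
Proof.
move=> hc; rewrite -(cardsID C) -add1n addnC; congr addn.
  rewrite (_ : _ :\: _ = [set c]) ?cards1 //; apply/setP => i; rewrite finset.in_set1.
  have -> : (i \in fiber f c :\: C) = (i \in W) && (f i == c) by rewrite !inE negbK.
  by apply/andP/eqP => [[iW]|->]; rewrite ?fW ?hc ?eqxx // => /eqP.
rewrite -[RHS]addn0 -(countC hc) -cardfC.
by apply: eq_card => i; rewrite !inE andbC.
Qed.

Let card_fiberC c : c \in C -> (#|fiber f c| <= 1)%N.
Proof.
move=> hc; have -> : fiber f c = [set z in C | f z == c].
  apply/setP => i; rewrite [LHS]inE [RHS]inE; case: (boolP (i \in C)) => // hi /=.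
  have iW : i \in W by move: hi; rewrite inE negbK.
  by rewrite fW //; apply: contraTF iW => /eqP ->; move: hc; rewrite inE.
rewrite cardfC eC // add0n; apply: leq_trans (_ : count_mem c (enum C) <= _)%N.
  by rewrite -[X in (_ <= count _ X)%N](cat_take_drop (size t)) count_cat leq_addl.
by rewrite count_uniq_mem ?enum_uniq // leq_b1.
Qed.

Let rk (z : 'I_n) := #|[set j : 'I_n | [&& (j < z)%N, f j == f z & j \in C]]|.

Let rk_inj i j : i \in C -> j \in C -> f i = f j -> rk i = rk j -> i = j.
Proof.
have lt x y : x \in C -> f x = f y -> (x < y)%N -> (rk x < rk y)%N.
  move=> hx e1 xy; apply: proper_card; apply/properP; split.
    apply/fintype.subsetP => z; rewrite !inE e1 => /and3P[zx -> ->].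
    by rewrite (ltn_trans zx xy).
  by exists x; rewrite inE ?ltnn // xy e1 eqxx hx.
move=> hi hj e1 e3; case: (ltngtP i j) => [ij|ij|/val_inj //].
  by have := lt i j hi e1 ij; rewrite e3 ltnn.
by have := lt j i hj (esym e1) ij; rewrite e3 ltnn.
Qed.

Let rk_lt z : z \in C -> (rk z < #|[set j in C | f j == f z]|)%N.
Proof.
move=> hz; apply: proper_card; apply/properP; split.
  by apply/fintype.subsetP => j; rewrite !inE => /and3P[_ -> ->].
by exists z; rewrite inE ?hz ?eqxx // ltnn.
Qed.

(** The added boxes of a column take the exponents below the one that [m] gives to its variable in
    [W], which becomes the top box. *)
Let a : 'X_{1..n} := [multinom (if i \in C then 2 * rk i + o (f i) else 0)%N | i < n].

Let amE i : (a + m)%MM i = if i \in C then (2 * rk i + o (f i))%N else m i.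
Proof.
rewrite mnmDE mnmE; case: ifP => // hi.
by have := mE i; rewrite eC // oC // => ->; rewrite addn0.
Qed.

Let am_exps : col_exps f o (a + m)%MM.
Proof.
have lt z : z \in C -> f z \in W -> (rk z < e (f z))%N.
  by move=> zC fzW; have := rk_lt zC; rewrite cardfC countC // addn0.
split=> [i|i j ef|i]; rewrite !amE.
- case: ifP => hi; first by rewrite oddD mul2n odd_double oddb.
  have iW : i \in W by move: hi; rewrite inE => /negbFE.
  by rewrite mE fW // oddD mul2n odd_double oddb.
- case: ifP => hi; case: ifP => hj.
  + by rewrite ef => h; apply: rk_inj => //; lia.
  + have jW : j \in W by move: hj; rewrite inE => /negbFE.
    have := lt i hi; rewrite ef fW // mE => /(_ jW); lia.
  + have iW : i \in W by move: hi; rewrite inE => /negbFE.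
    have := lt j hj; rewrite -ef fW // mE => /(_ iW); lia.
  + have iW : i \in W by move: hi; rewrite inE => /negbFE.
    have jW : j \in W by move: hj; rewrite inE => /negbFE.
    by move: ef; rewrite !fW.
- case: ifP => hi.
    have : (rk i < #|fiber f (f i)|)%N.
      apply: leq_trans (rk_lt hi) _; apply/subset_leq_card/fintype.subsetP => j.
      by rewrite !inE => /andP[].
    by lia.
  have iW : i \in W by move: hi; rewrite inE => /negbFE.
  by rewrite fW // card_fiberW // mE; lia.
Qed.

Let mdeg_m : msize P = (mdeg m).+1.
Proof.
move: hm; rewrite mcoeff_msupp mcoeff_pihomog; case: (eqVneq (mdeg m) (msize P).-1) => [e1|_];
  last by rewrite eqxx.
move=> Pm; rewrite e1 prednK //; apply: leq_ltn_trans (_ : mdeg m < _)%N => //.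
by apply: msize_mdeg_lt; rewrite mcoeff_msupp.
Qed.

(** A monomial of [P] of this degree involves no variable of [C], so the exponents on [C] are those
    of [a]; being distinct within a column, they force [g] to fix [C] pointwise. A column has at
    most one variable in [W], which is then fixed too. *)
Let base_uniq (g : G) : g \in colgrp f -> ('X_[a] * P)@_((a + m)%MM#(g.1)) != 0 ->
  g.1 = 1%g.
Proof.
move=> /colgrpP hg; rewrite -mcoeff_msupp mulrC (perm_mem (msuppMX _ _)).
case/mapP => m' hm' em'.
have dm' : mdeg m' = mdeg m.
  by have := congr1 mdeg em'; rewrite mdeg_mperm !mdegD; lia.
have m'C z : z \in C -> m' z = 0%N.
  rewrite inE => zW; apply/eqP; apply: contraNT zW => h; rewrite inE; apply/hasP.
  exists m' => //; rewrite mcoeff_msupp mcoeff_pihomog dm' mdeg_m /= eqxx.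
  by rewrite -mcoeff_msupp.
have [_ inj _] := am_exps.
have fixC z : z \in C -> g.1 z = z.
  move=> zC; apply: inj; first by rewrite hg.
  move/mnmP: em' => /(_ z); rewrite mnmE => ->; rewrite amE zC mnmDE m'C // addn0.
  by rewrite mnmE zC.
apply/permP => i; rewrite perm1; case: (boolP (i \in C)) => [/fixC //|hi].
have iW : i \in W by move: hi; rewrite inE negbK.
case: (boolP (g.1 i \in C)) => [/fixC /perm_inj //|hgi].
have gW : g.1 i \in W by move: hgi; rewrite inE negbK.
by have := hg i; rewrite !fW.
Qed.

Lemma spl_base : exists f, [/\ spl K f (fun c => c \in I2) \in I,
  forall i, i \in I1 -> #|fiber f i| = (k i).+1,
  forall i, i \in I2 -> #|fiber f i| = (r i).+1
  & forall i, i \notin I1 :|: I2 -> (#|fiber f i| <= 1)%N].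
Proof.
exists f; split=> [|i hi|i hi|i hi]; last 1 first.
- case: (boolP (i \in W)) => [iW|iC]; last by apply: card_fiberC; rewrite inE.
  rewrite card_fiberW // /e; move: hi; rewrite inE => /norP[/negPf-> /negPf->] //.
- apply: (@spl_coef_ideal K n K0 I hI f o ('X_[a] * P) (a + m)%MM).
  + exact: idealM.
  + have P0 : P != 0 by rewrite -msize_poly_eq0 mdeg_m.
    have a0 : 'X_[a] != 0 :> poly by rewrite -msize_poly_eq0 msizeX.
    by rewrite msizeM // msizeX mdeg_m -(mdeg_col_exps am_exps) mdegD addnS.
  have [par _ _] := am_exps; rewrite mcoeff_alt //.
  rewrite (eq_bigr (fun g : G => (g.1 == 1%g)%:R * P@_m)) => [|g hg].
    rewrite -mulr_suml mulf_neq0 //.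
      rewrite -natr_sum (char0_natr K0) -lt0n (bigD1 1%g) ?colgrp1 //= eqxx.
      exact: leq_addr.
    by move: hm; rewrite mcoeff_msupp mcoeff_pihomog; case: ifP; rewrite ?eqxx.
  case: eqP => [->|ne]; last first.
    rewrite mul0r; apply/eqP; rewrite mulf_eq0; apply/orP; right.
    by apply/negPn/negP => /(base_uniq hg).
  by rewrite odd_perm1 expr0 mperm1 mul1r mulrC mcoeffMX mul1r.
- by rewrite card_fiberW ?eW ?inE ?hi // /e hi.
- by rewrite card_fiberW ?eW ?inE ?hi ?orbT // /e I12 // hi.
Qed.

End Base.

(** * Shapes and bidominance *)

Section Transpose.
Variable n : nat.
Implicit Types (cs : seq (seq 'I_n)) (s : seq nat).

Lemma size_pmap_onth cs j :
  size (pmap (fun r => onth r j) cs) = count (fun x => j < x)%N (shape cs).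
Proof.
elim: cs => //= c cs <-; case: ltnP => h; last by rewrite onth_default.
by have := onthTE c j; rewrite h; case: (onth c j).
Qed.

Lemma shape_columns cs : shape (columns cs) = conj_part (shape cs).
Proof.
rewrite /shape /columns /conj_part -map_comp; apply: eq_map => j /=.
exact: size_pmap_onth.
Qed.

Lemma sorted_geq_head s x : sorted geq s -> x \in s -> (x <= head 0 s)%N.
Proof.
case: s => //= y s; rewrite (path_sortedE (rev_trans leq_trans)) => /andP[/allP h _].
by rewrite inE => /predU1P[->|/h].
Qed.

Lemma nth_conj_part s j : sorted geq s ->
  nth 0%N (conj_part s) j = count (fun x => j < x)%N s.
Proof.
move=> hs; case: (ltnP j (head 0%N s)) => h.
  by rewrite (nth_map 0%N) ?size_iota // nth_iota.
rewrite nth_default ?size_map ?size_iota //; apply/esym/eqP.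
rewrite -leqn0 leqNgt -has_count; apply/hasP => -[x hx] /=.
by rewrite ltnNge (leq_trans (sorted_geq_head hs hx)).
Qed.

(** The lists too short for index [k], which [pmap] drops, all come last, so positions are not
    shifted. *)
Lemma onth_row cs k j : sorted geq (shape cs) ->
  onth (pmap (fun r => onth r k) cs) j = obind (fun c => onth c k) (onth cs j).
Proof.
elim: cs j => [|c cs IHcs] j; first by rewrite /= !onth0n.
move=> hs; have hs' : sorted geq (shape cs) := path_sorted hs.
rewrite /=; have [hk|hk] := leqP (size c) k.
  have le x : x \in cs -> (size x <= k)%N.
    move=> hx; apply: leq_trans hk; apply: (@sorted_geq_head (shape (c :: cs))) => //.
    by rewrite inE map_f ?orbT.
  have -> : pmap (fun r => onth r k) cs = [::].
    apply/eqP; rewrite -size_eq0 size_pmap_onth -leqn0 leqNgt -has_count.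
    apply/hasP => -[_ /mapP[x hx ->]] /=; rewrite ltnNge le //.
  have e0 : onth c k = None by rewrite onth_default.
  rewrite e0 /= onth0n; case: j => [|j] /=; first by rewrite e0.
  case e: (onth cs j) => [x|] //=; rewrite onth_default // le //.
  by apply/onthP; exists j.
have := onthTE c k; rewrite hk; case e: (onth c k) => [x|] //= _.
by case: j => [|j] /=; rewrite ?e // IHcs.
Qed.

Lemma pmap_map_comp (A B C : Type) (g : B -> option C) (h : A -> B) (s : seq A) :
  pmap g (map h s) = pmap (fun x => g (h x)) s.
Proof. by elim: s => //= x s ->. Qed.

Lemma pmap_onth_iota (c : seq 'I_n) h : (size c <= h)%N ->
  pmap (onth c) (iota 0 h) = c.
Proof.
elim: c h => [|x c IHc] h; first by elim: (iota 0 h) => //= j s; rewrite onth0n.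
case: h => // h hc; rewrite /= (iotaDl 1 0) pmap_map_comp.
by congr (_ :: _); apply: IHc.
Qed.

Lemma columnsK cs : sorted geq (shape cs) -> all (fun c => c != [::]) cs ->
  columns (columns cs) = cs.
Proof.
move=> hs hne; set T := columns cs; set h := head 0%N (shape cs).
have hT : head 0%N (shape T) = size cs.
  rewrite /T shape_columns; case: cs hs hne {T h} => //= c cs hs /andP[hc /allP hne].
  rewrite /conj_part /=; case: c hc hs => //= x c _ hs; congr S.
  rewrite count_map; apply/eqP; rewrite -all_count; apply/allP => d /hne.
  by case: d.
apply: (@eq_from_nth _ [::]) => [|j]; rewrite size_map size_iota hT // => hj.
rewrite /columns hT (nth_map 0%N) ?size_iota // nth_iota // add0n {1}/T /columns pmap_map_comp.
rewrite -[RHS](@pmap_onth_iota _ h).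
  apply: eq_pmap => k; rewrite onth_row //.
  by have := onthTE cs j; rewrite hj; rewrite -(odflt_onth [::]); case: (onth cs j).
by apply: sorted_geq_head => //; apply: map_f; apply: mem_nth.
Qed.

Lemma perm_flatten_columns cs : sorted geq (shape cs) ->
  perm_eq (flatten (columns cs)) (flatten cs).
Proof.
move=> hs; apply/seq.permP => P.
pose h := head 0%N (shape cs).
have hc c : c \in cs -> (size c <= h)%N.
  by move=> hc; apply: sorted_geq_head => //; apply: map_f.
rewrite !count_flatten -map_comp !sumnE !big_map.
transitivity (\sum_(j <- iota 0 h) \sum_(c <- cs) oapp P false (onth c j) : nat)%N.
  apply: eq_bigr => j _ /=; elim: (cs) => [|c cs0 IH]; first by rewrite big_nil.
  by rewrite big_cons -IH /=; case: (onth c j).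
rewrite exchange_big /=; apply: eq_big_seq => c /hc{}hc.
rewrite -sum1_count; case: c hc => [|x0 c] hc.
  by rewrite big_nil big1_seq // => j _; rewrite onth_default.
rewrite (big_nth x0) -[iota 0 h](cat_take_drop (size (x0 :: c))) big_cat /=.
rewrite take_iota (minn_idPl hc) drop_iota /index_iota subn0 -/(size (x0 :: c)).
rewrite [X in (_ + X)%N]big1_seq => [|j]; last first.
  by rewrite mem_iota => /andP[_ /andP[h1 _]]; rewrite onth_default.
rewrite addn0 [RHS]big_mkcond; apply: eq_big_seq => j; rewrite mem_iota => /andP[_ hj].
have := onthTE (x0 :: c) j; rewrite hj; case e: (onth _ j) => [y|] //= _.
by rewrite -(odflt_onth x0) e /=; case: (P y).
Qed.

End Transpose.

(** * Bitableaux attached to column labellings *)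

Section Shape.
Variables (K : fieldType) (n : nat).
Implicit Types (f : 'I_n -> 'I_n) (o : 'I_n -> bool) (b : bool).

Definition colseq f c := [seq i <- enum 'I_n | f i == c].

Definition cols f o b : seq (seq 'I_n) :=
  sort (fun s t => size t <= size s)%N
    [seq colseq f c | c <- enum 'I_n & (o c == b) && (colseq f c != [::])].

Lemma size_colseq f c : size (colseq f c) = #|fiber f c|.
Proof.
rewrite cardE /enum_mem /colseq size_filter size_filter enumT.
by apply: eq_count => i; rewrite !inE.
Qed.

Lemma sorted_cols f o b : sorted geq (shape (cols f o b)).
Proof.
rewrite /shape sorted_map; apply: sort_sorted => s t; exact: leq_total.
Qed.

Lemma cols_nonempty f o b : all (fun c => c != [::]) (cols f o b).
Proof.
apply/allP => s; rewrite mem_sort => /mapP[c]; rewrite mem_filter.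
by move=> /andP[/andP[_ h] _] ->.
Qed.

Lemma big_cols (R : Type) (idx : R) (op : Monoid.com_law idx) f o b (F : seq 'I_n -> R) :
  F [::] = idx ->
  \big[op/idx]_(s <- cols f o b) F s = \big[op/idx]_(c | o c == b) F (colseq f c).
Proof.
move=> F0; rewrite /cols (perm_big _ (permEl (perm_sort _ _))) /= big_map.
rewrite big_filter big_enum_cond /= big_mkcondr; apply: eq_bigr => c _.
by case: eqP => //= ->.
Qed.

Lemma perm_flatten_cols f o b :
  perm_eq (flatten (cols f o b)) [seq i <- enum 'I_n | o (f i) == b].
Proof.
apply/seq.permP => P; rewrite count_flatten sumnE big_map big_cols //=.
rewrite count_filter -sum1_count big_enum_cond /=.
rewrite [RHS](partition_big f (fun c => o c == b)) /=; last by move=> i /andP[].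
apply: eq_bigr => c hc; rewrite count_filter -sum1_count big_enum_cond /=.
apply: eq_bigl => i; case: eqP => [->|]; rewrite ?andbF ?andbT //.
by rewrite hc andbT.
Qed.

Definition shape_of f o := (conj_part (shape (cols f o false)), conj_part (shape (cols f o true))).

Definition tab_of f o := (columns (cols f o false), columns (cols f o true)).

Lemma is_bitableau_tab f o : is_bitableau (shape_of f o) (tab_of f o).
Proof.
rewrite /is_bitableau !shape_columns !eqxx /=.
have h b : perm_eq (flatten (columns (cols f o b))) [seq i <- enum 'I_n | o (f i) == b].
  apply: perm_trans (perm_flatten_cols f o b).
  exact/perm_flatten_columns/sorted_cols.
apply: perm_trans (perm_cat (h false) (h true)) _.
have -> : [seq i <- enum 'I_n | o (f i) == true] =
    [seq i <- enum 'I_n | predC (fun i => o (f i) == false) i].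
  by apply: eq_filter => i /=; case: (o (f i)).
exact/permEl/perm_filterC.
Qed.

Lemma is_partition_conj (s : seq nat) : sorted geq s -> is_partition (conj_part s).
Proof.
move=> hs; apply/andP; split.
  apply: (@homo_sorted _ _ (fun j => count (fun x => j < x)%N s) ltn geq).
    move=> i j ij /=; apply: sub_count => x /=; exact: ltn_trans.
  exact: iota_ltn_sorted.
apply/mapP => -[j]; rewrite mem_iota add0n => /andP[_ hj].
apply/eqP; rewrite eq_sym -lt0n -has_count; apply/hasP; exists (head 0%N s) => //.
by case: s hj {hs} => //= x s _; rewrite mem_head.
Qed.

Lemma is_bipartition_shape f o : is_bipartition n (shape_of f o).
Proof.
have /and3P[/eqP h1 /eqP h2 h3] := is_bitableau_tab f o.
rewrite /is_bipartition !is_partition_conj ?sorted_cols // -h1 -h2 -!size_flatten -size_cat.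
by rewrite (perm_size h3) size_enum_ord eqxx.
Qed.

(** [colseq] is increasing, so the order of positions is the order of labels and no sign appears. *)
Lemma Delta_colseq f c (y : 'I_n -> {mpoly K[n]}) :
  Delta (colseq f c) y =
    \prod_(i < n | f i == c) \prod_(j < n | (i < j)%N && (f j == c)) (y i - y j).
Proof.
pose s := colseq f c.
have E i : (i \in s) = (f i == c) by rewrite mem_filter mem_enum andbT.
transitivity (\prod_(i <- s) \prod_(j <- s | (i < j)%N) (y i - y j)); last first.
  rewrite big_filter big_enum_cond; apply: eq_bigr => i _.
  by rewrite big_filter_cond big_enum_cond /=; apply: eq_bigl => j; rewrite andbC.
rewrite /Delta -/s [RHS]big_tnth; apply: eq_bigr => j _; rewrite [RHS]big_tnth.
apply: eq_bigl => k.
have srt : sorted (fun i j : 'I_n => i < j)%N s.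
  apply: sorted_filter => [x u v|]; first exact: ltn_trans.
  by have := iota_ltn_sorted 0 n; rewrite -val_enum_ord sorted_map.
have tr : transitive (fun i j : 'I_n => i < j)%N by move=> x u v; apply: ltn_trans.
have lt (a b : 'I_(size s)) : (a < b)%N -> (tnth (in_tuple s) a < tnth (in_tuple s) b)%N.
  have x0 : 'I_n := tnth (in_tuple s) j.
  move=> ab; rewrite !(tnth_nth x0) /=.
  by apply: (sorted_ltn_nth tr) => //; rewrite inE.
case: (ltngtP j k) => h; first by rewrite lt.
  by apply/esym/negbTE; rewrite -leqNgt ltnW // lt.
by rewrite (val_inj h) ltnn.
Qed.

Lemma specht_tab f o : specht K (tab_of f o) = spl K f o.
Proof.
rewrite /specht /= !columnsK ?sorted_cols ?cols_nonempty //.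
have D0 : Delta [::] (fun i : 'I_n => 'X_i ^+ 2) = 1 :> {mpoly K[n]}.
  by rewrite /Delta big_ord0.
rewrite !big_cols //; congr (_ * _).
  have -> : \prod_(i < n) \prod_(j < n | (i < j)%N && (f i == f j)) ('X_i ^+ 2 - 'X_j ^+ 2) =
      \prod_c Delta (colseq f c) (fun i : 'I_n => 'X_i ^+ 2) :> {mpoly K[n]}.
    rewrite (partition_big f xpredT) //=; apply: eq_bigr => c _.
    rewrite Delta_colseq; apply: eq_bigr => i /eqP <-.
    by apply: eq_bigl => j; rewrite [f j == _]eq_sym.
  rewrite [RHS](bigID (fun c => o c == false)) /=; congr (_ * _).
  by apply: eq_bigl => c; case: (o c).
rewrite (perm_big _ (perm_flatten_columns (sorted_cols f o true))).
rewrite (perm_big _ (perm_flatten_cols f o true)) /= big_filter big_enum_cond.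
by apply: eq_bigl => i; rewrite eqb_id.
Qed.

Lemma spl_specht_mod f o : specht_mod K n (shape_of f o) (spl K f o).
Proof.
exists 1%N, (fun=> 1), (fun=> spl K f o); split; last first.
  by rewrite big_ord1 scale1r.
by move=> _; exists (tab_of f o); rewrite ?is_bitableau_tab // specht_tab.
Qed.

Lemma nth_shape_of f o b j :
  nth 0%N (conj_part (shape (cols f o b))) j = #|[set c | (o c == b) && (j < #|fiber f c|)%N]|.
Proof.
rewrite nth_conj_part ?sorted_cols // count_map -sum1_count big_mkcond /=.
rewrite big_cols //= -sum1dep_card big_mkcondr; apply: eq_bigr => c _.
by rewrite size_colseq.
Qed.

(** Exactly the even columns with more than [k] boxes have a box of exponent [2 * k], and their
    number is a row of the first tableau. The odd columns account in the same way for the rows of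
    the second. *)
Lemma psi_even f o k : psi (key f o) (2 * k) =
  (psi (key f o) (2 * k).+1 + nth 0%N (shape_of f o).1 k)%N.
Proof.
rewrite nth_shape_of -sum1dep_card big_mkcond -big_split; apply: eq_bigr => c _ /=.
by rewrite /key; case: (o c) => /=; case: (leqP #|fiber f c| k) => /=; lia.
Qed.

Lemma psi_odd f o k : psi (key f o) (2 * k).+1 =
  (psi (key f o) (2 * k.+1) + nth 0%N (shape_of f o).2 k)%N.
Proof.
rewrite nth_shape_of -sum1dep_card big_mkcond -big_split; apply: eq_bigr => c _ /=.
by rewrite /key; case: (o c) => /=; case: (leqP #|fiber f c| k) => /=; lia.
Qed.

Lemma psi_sum f o k : (psi (key f o) (2 * k) +
  \sum_(j < k) (nth 0 (shape_of f o).1 j + nth 0 (shape_of f o).2 j))%N = n.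
Proof.
elim: k => [|k IHk]; first by rewrite muln0 psi0 big_ord0 addn0.
rewrite big_ord_recr /=; have := psi_even f o k; have := psi_odd f o k.
by move: IHk; rewrite /=; lia.
Qed.

(** Even arguments use the first inequalities of bidominance, odd ones the second; the order is
    reversed because [psi] counts the complementary boxes. *)
Lemma bidominated_psi f o f' o' : bidominated (shape_of f o) (shape_of f' o') ->
  forall k, (psi (key f' o') k <= psi (key f o) k)%N.
Proof.
move=> h k; rewrite -(odd_double_half k) -mul2n; move: (k./2) => j.
case: (odd k) => /=; last first.
  rewrite add0n; case: j => [|j]; first by rewrite muln0 !psi0.
  have [h1 _] := h j; have := psi_sum f o j.+1; have := psi_sum f' o' j.+1.
  by move: h1; move: (\sum_(_ < _) _)%N (\sum_(_ < _) _)%N => *; lia.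
have [_ h1] := h j; have := psi_sum f o j; have := psi_sum f' o' j.
rewrite add1n (psi_even f o) (psi_even f' o'); move: h1.
by move: (\sum_(_ < _) _)%N (\sum_(_ < _) _)%N => *; lia.
Qed.

Let geq_trans : transitive geq := rev_trans leq_trans.

Let geq_anti : antisymmetric geq.
Proof. by move=> x y h; apply/eqP; rewrite eqn_leq andbC. Qed.

Lemma perm_shape_cols f o b : perm_eq (shape (cols f o b))
  [seq #|fiber f c| | c <- enum 'I_n & (o c == b) && (0 < #|fiber f c|)%N].
Proof.
rewrite /shape; apply: perm_trans (perm_map _ (permEl (perm_sort _ _))) _.
rewrite -map_comp (eq_map (size_colseq f)); apply: perm_map.
rewrite (_ : [seq c <- _ | _] = [seq c <- enum 'I_n | (o c == b) && (0 < #|fiber f c|)%N]) //.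
by apply: eq_filter => c; rewrite -size_eq0 size_colseq lt0n.
Qed.

Lemma shape_of_relabel (s : 'S_n) f o : shape_of (fun i => f (s i)) o = shape_of f o.
Proof.
have cE c : #|fiber (fun i => f (s i)) c| = #|fiber f c|.
  rewrite -(card_imset _ (@perm_inj _ s)); apply: eq_card => i; rewrite [RHS]inE.
  apply/imsetP/eqP => [[j + ->]|<-]; first by rewrite inE => /eqP.
  by exists ((s^-1)%g i); rewrite ?inE permKV.
suff E b : shape (cols (fun i => f (s i)) o b) = shape (cols f o b) by rewrite /shape_of !E.
apply: (sorted_eq geq_trans geq_anti); try exact: sorted_cols.
apply: perm_trans (perm_shape_cols _ _ _) _; rewrite perm_sym.
apply: perm_trans (perm_shape_cols _ _ _) _; rewrite (eq_map cE) perm_map //.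
rewrite [X in perm_eq _ X](_ : _ = [seq c <- enum 'I_n | (o c == b) && (0 < #|fiber f c|)%N]) //.
by apply: eq_filter => c; rewrite cE.
Qed.

Lemma shape_of_Gamma f (I1 I2 : {set 'I_n}) (k r : 'I_n -> nat) :
  [disjoint I1 & I2] ->
  (forall i, i \in I1 -> #|fiber f i| = (k i).+1) ->
  (forall i, i \in I2 -> #|fiber f i| = (r i).+1) ->
  (forall i, i \notin I1 :|: I2 -> (#|fiber f i| <= 1)%N) ->
  shape_of f (fun c => c \in I2) = Gamma_star I1 I2 k r.
Proof.
move=> dis h1 h2 h0.
have srtS (s : seq nat) : sorted geq s -> sorted geq (map succn s).
  by rewrite sorted_map; apply: sub_sorted => x y.
have srt (s : seq nat) : sorted geq (sort geq s).
  by apply: sort_sorted => x y; apply: leq_total.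
have enumE (A : {set 'I_n}) : enum A = [seq c <- enum 'I_n | c \in A].
  by rewrite /enum_mem -filter_predI; apply: eq_filter => c; rewrite /= ?inE ?andbT.
rewrite /shape_of /Gamma_star; congr (conj_part _, conj_part _).
  apply: (sorted_eq geq_trans geq_anti); first exact: sorted_cols.
    rewrite (sorted_pairwise geq_trans) pairwise_cat -!(sorted_pairwise geq_trans).
    rewrite srtS ?srt //=; apply/andP; split.
      by apply/allrelP => _ _ /mapP[x _ ->] /nseqP[-> _].
    by elim: (n - _)%N => //= -[|N] //= ->.
  apply: perm_trans (perm_shape_cols _ _ _) _.
  set L := [seq c <- _ | _].
  have pL := permEl (perm_filterC (fun c => c \in I1) L).
  rewrite perm_sym in pL; apply: perm_trans (perm_map _ pL) _; rewrite map_cat.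
  apply: perm_cat.
    rewrite perm_sym; apply: perm_trans (perm_map _ (permEl (perm_sort _ _))) _.
    have -> : [seq c <- L | c \in I1] = enum I1.
      rewrite enumE /L -filter_predI; apply: eq_filter => c /=.
      by case: (boolP (c \in I1)) => //= hc; rewrite (disjointFr dis hc) h1.
    have /eq_in_map <- // : {in enum I1, (fun c => (k c).+1) =1 (fun c => #|fiber f c|)}.
      by move=> c; rewrite mem_enum => /h1->.
    by rewrite -map_comp.
  set L2 := [seq c <- L | _].
  have -> : [seq #|fiber f c| | c <- L2] = nseq (size L2) 1%N.
    rewrite -(size_map (fun c => #|fiber f c|)); apply/all_pred1P; rewrite all_map;
      apply/allP => c; rewrite !mem_filter /=.
    move=> /andP[n1 /andP[/andP[n2 pos] _]]; rewrite eqn_leq pos andbT h0 //.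
    by rewrite inE negb_or n1; move: n2; case: (c \in I2).
  suff -> : size L2 = (n - (#|I1| + #|I2| + \sum_(i in I1) k i + \sum_(i in I2) r i))%N by [].
  (* The number of columns with a single box outside [I1] and [I2] follows by counting all [n]
     boxes; it is the number of trailing ones in the definition of [Gamma_star]. *)
  have S1 : (\sum_(c < n | c \in I1) #|fiber f c| = #|I1| + \sum_(i in I1) k i)%N.
    by rewrite -sum1_card -big_split; apply: eq_bigr => c /h1->.
  have S2 : (\sum_(c < n | (c \notin I1) && (c \in I2)) #|fiber f c| =
             #|I2| + \sum_(i in I2) r i)%N.
    rewrite -sum1_card -big_split; apply: eq_big => [c|c /andP[_ /h2->] //].
    by case: (boolP (c \in I2)) => hc; rewrite ?andbF // (disjointFl dis hc).
  have := sum_fibers f; rewrite (bigID (fun c => c \in I1)) /= S1.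
  rewrite (bigID (fun c => c \in I2) (fun c => c \notin I1)) /= S2.
  have -> : (\sum_(c < n | (c \notin I1) && (c \notin I2)) #|fiber f c| = size L2)%N.
    rewrite /L2 /L -filter_predI -[RHS]count_predT count_filter -sum1_count big_enum_cond /=.
    rewrite [RHS]big_mkcond [LHS]big_mkcond; apply: eq_bigr => c _ /=.
    case: (boolP (c \in I1)) => hc1 //=; case: (boolP (c \in I2)) => hc2 //=.
    by have := h0 c; rewrite inE negb_or hc1 hc2 => /(_ isT); case: #|_| => [|[|]].
  move: (size L2) (\sum_(i in I1) k i)%N (\sum_(i in I2) r i)%N #|I1| #|I2| => x1 x2 x3 x4 x5.
  by move=> <-; lia.
apply: (sorted_eq geq_trans geq_anti); [exact: sorted_cols|exact: srtS|].
apply: perm_trans (perm_shape_cols _ _ _) _.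
rewrite perm_sym; apply: perm_trans (perm_map _ (permEl (perm_sort _ _))) _.
have -> : [seq c <- enum 'I_n | ((c \in I2) == true) && (0 < #|fiber f c|)%N] = enum I2.
  rewrite enumE; apply: eq_filter => c /=.
  by case: (boolP (c \in I2)) => //= /h2->.
have /eq_in_map <- // : {in enum I2, (fun c => (r c).+1) =1 (fun c => #|fiber f c|)}.
  by move=> c; rewrite mem_enum => /h2->.
by rewrite -map_comp.
Qed.

End Shape.

(** * Matrix coefficient operators *)

Section LowerOperators.
Variables (K : fieldType) (n : nat).
Local Notation poly := {mpoly K[n]}.
Local Notation G := (hyperoct n).
Hypothesis K0 : [pchar K] =i pred0.
Implicit Types (g h : G) (p q v : poly) (f : 'I_n -> 'I_n) (o : 'I_n -> bool) (d : nat).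

(* The two-sided ideal of the group algebra generated by the antisymmetrizers of
   the labellings with spldeg > d, as operators on polynomials. *)
Inductive lower d : (poly -> poly) -> Prop :=
| lower0 F : (forall v, F v = 0) -> lower d F
| lowerD F F1 F2 : lower d F1 -> lower d F2 -> (forall v, F v = F1 v + F2 v) -> lower d F
| lowerG F c g f o h : (d < spldeg f o)%N ->
    (forall v, F v = c *: pact g (alt f o (pact h v))) -> lower d F.

Lemma lower_ext d F F' : F =1 F' -> lower d F -> lower d F'.
Proof.
move=> e hF; case: hF e => [F1 h|F1 F2 F3 h1 h2 h|F1 c g f o h hd hE] e.
- by apply: lower0 => v; rewrite -e.
- by apply: lowerD h1 h2 _ => v; rewrite -e.
- by apply: lowerG hd _ => v; rewrite -e.
Qed.

Lemma lowerZ d F c : lower d F -> lower d (fun v => c *: F v).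
Proof.
elim=> {F} [F h|F F1 F2 _ h1 _ h2 h|F c' g f o h hd hE].
- by apply: lower0 => v; rewrite h scaler0.
- by apply: lowerD h1 h2 _ => v; rewrite h scalerDr.
- by apply: (lowerG hd) => v; rewrite hE scalerA.
Qed.

Lemma lower_sum d (T : Type) (s : seq T) (P : pred T) (F : T -> poly -> poly) :
  (forall t, P t -> lower d (F t)) -> lower d (fun v => \sum_(t <- s | P t) F t v).
Proof.
move=> hF; elim: s => [|t s IHs]; first by apply: lower0 => v; rewrite big_nil.
case: (boolP (P t)) => hP.
  by apply: lowerD (hF t hP) IHs _ => v; rewrite big_cons hP.
by apply: lower_ext IHs => v; rewrite big_cons (negPf hP).
Qed.

Lemma lower_pactl d F g : lower d F -> lower d (fun v => pact g (F v)).
Proof.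
elim=> {F} [F h|F F1 F2 _ h1 _ h2 h|F c' g' f o h hd hE].
- by apply: lower0 => v; rewrite h linear0.
- by apply: lowerD h1 h2 _ => v; rewrite h linearD.
- by apply: (lowerG hd) => v; rewrite hE linearZ /= -pactM.
Qed.

Lemma lower_altl d F f o : lower d F -> lower d (fun v => alt f o (F v)).
Proof. by move=> hF; apply: lower_sum => g _; apply/lowerZ/lower_pactl. Qed.

(** Degrees: the antisymmetrizers in [lower] kill every polynomial of degree at most
    [spldeg f o]. *)
Lemma lower_spl f o F : lower (spldeg f o) F -> F (spl K f o) = 0.
Proof.
elim=> {F} [F h|F F1 F2 _ h1 _ h2 h|F c' g' f' o' h hd hE].
- by rewrite h.
- by rewrite h h1 h2 addr0.
- rewrite hE alt_eq0 ?linear0 ?scaler0 //.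
  by apply: leq_trans (msize_pact _ _) _; rewrite msize_spl.
Qed.

(** The sign change at [i] has opposite characters for the two labellings, so the result equals its
    opposite. *)
Lemma alt_eq0_of_parity f f' o (i : 'I_n) q : o (f i) != o (f' i) ->
  antisym f' o q -> alt f o q = 0.
Proof.
move=> ne aq; pose t : G := (1%g, [ffun j => j == i]).
have tC k : t \in colgrp k by apply/colgrpP => j; rewrite perm1.
have ct k : colchar K k o t = (-1) ^+ o (k i).
  rewrite /colchar odd_perm1 expr0 mul1r /flip_sign (bigD1 i) //= ffunE eqxx.
  by rewrite big1 ?mulr1 // => j /negPf ji; rewrite ffunE ji.
have := alt_pact o q (tC f); rewrite (aq t (tC f')) !ct linearZ /=.
move=> /(congr1 (fun x => (-1) ^+ o (f i) *: x)); rewrite !scalerA -!signr_addb addbb scale1r.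
have -> : o (f i) (+) o (f' i) by case: (o (f i)) (o (f' i)) ne => [] [].
rewrite expr1 scaleN1r => /eqP; rewrite eq_sym -addr_eq0 -mulr2n -scaler_nat scaler_eq0.
by rewrite (char0_natr K0) /= => /eqP.
Qed.

Lemma spldeg_fibers f o : spldeg f o =
  (\sum_(c : 'I_n) (\sum_(0 <= v < #|fiber f c|) 2 * v + #|fiber f c| * o c))%N.
Proof. by rewrite -mdeg_std (sum_col_exps (std_col_exps f o)). Qed.

(** The degree loses the top exponent of the old column and gains the next exponent of the new one,
    which is larger. *)
Lemma spldeg_move f o (y c : 'I_n) : f y != c -> o (f y) = o c ->
  (#|fiber f (f y)| <= #|fiber f c|)%N ->
  (spldeg f o < spldeg (fun i => if i == y then c else f i) o)%N.
Proof.
move=> ne eo le; have sub : [set y] \subset fiber f (f y) by rewrite finset.sub1set inE.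
have cne : c != f y by rewrite eq_sym.
have E k : #|fiber (fun i => if i == y then c else f i) k| =
   (#|fiber f k| + (k == c) - (k == f y))%N.
  have := card_fiber_move k cne sub; rewrite cards1 !muln1 => <-.
  by apply: eq_card => i; rewrite !inE.
rewrite !spldeg_fibers (bigD1 c) //= (bigD1 (f y)) //= [X in (_ < X)%N](bigD1 c) //= [X in (_ < _ + X)%N](bigD1 (f y)) //=.
set S := (\sum_(i | (i != c) && (i != f y)) _)%N; set S' := (\sum_(i | (i != c) && (i != f y)) _)%N.
have -> : S' = S.
  by apply: eq_bigr => k /andP[/negPf k1 /negPf k2]; rewrite E k1 k2 addn0 subn0.
rewrite !E !eqxx eq_sym (negPf ne) addn0 subn0 addn1 big_nat_recr //= eo.
have : (0 < #|fiber f (f y)|)%N by apply/card_gt0P; exists y; rewrite inE.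
case: #|fiber f (f y)| le => // a le _; rewrite subn1 /= big_nat_recr //=.
move: (\sum_(0 <= v < a) _)%N (\sum_(0 <= v < #|fiber f c|) _)%N S => s1 s2 s3.
by move: #|fiber f c| le => b lab; case: (o c); rewrite ?muln1 ?muln0; lia.
Qed.

Lemma colgrp_tperm f (x y : 'I_n) : f x = f y -> ((tperm x y, [ffun=> false]) : G) \in colgrp f.
Proof. by move=> e; apply/colgrpP => i /=; case: tpermP => // ->; rewrite e. Qed.

Lemma colchar_tperm f o (x y : 'I_n) :
  colchar K f o (tperm x y, [ffun=> false]) = (-1) ^+ (x != y).
Proof.
rewrite /colchar odd_tperm /flip_sign big1 ?mulr1 // => i _.
by rewrite ffunE.
Qed.

(* A Garnir argument.  If g does not preserve the columns of f, let c be a largest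
   column that differs in f and f2 = f o g^-1, and y an entry of c in f but not in
   f2.  Moving y to column c of f2 gives a labelling f3 of larger degree, whose
   antisymmetrizer is, on alternating polynomials for f2, a signed sum over the
   transpositions of y with the entries of c. *)
Lemma alt_sandwich f o g : exists k, lower (spldeg f o)
  (fun v => alt f o (pact g (alt f o v)) - k *: alt f o v).
Proof.
(* The transpositions met below remove [y] from this set and add nothing to it, whence the induction
   on its size. *)
pose D (g : G) := [set i | f i != f ((g.1^-1)%g i)].
move: {2}#|D g|.+1 (ltnSn #|D g|) => N; elim: N g => // N IHN g hN.
pose f2 i := f ((g.1^-1)%g i).
have qE v : pact g (alt f o v) = alt f2 o (pact g v) by rewrite pact_alt.
case: (pselect (exists i, o (f i) != o (f2 i))) => [[i hi]|par].
  exists 0; apply: lower0 => v; rewrite scale0r subr0 qE.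
  exact: (alt_eq0_of_parity hi (@alt_antisym K n f2 o (pact g v))).
have {}par i : o (f i) = o (f2 i).
  by apply/eqP/negPn/negP => h; apply: par; exists i.
case: (pselect (exists c, fiber f c != fiber f2 c)) => [[c0 hc0]|same]; last first.
  have gC : g \in colgrp f.
    apply/colgrpP => i; have : fiber f (f i) = fiber f2 (f i).
      by apply/eqP/negPn/negP => h; apply: same; exists (f i).
    move/setP/(_ (g.1 i)); rewrite !inE /f2 permK eqxx => /eqP//.
  exists (colchar K f o g * #|colgrp f|%:R); apply: lower0 => v.
  by rewrite alt_pact // alt_of_antisym ?scalerA ?subrr //; apply: alt_antisym.
have [c hc cmax] := @arg_maxnP _ c0 (fun c => fiber f c != fiber f2 c) (fun c => #|fiber f c|) hc0.
have cf2 k : #|fiber f2 k| = #|fiber f k|.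
  rewrite -(card_imset _ (@perm_inj _ (g.1^-1)%g)); apply: eq_card => i; rewrite [RHS]inE.
  apply/imsetP/eqP => [[j + ->]|<-]; first by rewrite inE => /eqP.
  by exists (g.1 i); rewrite ?inE /f2 permK.
have [y yc yc2] : exists2 y, y \in fiber f c & y \notin fiber f2 c.
  apply/subsetPn; apply: contraNN hc => sub.
  by rewrite eqEcard sub cf2 leqnn.
have fy : f y = c by move: yc; rewrite inE => /eqP.
have f2y : f2 y != c by move: yc2; rewrite inE.
have le : (#|fiber f2 (f2 y)| <= #|fiber f2 c|)%N.
  rewrite !cf2; apply: cmax; apply/eqP => /setP/(_ y); rewrite !inE fy eqxx.
  by rewrite eq_sym (negPf f2y).
pose f3 i := if i == y then c else f2 i.
have lt : (spldeg f o < spldeg f3 o)%N.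
  rewrite -(spldeg_relabel K0 (g.1^-1)%g f o); apply: spldeg_move => //.
  by rewrite -par fy.
have of3 i : o (f3 i) = o (f2 i).
  by rewrite /f3; case: eqP => // ->; rewrite -par fy.
pose t (x : 'I_n) : G := (tperm x y, [ffun=> false]).
have f3c h : h \in colgrp f3 -> f3 (h.1 y) = c.
  by move/colgrpP->; rewrite /f3 eqxx.
have step h v : h \in colgrp f3 -> colchar K f3 o h *: pact h (alt f2 o v) =
    (-1) ^+ (h.1 y != y) *: pact (t (h.1 y)) (alt f2 o v).
  move=> hC; pose x := h.1 y; have tC : t x \in colgrp f3.
    by apply: colgrp_tperm; rewrite f3c // /f3 eqxx.
  pose h' := ((t x)^-1 * h)%g; have h'C : h' \in colgrp f3 by rewrite colgrpMl ?colgrpV.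
  have h'y : h'.1 y = y by rewrite permM /= tpermV tpermL.
  have h'C2 : h' \in colgrp f2.
    apply/colgrpP => i; move/colgrpP: h'C => /(_ i); rewrite /f3 -{1}h'y (inj_eq perm_inj).
    by case: eqP => // ->; rewrite h'y.
  have -> : h = (t x * h')%g by rewrite mulKVg.
  rewrite pactM (alt_antisym _ _ h'C2) linearZ /= scalerA colcharM // colchar_tperm.
  rewrite permM h'y /= tpermR -mulrA; congr (_ *: _).
  have -> : colchar K f3 o h' = colchar K f2 o h'.
    by congr (_ * _); apply: eq_bigr => i _ /=; rewrite of3.
  by rewrite colchar_sq mulr1.
have {}IHN h : h \in colgrp f3 -> f (h.1 y) != c -> exists k, lower (spldeg f o)
    (fun v => alt f o (pact (t (h.1 y) * g)%g (alt f o v)) - k *: alt f o v).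
  move=> hC hx; apply: IHN; rewrite -ltnS; apply: leq_trans hN; rewrite ltnS; apply: proper_card.
  have xy : h.1 y != y by apply: contraNneq hx => ->; rewrite fy.
  have f2x : f2 (h.1 y) = c by have := f3c h hC; rewrite /f3 (negPf xy).
  have E i : f (((t (h.1 y) * g)%g.1^-1)%g i) = f2 (tperm (h.1 y) y i).
    by rewrite /f2 /= invMg permM tpermV.
  apply/properP; split; last first.
    exists y; rewrite inE ?E fy 1?eq_sym // tpermR f2x eqxx //.
  apply/fintype.subsetP => i; rewrite !inE E -/(f2 i); case: tpermP => [->|->|_ _] //.
    by rewrite f2x.
  by rewrite f2x fy eqxx.
pose S1 := [set h in colgrp f3 | f (h.1 y) == c].
have Spos : (#|S1|%:R : K) != 0.
  rewrite (char0_natr K0) -lt0n; apply/card_gt0P; exists 1%g.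
  by rewrite inE colgrp1 perm1 fy eqxx.
(* Expand [alt f3 o] over [h]. If [h] sends [y] to an entry of column [c] of [f], the outer
   [alt f o] absorbs the transposition and its sign; these terms give the left-hand side. The others
   have sign -1 and fall under the induction hypothesis. *)
have main v : #|S1|%:R *: alt f o (pact g (alt f o v)) =
    alt f o (alt f3 o (alt f2 o (pact g v))) +
    \sum_(h in colgrp f3 | f (h.1 y) != c) alt f o (pact (t (h.1 y) * g)%g (alt f o v)).
  have -> : alt f3 o (alt f2 o (pact g v)) =
      \sum_(h in colgrp f3) (-1) ^+ (h.1 y != y) *: pact (t (h.1 y)) (alt f2 o (pact g v)).
    by apply: eq_bigr => h hC; apply: step.
  under [X in _ = _ + X]eq_bigr => h _ do rewrite pactM qE.
  rewrite qE; move: (alt f2 o (pact g v)) => q.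
  have -> : alt f o (\sum_(h in colgrp f3) (-1) ^+ (h.1 y != y) *: pact (t (h.1 y)) q) =
      \sum_(h in colgrp f3) alt f o ((-1) ^+ (h.1 y != y) *: pact (t (h.1 y)) q).
    exact: linear_sum.
  rewrite [in RHS](bigID (fun h : G => f (h.1 y) == c)) /= -addrA -[LHS]addr0; congr (_ + _).
    rewrite scaler_nat -sumr_const big_set /=; apply: eq_big => [h|h /andP[hC /eqP e]] //.
    by rewrite linearZ /= alt_pact ?colgrp_tperm ?e //
      colchar_tperm scalerA -signr_addb addbb scale1r.
  rewrite -big_split big1 //= => h /andP[hC hx].
  have xy : h.1 y != y by apply: contraNneq hx => ->; rewrite fy.
  by rewrite xy linearZ /= scaleN1r addNr.
have [k hk] : exists k : G -> K, forall h, h \in colgrp f3 -> f (h.1 y) != c ->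
   lower (spldeg f o) (fun v => alt f o (pact (t (h.1 y) * g)%g (alt f o v)) - k h *: alt f o v).
  have H h : exists k, h \in colgrp f3 -> f (h.1 y) != c ->
     lower (spldeg f o) (fun v => alt f o (pact (t (h.1 y) * g)%g (alt f o v)) - k *: alt f o v).
    case: (boolP ((h \in colgrp f3) && (f (h.1 y) != c))) => [/andP[h1 h2]|hN'].
      by have [k hk] := IHN h h1 h2; exists k.
    by exists 0 => h1 h2; rewrite h1 h2 in hN'.
  by have /choice[k hk] := H; exists k.
exists (#|S1|%:R^-1 * \sum_(h in colgrp f3 | f (h.1 y) != c) k h).
apply: (@lower_ext _ (fun v => #|S1|%:R^-1 *: (alt f o (alt f3 o (alt f2 o (pact g v))) +
   \sum_(h in colgrp f3 | f (h.1 y) != c)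
     (alt f o (pact (t (h.1 y) * g)%g (alt f o v)) - k h *: alt f o v)))).
  move=> v; rewrite sumrB addrA -main scalerBr scalerA mulVf // scale1r.
  by rewrite -scaler_suml scalerA.
apply: lowerZ; apply: (@lowerD _ _ (fun v => alt f o (alt f3 o (alt f2 o (pact g v))))
  (fun v => \sum_(h in colgrp f3 | f (h.1 y) != c)
     (alt f o (pact (t (h.1 y) * g)%g (alt f o v)) - k h *: alt f o v))) => //.
- apply: (@lower_altl _ (fun v => alt f3 o (alt f2 o (pact g v))) f o).
  pose F2 v := \sum_(h in colgrp f2) colchar K f2 o h *: pact 1%g (alt f3 o (pact (h * g)%g v)).
  apply: (@lower_ext _ F2) => [v|].
    have -> : alt f3 o (alt f2 o (pact g v)) =
        \sum_(h in colgrp f2) alt f3 o (colchar K f2 o h *: pact h (pact g v)).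
      exact: linear_sum.
    apply: eq_bigr => h _.
    by rewrite pact1 linearZ /= -pactM.
  by apply: lower_sum => h _; apply: (lowerG lt) => v.
- by apply: lower_sum => h /andP[h1 h2]; apply: hk h1 h2.
Qed.

Lemma natr_neq0 k : (0 < k)%N -> (k%:R : K) != 0.
Proof. by rewrite (char0_natr K0) -lt0n. Qed.

Lemma card_colgrp_gt0 f : (0 < #|colgrp f|)%N.
Proof. by apply/card_gt0P; exists 1%g; apply: colgrp1. Qed.

(** * Matrix coefficients for an invariant bilinear form *)

Section Dot.
Variable d : nat.

Definition dot p q : K := \sum_(m : 'X_{1..n < d}) p@_m * q@_m.

Lemma dotDl p1 p2 q c : dot (c *: p1 + p2) q = c * dot p1 q + dot p2 q.
Proof.
rewrite /dot mulr_sumr -big_split; apply: eq_bigr => m _ /=.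
by rewrite mcoeffD mcoeffZ mulrDl mulrA.
Qed.

Lemma dotC p q : dot p q = dot q p.
Proof. by apply: eq_bigr => m _; rewrite mulrC. Qed.

Lemma dotDr p q1 q2 c : dot p (c *: q1 + q2) = c * dot p q1 + dot p q2.
Proof. by rewrite dotC dotDl ![dot _ p]dotC. Qed.

Lemma dot0l q : dot 0 q = 0.
Proof. by apply: big1 => m _; rewrite mcoeff0 mul0r. Qed.

Lemma dotZl p q c : dot (c *: p) q = c * dot p q.
Proof. by rewrite -[c *: p]addr0 dotDl dot0l addr0. Qed.

Lemma dotZr p q c : dot p (c *: q) = c * dot p q.
Proof. by rewrite dotC dotZl dotC. Qed.

Lemma dot_suml (T : Type) (s : seq T) (P : pred T) (F : T -> poly) q :
  dot (\sum_(t <- s | P t) F t) q = \sum_(t <- s | P t) dot (F t) q.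
Proof.
apply: (big_morph (fun p => dot p q)) => [p1 p2|]; last exact: dot0l.
by rewrite -[p1 in LHS]scale1r dotDl mul1r.
Qed.

Lemma dot_sumr (T : Type) (s : seq T) (P : pred T) (F : T -> poly) p :
  dot p (\sum_(t <- s | P t) F t) = \sum_(t <- s | P t) dot p (F t).
Proof. by rewrite dotC dot_suml; apply: eq_bigr => t _; rewrite dotC. Qed.

Lemma dot_pact g p q : dot (pact g p) (pact g q) = dot p q.
Proof.
have lt (m : 'X_{1..n < d}) : (mdeg ((val m)#(g.1)) < d)%N by rewrite mdeg_mperm (valP m).
have inj : injective (fun m => BMultinom (lt m)).
  by move=> m1 m2 /(congr1 val) /= /mperm_inj/val_inj.
rewrite /dot [RHS](reindex_inj inj); apply: eq_bigr => m _ /=.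
by rewrite !mcoeff_pact mulrACA flip_sign_sq mul1r.
Qed.

(* The operator attached to a matrix coefficient of the regular representation. *)
Definition coefop p q v := \sum_(h : G) dot p (pact h q) *: pact h v.

Lemma coefop_pactl g p q v : coefop (pact g p) q v = pact g (coefop p q v).
Proof.
rewrite /coefop linear_sum (reindex_inj (mulgI g)); apply: eq_bigr => h _ /=.
by rewrite !pactM dot_pact linearZ.
Qed.

Lemma coefop_pactr g p q v : coefop p q (pact g v) = coefop p (pact g^-1%g q) v.
Proof.
rewrite /coefop [RHS](reindex_inj (mulIg g)); apply: eq_bigr => h _ /=.
by rewrite -!pactM mulgK.
Qed.

Lemma coefopDl c p1 p2 q v : coefop (c *: p1 + p2) q v = c *: coefop p1 q v + coefop p2 q v.
Proof.
rewrite /coefop scaler_sumr -big_split; apply: eq_bigr => h _ /=.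
by rewrite dotDl scalerDl scalerA.
Qed.

Lemma coefopDr c p q1 q2 v : coefop p (c *: q1 + q2) v = c *: coefop p q1 v + coefop p q2 v.
Proof.
rewrite /coefop scaler_sumr -big_split; apply: eq_bigr => h _ /=.
by rewrite linearP /= dotDr scalerDl scalerA.
Qed.

Lemma coefop0l q v : coefop 0 q v = 0.
Proof. by apply: big1 => h _; rewrite dot0l scale0r. Qed.

Lemma coefop0r p v : coefop p 0 v = 0.
Proof. by apply: big1 => h _; rewrite linear0 dotC dot0l scale0r. Qed.

Lemma coefopZl c p q v : coefop (c *: p) q v = c *: coefop p q v.
Proof. by rewrite -[c *: p]addr0 coefopDl coefop0l addr0. Qed.

Lemma coefopZr c p q v : coefop p (c *: q) v = c *: coefop p q v.
Proof. by rewrite -[c *: q]addr0 coefopDr coefop0r addr0. Qed.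

Lemma coefop_is_linear p q : linear (coefop p q).
Proof.
move=> c u v; rewrite /coefop scaler_sumr -big_split; apply: eq_bigr => h _ /=.
by rewrite linearP /= scalerDr !scalerA mulrC.
Qed.
HB.instance Definition _ p q :=
  GRing.isLinear.Build K poly poly _ (coefop p q) (coefop_is_linear p q).

Lemma alt_coefop f o p q v : alt f o (coefop p q v) = coefop (alt f o p) q v.
Proof.
rewrite /alt; elim/big_rec2: _ => [|g x y _ ->]; first by rewrite coefop0l.
by rewrite coefopDl coefop_pactl.
Qed.

(** Inversion preserves the column group and its character, so antisymmetrizers pass from the
    argument to [q] unchanged. *)
Lemma coefop_alt f o p q v : coefop p q (alt f o v) = coefop p (alt f o q) v.
Proof.
rewrite /alt linear_sum /= (reindex_inj invg_inj) /=.
transitivity (\sum_(g in colgrp f) colchar K f o g *: coefop p (pact g q) v).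
  apply: eq_big => [g|g hg]; first by apply/idP/idP => /colgrpV; rewrite ?invgK.
  have hg' : g \in colgrp f by rewrite -(invgK g); apply: colgrpV.
  by rewrite linearZ /= coefop_pactr invgK colcharV.
elim/big_rec2: _ => [|g x y _ ->]; first by rewrite coefop0r.
by rewrite coefopDr.
Qed.

Definition intval (x : K) := exists z : int, x = z%:~R.

Lemma intval_sum (T : Type) (s : seq T) (P : pred T) (F : T -> K) :
  (forall t, P t -> intval (F t)) -> intval (\sum_(t <- s | P t) F t).
Proof.
move=> hF; elim/big_ind: _ => // [|x y [a ->] [b ->]]; first by exists 0.
by exists (a + b); rewrite rmorphD.
Qed.

Lemma intval_mul x y : intval x -> intval y -> intval (x * y).
Proof. by move=> [a ->] [b ->]; exists (a * b); rewrite rmorphM. Qed.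

Lemma intval_sign b : intval ((-1) ^+ b).
Proof. by exists ((-1) ^+ b); rewrite rmorphXn rmorphN1. Qed.

(** Integrality supplies the positivity that is missing in [K], where a sum of squares may vanish
    nontrivially. *)
Lemma sum_sqr_eq0 (T : finType) (F : T -> K) : (forall t, intval (F t)) ->
  \sum_t F t * F t = 0 -> forall t, F t = 0.
Proof.
move=> /choice[z hz] h t; have : (\sum_t z t * z t)%:~R = 0 :> K.
  by rewrite rmorph_sum -[RHS]h; apply: eq_bigr => s _; rewrite hz rmorphM.
move/eqP; rewrite (intr_eq0_pchar0 K0) Num.Theory.psumr_eq0 => [/allP/(_ t)|s _]; last first.
  by rewrite -expr2 Num.Theory.sqr_ge0.
by rewrite mem_index_enum mulf_eq0 orbb hz => /(_ isT) /eqP->.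
Qed.

(** The operator of the Specht polynomial against itself is a combination of products [alt g alt],
    each of which is a multiple of [alt] modulo [lower] by [alt_sandwich]. Evaluation at the Specht
    polynomial, which [lower] kills, shows that the total multiple is nonzero. *)
Lemma alt_coefop_lower f o : (spldeg f o < d)%N ->
  exists2 k, k != 0 & lower (spldeg f o)
    (fun v => alt f o v - k *: coefop (spl K f o) (spl K f o) v).
Proof.
move=> ltd; have hm := std_col_exps f o; set m := std_exps f o in hm.
(* A multiple of the Specht polynomial whose coefficients are visibly integers. *)
pose A : poly := alt f o 'X_[m]; have [par inj _] := hm.
have [c c0 hA] := alt_mnm_spl K0 hm; rewrite -/A in hA.
pose N : K := #|colgrp f|%:R; have N0 : N != 0 by apply/natr_neq0/card_colgrp_gt0.
have aA : antisym f o A by apply: alt_antisym.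
have altA : alt f o A = N *: A by apply: alt_of_antisym.
have intA m' : intval A@_m'.
  rewrite /A alt_mnm // raddf_sum; apply: intval_sum => g _.
  rewrite /= mcoeffZ mcoeffX; apply: intval_mul; first exact: intval_sign.
  by exists (Posz (nat_of_bool (m#(g.1^-1)%g == m')%MM)).
have intpA h m' : intval (pact h A)@_m'.
  rewrite mcoeff_pact; apply: intval_mul => //.
  rewrite /mnm_sign /flip_sign; elim/big_ind: _ => [|x y|i _].
  - by exists 1.
  - exact: intval_mul.
  - exact: intval_sign.
have intd h : intval (dot A (pact h A)) by apply: intval_sum => m' _; apply: intval_mul.
have dAA : dot A A != 0.
  have hmd : (mdeg m < d)%N by rewrite (mdeg_col_exps hm).
  apply/eqP => /(sum_sqr_eq0 (fun m' : 'X_{1..n < d} => intA m')) /(_ (BMultinom hmd)) /= /eqP.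
  by apply/negP; apply: alt_mnm_coeff.
have [k hk] : exists k : G -> K, forall h, lower (spldeg f o)
   (fun v => alt f o (pact h (alt f o v)) - k h *: alt f o v).
  by have /choice[k hk] := alt_sandwich f o; exists k.
pose kap := \sum_h dot A (pact h A) * k h.
have E v : (N * N) *: coefop A A v = alt f o (coefop A A (alt f o v)).
  by rewrite coefop_alt alt_coefop altA coefopZl coefopZr scalerA.
have L : lower (spldeg f o) (fun v => (N * N) *: coefop A A v - kap *: alt f o v).
  apply: (@lower_ext _ (fun v => \sum_h dot A (pact h A) *:
      (alt f o (pact h (alt f o v)) - k h *: alt f o v))).
    move=> v; rewrite E /coefop linear_sum /= /kap scaler_suml -sumrB.
    by apply: eq_bigr => h _; rewrite scalerBr scalerA; congr (_ - _); rewrite linearZ.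
  by apply: lower_sum => h _; apply/lowerZ/hk.
(* On A itself the operator is a sum of squares of integers. *)
have kap0 : kap != 0.
  apply: contraNneq dAA => k0; have := lower_spl L; rewrite k0 scale0r subr0.
  move/eqP; rewrite scaler_eq0 mulf_eq0 orbb (negPf N0) /= => /eqP.
  move=> /(congr1 (fun x => c *: x)); rewrite scaler0 -linearZ /= -hA.
  move=> /(congr1 (dot A)); rewrite dot_sumr [RHS]dotC dot0l => h0.
  rewrite -{2}[A]pact1; apply/eqP; apply: (sum_sqr_eq0 intd).
  by rewrite -[RHS]h0; apply: eq_bigr => h _; rewrite dotZr.
exists (kap^-1 * (N * N) * (c * c)); first by rewrite !mulf_neq0 ?invr_eq0.
apply: (@lower_ext _ (fun v => (- kap^-1) *: ((N * N) *: coefop A A v - kap *: alt f o v))).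
  move=> v; rewrite hA coefopZl coefopZr scalerBr !scalerA !mulNr mulVf //
    !scaleNr scale1r opprK addrC.
  by rewrite !mulrA.
exact: lowerZ.
Qed.

End Dot.

End LowerOperators.

(** * Generation over the invariants *)

Section Coinvariants.
Variables (K : fieldType) (n : nat).
Local Notation poly := {mpoly K[n]}.
Local Notation G := (hyperoct n).
Local Notation inv := (@hyp_invariant K n).
Implicit Types (g h : G) (p q s : poly) (m : 'X_{1..n}).

(** The staircase comes from the relations that make [x_i^(2 * (n - i))] reducible over the
    invariants. It has as many monomials as the group has elements, so that spanning will imply
    independence on a free orbit. *)
Definition stair := {dffun forall i : 'I_n, 'I_(2 * (n - i))}.

Definition stair_mnm (a : stair) : 'X_{1..n} := [multinom (a i : nat) | i < n].

Lemma stair_mnmP m : (forall i : 'I_n, m i < 2 * (n - i))%N -> exists a, m = stair_mnm a.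
Proof.
move=> h; exists (finfun (fun i => Ordinal (h i))).
by apply/mnmP => i; rewrite mnmE ffunE.
Qed.

Lemma card_stair : #|{: stair}| = #|{: G}|.
Proof.
rewrite card_dep_ffun foldrE big_map big_enum /=.
under eq_bigr => i _ do rewrite card_ord.
rewrite big_split /= prod_nat_const card_ord.
rewrite card_prod card_ffun card_bool card_ord mulnC; congr (_ * _)%N.
have -> : #|{: 'S_n}| = n`!.
  by rewrite -[RHS]card_Sn; apply: eq_card => x; rewrite inE.
rewrite fact_prod big_add1 /= big_mkord (reindex_inj rev_ord_inj) /=.
by apply: eq_big => [i|i _]; rewrite ?inE // subKn.
Qed.

(* The degree-d part of the module spanned by the staircase monomials over the
   invariants, bounding each summand rather than only the sum. *)
Inductive dspan (d : nat) : poly -> Prop :=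
| dspan0 : dspan d 0
| dspanD p q : dspan d p -> dspan d q -> dspan d (p + q)
| dspanM s a : s \in inv -> (msize s + mdeg (stair_mnm a) <= d)%N ->
    dspan d (s * 'X_[stair_mnm a]).

Lemma invC (c : K) : c%:MP_[n] \in inv.
Proof. by apply/hyp_invariantP => g; rewrite /pact comp_mpolyC. Qed.

Lemma dspan_inv d d' s p : s \in inv -> (msize s + d <= d'.+1)%N -> dspan d p -> dspan d' (s * p).
Proof.
move=> hs hd; elim=> {p} [|p q _ hp _ hq|t a ht le].
- by rewrite mulr0; apply: dspan0.
- by rewrite mulrDr; apply: dspanD.
have [->|s0] := eqVneq s 0; first by rewrite mul0r; apply: dspan0.
have [->|t0] := eqVneq t 0; first by rewrite mul0r mulr0; apply: dspan0.
rewrite mulrA; apply: dspanM; first exact: rpredM.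
rewrite (msizeM s0 t0) -subn1; move: s0 t0 le hd; rewrite -!msize_poly_eq0.
by move: (msize s) (msize t) (mdeg _) => x y z *; lia.
Qed.

Lemma dspan_leq d d' p : (d <= d')%N -> dspan d p -> dspan d' p.
Proof.
move=> le h; rewrite -[p]mul1r; apply: dspan_inv h; first exact: rpred1.
by rewrite msize1.
Qed.

Lemma dspanZ d c p : dspan d p -> dspan d (c *: p).
Proof.
move=> h; rewrite -mul_mpolyC; apply: dspan_inv h; first exact: invC.
by rewrite msizeC; case: (c != 0).
Qed.

Lemma dspanN d p : dspan d p -> dspan d (- p).
Proof. by rewrite -scaleN1r; apply: dspanZ. Qed.

Let y (i : 'I_n) : poly := 'X_i ^+ 2.

Let yX i m : y i * 'X_[m] = 'X_[m + (U_(i) + U_(i))].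
Proof. by rewrite [RHS]mpolyXD mulrC mpolyXD /y expr2. Qed.

Let mdeg_y i m : mdeg (m + (U_(i) + U_(i))) = (mdeg m + 2)%N.
Proof. by rewrite !mdegD mdeg1. Qed.

Let wgt_y (i : 'I_n) m : mnmwgt (m + (U_(i) + U_(i))) = (mnmwgt m + 2 * i.+1)%N.
Proof. by rewrite !mnmwgtD mnmwgt1 mul2n addnn. Qed.

(* The elementary symmetric polynomials in the squares of x_k, x_(k+1), ... *)
Definition tailsym k j : poly := (\prod_(i < n | (k <= i)%N) (1 + (y i)%:P * 'X))`_j.

Lemma tailsymS (i : 'I_n) j :
  tailsym i j.+1 = tailsym i.+1 j.+1 + y i * tailsym i.+1 j.
Proof.
rewrite /tailsym (bigD1 i) //= (eq_bigl (fun k : 'I_n => (i.+1 <= k)%N)) => [|k]; last first.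
  by rewrite ltn_neqAle andbC eq_sym.
by rewrite mulrDl mul1r coefD -mulrA coefCM coefXM.
Qed.

Lemma tailsym0 k : tailsym k 0 = 1.
Proof.
rewrite /tailsym -horner_coef0 horner_prod big1 // => i _.
by rewrite hornerD hornerMX mulr0 addr0 -polyC1 hornerC.
Qed.

Lemma tailsymn j : tailsym n j.+1 = 0.
Proof.
rewrite /tailsym big_pred0 ?coef1 // => i.
by rewrite leqNgt ltn_ord.
Qed.

Lemma tailsym_ind (P : nat -> Prop) : P n -> (forall i : 'I_n, P i.+1 -> P i) ->
  forall k, (k <= n)%N -> P k.
Proof.
move=> Pn PS k le; rewrite -(subKn le); elim: (n - k)%N (leq_subr k n) => [|d IHd] hd.
  by rewrite subn0.
have lt : (n - d.+1 < n)%N by lia.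
by apply: (PS (Ordinal lt)); rewrite /= subnSK //; apply: IHd; apply: ltnW.
Qed.

Lemma tailsym_eq0 k j : (k <= n)%N -> (n - k < j)%N -> tailsym k j = 0.
Proof.
move=> le; move: k le j; apply: tailsym_ind => [|i IHi] [|j] //.
  by move=> _; apply: tailsymn.
move=> lt; have := ltn_ord i => lti.
by rewrite tailsymS !IHi ?mulr0 ?addr0 //; lia.
Qed.

Lemma msize_tailsym k j : (k <= n)%N -> (msize (tailsym k j) <= (2 * j).+1)%N.
Proof.
move=> le; move: k le j; apply: tailsym_ind => [|i IHi] [|j].
- by rewrite tailsym0 msize1.
- by rewrite tailsymn msize0.
- by rewrite tailsym0 msize1.
rewrite tailsymS; apply: leq_trans (msizeD_le _ _) _; rewrite geq_max IHi /=.
have [->|t0] := eqVneq (tailsym i.+1 j) 0; first by rewrite mulr0 msize0.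
have y0 : y i != 0 by rewrite expf_neq0 // -msize_poly_eq0 msizeX mdeg1.
rewrite msizeM // /y expr2 -mpolyXD msizeX mdegD mdeg1.
by have := IHi j; move: (msize _) => x; lia.
Qed.

Lemma tailsym_inv j : tailsym 0 j \in inv.
Proof.
apply/hyp_invariantP => g; rewrite /tailsym -coef_map rmorph_prod /=.
apply: (congr1 (fun p : {poly poly} => p`_j)).
rewrite [RHS](reindex_inj (@perm_inj _ g.1)) /=; apply: eq_bigr => i _.
rewrite rmorphD rmorph1 rmorphM /= map_polyX map_polyC /=; congr (1 + _%:P * _).
by rewrite /y rmorphXn /= pactX exprMn sqrr_sign mul1r.
Qed.

Section Reduction.
Variable W : nat.
Hypothesis IHW : forall m, (mnmwgt m < W)%N -> dspan (mdeg m).+1 'X_[m].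

(** The recursion trades the tail from [k + 1] for the tail from [k] and a factor [y] of index [k].
    It ends at the full symmetric polynomials, which are invariant; each of the at most [j] factors
    so produced has index below [k], hence weight at most [2 * k]. *)
Lemma dspan_tailsym k j m : (k <= n)%N -> (mnmwgt m + 2 * j * k < W)%N ->
  dspan (mdeg m + 2 * j).+1 (tailsym k j * 'X_[m]).
Proof.
elim: k j m => [|k IHk] j m le hW.
  apply: dspan_inv (IHW _); [exact: tailsym_inv| |by rewrite muln0 addn0 in hW].
  by have := msize_tailsym j le; move: (msize _) (mdeg m) => a b; lia.
elim: j m hW => [|j IHj] m hW.
  by rewrite tailsym0 mul1r muln0 addn0; apply: IHW; rewrite muln0 mul0n addn0 in hW.
have E := tailsymS (Ordinal le) j; rewrite /= in E.
have -> : tailsym k.+1 j.+1 * 'X_[m] =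
    tailsym k j.+1 * 'X_[m] - tailsym k.+1 j * (y (Ordinal le) * 'X_[m]).
  by rewrite E; ring.
rewrite yX; apply: dspanD; [|apply: dspanN].
  by apply: IHk; [exact: ltnW|move: hW; lia].
have -> : (mdeg m + 2 * j.+1 = mdeg (m + (U_(Ordinal le) + U_(Ordinal le))) + 2 * j)%N.
  by rewrite mdeg_y; lia.
by apply: IHj; rewrite wgt_y /=; move: hW; lia.
Qed.

(** The power of [y i] is the only term of the recursion that may reach weight [W]; once it is
    subtracted, the rest reduces. *)
Lemma dspan_tailsym_pow (i : 'I_n) j m : (mnmwgt m + 2 * j * i.+1 <= W)%N ->
  dspan (mdeg m + 2 * j).+1 ((tailsym i.+1 j - (- y i) ^+ j) * 'X_[m]).
Proof.
elim: j m => [|j IHj] m hW.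
  by rewrite tailsym0 expr0 subrr mul0r; apply: dspan0.
have -> : (tailsym i.+1 j.+1 - (- y i) ^+ j.+1) * 'X_[m] =
    tailsym i j.+1 * 'X_[m] - (tailsym i.+1 j - (- y i) ^+ j) * (y i * 'X_[m]).
  by rewrite tailsymS exprS; ring.
apply: dspanD; [apply: dspan_tailsym|apply: dspanN].
- by apply: ltnW.
- by move: hW; lia.
have -> : (mdeg m + 2 * j.+1 = mdeg (m + (U_(i) + U_(i))) + 2 * j)%N.
  by rewrite mdeg_y; lia.
by rewrite yX; apply: IHj; rewrite wgt_y; move: hW; lia.
Qed.

End Reduction.

Lemma dspan_mnm m : dspan (mdeg m).+1 'X_[m].
Proof.
move: {2}(mnmwgt m).+1 (ltnSn (mnmwgt m)) => N; elim: N m => // N IHN m hN.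
case: (pselect (forall i : 'I_n, m i < 2 * (n - i))%N) => [/stair_mnmP[a ->]|].
  by rewrite -['X_[_]]mul1r; apply: dspanM; rewrite ?rpred1 // msize1.
move=> /existsNP[i /negP]; rewrite -leqNgt => hi.
pose m' := [multinom (m j - (2 * (n - i)) * (j == i))%N | j < n].
have mE : m = (m' + U_(i) *+ (2 * (n - i)))%MM.
  apply/mnmP => j; rewrite !mnmE mulmnE mnm1E (eq_sym i j).
  by case: eqP => [->|_]; rewrite ?muln1 ?muln0 ?mul1n ?mul0n; lia.
have IH m0 : (mnmwgt m0 < mnmwgt m)%N -> dspan (mdeg m0).+1 'X_[m0].
  by move=> lt; apply: IHN; apply: leq_trans lt _.
have wE : mnmwgt m = (mnmwgt m' + 2 * (n - i) * i.+1)%N.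
  rewrite {1}mE mnmwgtD; congr (_ + _)%N.
  by elim: (2 * (n - i))%N => [|d IHd];
    rewrite ?mulmS ?mnmwgtD ?IHd ?mnmwgt1 ?mulSn // mulm0n mnmwgt0.
have := @dspan_tailsym_pow _ IH i (n - i) m'; rewrite wE leqnn => /(_ isT).
(* Only [n - i - 1] squares come after the one of index [i], so their elementary symmetric
   polynomial of degree [n - i] is zero and the power of [y i] itself is reduced. *)
rewrite tailsym_eq0 //; last by have := ltn_ord i; lia.
rewrite sub0r => h.
have -> : 'X_[m] = (- (-1) ^+ (n - i)) *: (- (- y i) ^+ (n - i) * 'X_[m']).
  rewrite {1}mE mpolyXD -mpolyXn exprM -/(y i) [(- y i) ^+ _]exprNn -(signr_odd K (n - i)) -(signr_odd poly (n - i)).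
  by case: (odd _); rewrite ?expr0 ?expr1 ?opprK ?scale1r ?scaleN1r; ring.
suff -> : mdeg m = (mdeg m' + 2 * (n - i))%N by apply: dspanZ.
by rewrite mE mdegD mdegMn mdeg1 mul1n.
Qed.

Lemma dspan_msize p : dspan (msize p) p.
Proof.
rewrite [X in dspan _ X]mpolyE big_seq; elim/big_rec: _ => [|m q hm hq]; first exact: dspan0.
apply: dspanD => //; apply: dspanZ; apply: dspan_leq (dspan_mnm m).
exact: msize_mdeg_lt.
Qed.

(** * Evaluation on a free orbit *)

Hypothesis K0 : [pchar K] =i pred0.

Let pt (i : 'I_n) : K := i.+1%:R.

Let ev p : 'rV[K]_#|{: G}| := \row_j (pact (enum_val j) p).@[pt].

Let ev_is_linear : linear ev.
Proof. by move=> c p q; apply/rowP => j; rewrite !mxE linearP /= mevalD mevalZ. Qed.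
HB.instance Definition _ := GRing.isLinear.Build K poly _ _ ev ev_is_linear.

Let evE p g : ev p 0 (enum_rank g) = (pact g p).@[pt].
Proof. by rewrite mxE enum_rankK. Qed.

Let ev_pact h p q : ev p = ev q -> ev (pact h p) = ev (pact h q).
Proof.
move=> e; apply/rowP => j; rewrite !mxE -!pactM -!evE.
by rewrite e.
Qed.

Let ev_inv s p : s \in inv -> ev (s * p) = s.@[pt] *: ev p.
Proof.
move/hyp_invariantP => hs; apply/rowP => j; rewrite !mxE rmorphM /= hs.
exact: mevalM.
Qed.

(** The coordinates 1, ..., n have distinct squares and differ from their opposites. *)
Lemma orbit_free (g h : G) :
  (forall i, (-1) ^+ g.2 i * pt (g.1 i) = (-1) ^+ h.2 i * pt (h.1 i)) -> g = h.
Proof.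
move=> e; have eqi i : g.1 i = h.1 i.
  have /(congr1 (fun x => x ^+ 2)) := e i; rewrite !exprMn !sqrr_sign !mul1r /pt -!natrX.
  move/eqP; rewrite -subr_eq0 !pmulrn -intrB (intr_eq0_pchar0 K0) subr_eq0 eqz_nat eqn_sqr eqSS => /eqP.
  exact: val_inj.
case: g h e eqi => [s u] [t v] /= e eqi; have -> : s = t by apply/permP.
congr pair; apply/ffunP => i; have := e i; rewrite eqi => /mulIf h.
have /h : pt (t i) != 0 by rewrite /pt (char0_natr K0).
case: (u i) (v i) => [] [] //=; rewrite expr0 expr1 => /eqP.
  by rewrite eq_sym -subr_eq0 opprK -mulr2n (char0_natr K0).
by rewrite -subr_eq0 opprK -mulr2n (char0_natr K0).
Qed.

(** Interpolation: the orbit is free, so products of affine forms separate its points. *)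
Lemma ev_surj (w : 'rV_#|{: G}|) : exists p, ev p = w.
Proof.
have delta g : exists p, forall h, (pact h p).@[pt] = (h == g)%:R.
  have sep h : exists p, h != g -> p.@[fun i => (-1) ^+ g.2 i * pt (g.1 i)] = 1 /\
      p.@[fun i => (-1) ^+ h.2 i * pt (h.1 i)] = 0.
    case: (eqVneq h g) => [->|ne]; first by exists 0.
    have : exists i, (-1) ^+ h.2 i * pt (h.1 i) != (-1) ^+ g.2 i * pt (g.1 i).
      apply/not_existsP => e; case/eqP: ne; apply: orbit_free => i.
      by apply/eqP/negPn/negP; apply: e.
    case=> i; set a := _ * _; set b := _ * _ => ab.
    exists ((b - a)^-1 *: ('X_i - a%:MP)) => _.
    by rewrite !mevalZ !mevalB !mevalXU !mevalC subrr mulr0 mulVf // subr_eq0 eq_sym.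
  have /choice[P hP] := sep.
  exists (\prod_(h | h != g) P h) => h; rewrite meval_pact rmorph_prod /=.
  case: eqVneq => [->|ne]; first by rewrite big1 // => k /hP[].
  by rewrite (bigD1 h) //=; have [_ ->] := hP h ne; rewrite mul0r.
have /choice[D hD] := delta.
exists (\sum_j w 0 j *: D (enum_val j)); rewrite linear_sum /=; apply/rowP => j.
rewrite summxE (bigD1 j) //= big1 => [|k kj]; last first.
  rewrite linearZ /= !mxE hD (inj_eq enum_val_inj) eq_sym (negPf kj) mulr0 //.
by rewrite linearZ /= !mxE hD eqxx mulr1 addr0.
Qed.

Section Span.
Variable F : poly -> Prop.
Hypotheses (F0 : F 0) (FD : forall p q, F p -> F q -> F (p + q))
  (FM : forall s p, s \in inv -> F p -> F (s * p)).

(** The coefficients [c] are the values at [pt] of the invariant coefficients. For the last clause,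
    a summand in which the invariant is constant cancels; in any other the staircase monomial has
    strictly smaller degree. *)
Lemma dspan_ev d p : dspan d p -> exists c : stair -> K,
  [/\ ev p = \sum_a c a *: ev 'X_[stair_mnm a],
      forall a, c a != 0 -> (mdeg (stair_mnm a) < d)%N
    & (forall a, ((mdeg (stair_mnm a)).+1 < d)%N -> F 'X_[stair_mnm a]) ->
      F (p - \sum_a c a *: 'X_[stair_mnm a])].
Proof.
elim=> {p} [|p q _ [c [c1 c2 c3]] _ [e [e1 e2 e3]]|s a hs le].
- exists (fun=> 0); split; first 1 last.
  + by move=> a; rewrite eqxx.
  + by move=> _; rewrite big1 ?subr0 // => a _; rewrite scale0r.
  by rewrite linear0 big1 // => a _; rewrite scale0r.
- exists (fun a => c a + e a); split.
  + rewrite linearD /= c1 e1 -big_split; apply: eq_bigr => a _.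
    by rewrite scalerDl.
  + move=> a; case: (eqVneq (c a) 0) => [->|/c2 //].
    by rewrite add0r; apply: e2.
  move=> h; have -> : p + q - \sum_a (c a + e a) *: 'X_[stair_mnm a] =
      p - \sum_a c a *: 'X_[stair_mnm a] + (q - \sum_a e a *: 'X_[stair_mnm a]).
    rewrite (eq_bigr (fun a => c a *: 'X_[stair_mnm a] + e a *: 'X_[stair_mnm a])) => [|a _].
      by rewrite big_split /=; ring.
    by rewrite scalerDl.
  by apply: FD; [apply: c3|apply: e3].
have sumE (V : lmodType K) (x : stair -> V) :
    \sum_b (s.@[pt] * (b == a)%:R) *: x b = s.@[pt] *: x a.
  rewrite (bigD1 a) //= eqxx mulr1 big1 ?addr0 // => b /negPf->.
  by rewrite mulr0 scale0r.
exists (fun b => s.@[pt] * (b == a)%:R); split.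
- by rewrite sumE ev_inv.
- move=> b; case: (eqVneq b a) => [->|_]; last by rewrite mulr0 eqxx.
  rewrite mulr1 => s0; apply: leq_trans le; rewrite -add1n leq_add2r lt0n msize_poly_eq0.
  by apply: contraNneq s0 => ->; rewrite meval0.
move=> h; rewrite sumE -mul_mpolyC -mulrBl.
case: (leqP (msize s) 1) => hs1; last first.
  by apply: FM; [apply: rpredB => //; apply: invC|apply: h; apply: leq_trans le;
    rewrite -addn1 addnC; lia].
by rewrite (msize1_polyC hs1) mevalC subrr mul0r.
Qed.

End Span.

(** The evaluations of the staircase monomials span, because these monomials span all polynomials
    over the invariants, and there are exactly |G| of them: the matrix is square and invertible. *)
Lemma stair_coords : exists cf : 'rV[K]_#|{: G}| -> stair -> K,
  (forall w, w = \sum_a cf w a *: ev 'X_[stair_mnm a]) /\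
  (forall w (c : stair -> K), w = \sum_a c a *: ev 'X_[stair_mnm a] -> c =1 cf w).
Proof.
pose M := \matrix_i ev 'X_[stair_mnm (enum_val i)] : 'M[K]_(#|{: stair}|, _).
have sumE (c : stair -> K) :
    \sum_a c a *: ev 'X_[stair_mnm a] = (\row_i c (enum_val i)) *m M.
  rewrite mulmx_sum_row (reindex_onto (@enum_val _ _) enum_rank) /= => [|a _];
    last exact: enum_rankK.
  by apply: eq_big => [i|i _]; rewrite ?enum_valK ?eqxx // mxE rowK.
have full : row_full M.
  rewrite -sub1mx; apply/row_subP => i; have [p <-] := ev_surj (row i 1%:M).
  have [c [-> _ _]] := @dspan_ev (fun=> True) I (fun _ _ _ _ => I) (fun _ _ _ _ => I) _ _ (dspan_msize p).
  by rewrite sumE submxMl.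
have free : row_free M by rewrite /row_free (eqP full) card_stair.
exists (fun w a => (w *m pinvmx M) 0 (enum_rank a)); split=> [w|w c ->].
  rewrite sumE -[LHS](mulmxKpV (submx_full w full)); congr (_ *m _).
  by apply/rowP => i; rewrite !mxE enum_valK.
rewrite sumE => a; have := mulmxKpV (submxMl (\row_i c (enum_val i)) M).
by move/(row_free_inj free)->; rewrite mxE enum_rankK.
Qed.

(* A is an equivariant section, up to the factor |G|, of the evaluation on a free
   orbit, and does not raise degrees; D interpolates the indicator of 1. *)
Lemma invariants_cyclic : exists h0 : poly, forall p, exists2 s : G -> poly,
  (forall g, s g \in inv) & p = \sum_g s g * pact g h0.
Proof.
have [cf [cfE cfU]] := stair_coords.
have cfP c w1 w2 : cf (c *: w1 + w2) =1 (fun a => c * cf w1 a + cf w2 a).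
  move=> a; rewrite -(@cfU _ (fun a => c * cf w1 a + cf w2 a)) //.
  rewrite {1}(cfE w1) {1}(cfE w2) scaler_sumr -big_split; apply: eq_bigr => b _.
  by rewrite scalerDl scalerA.
have cf0 : cf 0 =1 (fun=> 0).
  by move=> a; rewrite -(@cfU _ (fun=> 0)) // big1 // => b _; rewrite scale0r.
pose L w := \sum_a cf w a *: 'X_[stair_mnm a] : poly.
have LP c w1 w2 : L (c *: w1 + w2) = c *: L w1 + L w2.
  rewrite /L scaler_sumr -big_split; apply: eq_bigr => a _.
  by rewrite cfP scalerDl scalerA.
have evL w : ev (L w) = w.
  rewrite [RHS]cfE linear_sum; apply: eq_bigr => a _.
  by rewrite linearZ.
have msL p : (msize (L (ev p)) <= msize p)%N.
  apply: msize_sum_le => a _; have [c [c1 c2 _]] :=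
    @dspan_ev (fun=> True) I (fun _ _ _ _ => I) (fun _ _ _ _ => I) _ _ (dspan_msize p).
  rewrite -(cfU _ _ c1); case: (eqVneq (c a) 0) => [->|/c2 lt].
    by rewrite scale0r msize0.
  by apply: leq_trans (msizeZ_le _ _) _; rewrite msizeX.
pose A p := \sum_g pact g (L (ev (pact g^-1%g p))).
have AP c p q : A (c *: p + q) = c *: A p + A q.
  rewrite /A scaler_sumr -big_split; apply: eq_bigr => g _ /=.
  by rewrite !linearP LP linearP.
have evA p : ev (A p) = #|{: G}|%:R *: ev p.
  rewrite linear_sum /= (eq_bigr (fun=> ev p)) => [|g _].
    by rewrite sumr_const scaler_nat; congr (_ *+ _); apply: eq_card.
  have /ev_pact e := evL (ev (pact g^-1%g p)).
  by rewrite e -pactM mulgV pact1.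
have A_ev p q : ev p = ev q -> A p = A q.
  by move=> e; apply: eq_bigr => g _; rewrite (ev_pact g^-1%g e).
have A_pact h p : A (pact h p) = pact h (A p).
  rewrite /A linear_sum (reindex_inj (mulgI h)); apply: eq_bigr => g _ /=.
  by rewrite -!pactM invMg mulgKV.
have msA p : (msize (A p) <= msize p)%N.
  apply: msize_sum_le => g _; apply: leq_trans (msize_pact _ _) _.
  by apply: leq_trans (msL _) (msize_pact _ _).
have [D hD] := ev_surj (\row_j (enum_val j == 1%g)%:R).
have {}hD g : (pact g D).@[pt] = (g == 1%g)%:R by rewrite -evE hD mxE enum_rankK.
exists (A D).
pose F p := exists2 s : G -> poly, (forall g, s g \in inv) & p = \sum_g s g * pact g (A D).
have F0 : F 0.
  by exists (fun=> 0) => [g|]; rewrite ?rpred0 // big1 // => g _; rewrite mul0r.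
have FD p q : F p -> F q -> F (p + q).
  move=> [s hs ->] [t ht ->]; exists (fun g => s g + t g) => [g|]; first by rewrite rpredD.
  by rewrite -big_split; apply: eq_bigr => g _; rewrite mulrDl.
have FM s p : s \in inv -> F p -> F (s * p).
  move=> hs [t ht ->]; exists (fun g => s * t g) => [g|]; first by rewrite rpredM.
  by rewrite mulr_sumr; apply: eq_bigr => g _; rewrite mulrA.
have FA p : F (A p).
  have A0 : A 0 = 0 by apply/eqP;
    rewrite -msize_poly_eq0 -leqn0 -[X in (_ <= X)%N](@msize0 n K) msA.
  (* [A] depends only on the evaluation, and translates of the indicator [D] express every
     evaluation. *)
  have -> : A p = A (\sum_g (pact g p).@[pt] *: pact g^-1%g D).
    apply: A_ev; apply/rowP => j; rewrite linear_sum summxE (bigD1 (enum_val j)) //=.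
    rewrite linearZ /= !mxE -pactM hD mulgV eqxx mulr1 big1 ?addr0 // => g ne.
    rewrite linearZ /= !mxE -pactM hD -eq_mulgV1 eq_sym (negPf ne).
    exact: mulr0.
  elim/big_rec: _ => [|g q _ hq]; first by rewrite A0.
  rewrite AP; apply: FD => //; rewrite -mul_mpolyC; apply: FM; first exact: invC.
  exists (fun h => (h == g^-1%g)%:R) => [h|]; first by rewrite rpred_nat.
  rewrite (bigD1 g^-1%g) //= eqxx mul1r A_pact big1 ?addr0 // => h /negPf->.
  by rewrite mul0r.
move=> p; rewrite -/(F p); move: {2}(msize p).+1 (ltnSn (msize p)) => N.
elim: N p => // N IHN p hN; pose c := #|{: G}|%:R^-1 : K.
have c0 : #|{: G}|%:R != 0 :> K.
  by rewrite (char0_natr K0) -lt0n; apply/card_gt0P; exists 1%g.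
pose q := p - c *: A p; have evq : ev q = 0.
  by rewrite linearB linearZ /= evA scalerA mulVf // scale1r subrr.
have msq : (msize q <= msize p)%N.
  apply: leq_trans (msizeD_le _ _) _; rewrite geq_max leqnn msizeN /=.
  by apply: leq_trans (msizeZ_le _ _) (msA _).
have -> : p = q + c%:MP * A p by rewrite mul_mpolyC subrK.
apply: (FD _ _); last by apply: (FM _ _); [exact: invC|exact: FA].
have [e [e1 _ e3]] := dspan_ev F0 FD FM (dspan_msize q).
(* As [q] vanishes on the orbit, its coefficients [e] are zero by uniqueness; the last clause of
   [dspan_ev] then needs only staircase monomials of degree below that of [p], where induction
   applies. *)
have -> : q = q - \sum_a e a *: 'X_[stair_mnm a].
  rewrite big1 ?subr0 // => a _; rewrite (cfU _ _ e1) evq cf0.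
  exact: scale0r.
apply: e3 => a lt; apply: IHN; rewrite msizeX.
by apply: leq_trans lt _; apply: leq_trans msq _.
Qed.

End Coinvariants.

(** * The quotient by a stable ideal *)

Section Bases.
Variables (K : fieldType) (V : lmodType K).
Implicit Types (A : set V) (x v : V).

Definition combo d (e : 'I_d -> V) v := exists c : 'I_d -> K, v = \sum_i c i *: e i.

Lemma comboD d (e : 'I_d -> V) a u v : combo e u -> combo e v -> combo e (a *: u + v).
Proof.
move=> [b ->] [c ->]; exists (fun i => a * b i + c i).
rewrite scaler_sumr -big_split; apply: eq_bigr => i _ /=.
by rewrite scalerA scalerDl.
Qed.

Lemma combo0 d (e : 'I_d -> V) : combo e 0.
Proof. by exists (fun=> 0); rewrite big1 // => i _; rewrite scale0r. Qed.

Lemma combo_gen d (e : 'I_d -> V) i : combo e (e i).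
Proof.
exists (fun j => (j == i)%:R); rewrite (bigD1 i) //= eqxx scale1r big1 ?addr0 //.
by move=> j /negPf->; rewrite scale0r.
Qed.

Lemma finite_basis (s : seq V) A : (forall v, A v -> v \in s) ->
  exists d (e : 'I_d -> V), is_basis (lin_span A) e.
Proof.
move=> hA; suff [d [e [eA efree espan]]] : exists d (e : 'I_d -> V),
    [/\ forall i, A (e i), forall c : 'I_d -> K, \sum_i c i *: e i = 0 -> forall i, c i = 0
      & forall v, A v -> combo e v].
  exists d, e; split=> // [i|v [k [c [x [xA ->]]]]].
    by exists 1%N, (fun=> 1), (fun=> e i); rewrite big_ord1 scale1r.
  elim/big_rec: _ => [|i u _ hu]; first exact: combo0.
  by apply: comboD => //; apply: espan.
elim: s A hA => [|x s IHs] A hA.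
  exists 0%N, (fun=> 0); split=> [[]|c _ []|v /hA] //.
have [|d [e [eA efree espan]]] := IHs (fun v => A v /\ v \in s); first by move=> v [].
have {}eA i : A (e i) by case: (eA i).
case: (pselect (A x /\ ~ combo e x)) => [[Ax nx]|h]; last first.
  exists d, e; split=> // v Av; have := hA v Av; rewrite inE => /predU1P[vx|vs].
    by subst v; apply: contrapT => nx; apply: h.
  exact: espan.
pose e' (i : 'I_d.+1) := if unlift ord0 i is Some j then e j else x.
have sumE (c : 'I_d.+1 -> K) :
    \sum_i c i *: e' i = c ord0 *: x + \sum_j c (lift ord0 j) *: e j.
  rewrite big_ord_recl /e' unlift_none; congr (_ + _).
  by apply: eq_bigr => j _; rewrite liftK.
exists d.+1, e'; split=> [i|c|v Av].
- by rewrite /e'; case: (unlift ord0 i).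
- rewrite sumE; case: (eqVneq (c ord0) 0) => [c0|c0 /eqP].
    rewrite c0 scale0r add0r => /efree h i.
    by case: (unliftP ord0 i) => [j ->|->].
  rewrite addr_eq0 => /eqP E; case: nx.
  exists (fun j => - (c ord0)^-1 * c (lift ord0 j)).
  rewrite -[LHS]scale1r -(mulVf c0) -scalerA E scalerN -scaleNr scaler_sumr.
  by apply: eq_bigr => j _; rewrite scalerA.
have := hA v Av; rewrite inE => /predU1P[->|vs].
  by have -> : x = e' ord0; [rewrite /e' unlift_none|apply: combo_gen].
have [c ->] := espan v (conj Av vs).
exists (fun i => if unlift ord0 i is Some j then c j else 0).
rewrite sumE unlift_none scale0r add0r; apply: eq_bigr => j _.
by rewrite liftK.
Qed.

Lemma lin_dim_basis (U : set V) : (exists d (e : 'I_d -> V), is_basis U e) ->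
  exists e : 'I_(lin_dim U) -> V, is_basis U e.
Proof. exact: (@xgetPex _ 0%N [set d | exists e : 'I_d -> V, is_basis U e]%classic). Qed.

End Bases.

Section SpechtBasis.
Variables (K : fieldType) (n : nat).

(** Bitableaux of a given shape are recovered from their reading words, which are permutations of
    [enum 'I_n]; hence the generating set is finite. *)
Lemma specht_mod_basis ab :
  exists e : 'I_(lin_dim (specht_mod K n ab)) -> {mpoly K[n]}, is_basis (specht_mod K n ab) e.
Proof.
apply: lin_dim_basis; apply: (@finite_basis _ _ [seq @specht K n
  (reshape ab.1 (take (sumn ab.1) t), reshape ab.2 (drop (sumn ab.1) t)) |
  t <- permutations (enum 'I_n)]) => _ [[T S] /and3P[/eqP/= h1 /eqP/= h2 h3] ->].
apply/mapP; exists (flatten T ++ flatten S); first by rewrite mem_permutations.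
by rewrite -h1 -h2 -size_flatten take_size_cat // drop_size_cat // !flattenK.
Qed.

End SpechtBasis.

Section Generators.
Variables (K : fieldType) (n : nat).
Local Notation poly := {mpoly K[n]}.
Local Notation G := (hyperoct n).
Hypothesis K0 : [pchar K] =i pred0.
Variables (I : ideal poly) (hI : hyp_stable I).
Implicit Types (g h : G) (p q v : poly) (f : 'I_n -> 'I_n) (o : 'I_n -> bool).

Lemma alt_spl_ideal f o p : spl K f o \in I -> alt f o p \in I.
Proof.
move=> h; have [q ->] := spl_dvd K0 (@alt_antisym K n f o p).
by rewrite mulrC idealM.
Qed.

Lemma spldeg_lt f o : (spldeg f o < (2 * n * n + n).+1)%N.
Proof.
rewrite ltnS; apply: leq_add.
  apply: (@leq_trans (\sum_(i < n) \sum_(j < n) 2)); last first.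
    by rewrite !sum_nat_const !card_ord mulnC mulnAC mulnC mulnA.
  by apply: leq_sum => i _;
    rewrite [X in (_ <= X)%N](bigID (fun j : 'I_n => (i < j)%N && (f i == f j))) leq_addr.
by rewrite sum1_card -[X in (_ <= X)%N]card_ord max_card.
Qed.

(* Orthogonality of the characters of the group of sign changes. *)
Lemma sum_alt_id p : \sum_(o : {ffun 'I_n -> bool}) alt id o p = (2 ^ n)%:R *: p.
Proof.
rewrite /alt exchange_big /=.
transitivity (\sum_(g in colgrp id) ((g == 1%g)%:R * (2 ^ n)%:R) *: pact g p); last first.
  rewrite (bigD1 1%g) ?colgrp1 //= eqxx mul1r pact1 big1 ?addr0 // => g /andP[_ /negPf->].
  by rewrite mul0r scale0r.
apply: eq_bigr => g /colgrpP /= hg; rewrite -scaler_suml; congr (_ *: _).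
have g1 : g.1 = 1%g by apply/permP => i; rewrite hg perm1.
rewrite /colchar g1 odd_perm1 /flip_sign /=.
under eq_bigr => o _ do rewrite mul1r.
rewrite -(bigA_distr_bigA (fun i (b : bool) => (-1) ^+ (g.2 i && b))) /=.
have [->|ne] := eqVneq g 1%g.
  rewrite mul1r (eq_bigr (fun=> 2%:R)) => [|i _].
    by rewrite prodr_const card_ord natrX.
  by rewrite big_bool /= ffunE.
rewrite mul0r; apply/eqP/prodf_eq0.
have [i hi] : exists i, g.2 i.
  apply: contrapT => /forallNP h; case/eqP: ne; case: g g1 {hg} h => s u /= -> h.
  by congr pair; apply/ffunP => i; rewrite ffunE; apply/negP.
by exists i => //; rewrite big_bool /= hi /= addNr.
Qed.

(** * Group translates of the cyclic vector *)

Section Good.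
Variables (Gam : seq nat * seq nat) (fG : 'I_n -> 'I_n) (oG : 'I_n -> bool).
Hypotheses (shG : shape_of fG oG = Gam) (splG : spl K fG oG \in I).
Variable e : forall ab, 'I_(lin_dim (specht_mod K n ab)) -> poly.
Hypothesis eB : forall ab, is_basis (specht_mod K n ab) (@e ab).
Variable h0 : poly.
(** A degree bound above [spldeg] of every labelling, so that one truncated form [dot d] serves all
    shapes and the induction on [d - spldeg f o] is well founded. *)
Let d := (2 * n * n + n).+1.
Variable Q : poly -> Prop.
Hypotheses (QI : forall p, p \in I -> Q p) (QD : forall p q, Q p -> Q q -> Q (p + q))
  (QZ : forall c p, Q p -> Q (c *: p)).
Hypothesis Qgen : forall ab i j, ab \in BP n -> ~ bidominated ab Gam ->
  Q (coefop d (@e ab i) (@e ab j) h0).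

Let Q0 : Q 0. Proof. by apply: QI; apply: rpred0. Qed.

Lemma Q_coefop ab p q : ab \in BP n -> ~ bidominated ab Gam ->
  specht_mod K n ab p -> specht_mod K n ab q -> Q (coefop d p q h0).
Proof.
move=> hab nb hp hq; have [_ _ sp] := eB ab.
have [c ->] := sp p hp; have [b ->] := sp q hq.
elim/big_rec: _ => [|i u _ hu]; first by rewrite coefop0l.
rewrite coefopDl; apply: QD => //; apply: QZ.
elim/big_rec: _ => [|j v _ hv]; first by rewrite coefop0r.
by rewrite coefopDr; apply: QD => //; apply: QZ; apply: Qgen.
Qed.

Lemma pact_spl_specht g f o : specht_mod K n (shape_of f o) (pact g (spl K f o)).
Proof.
have [c _ ->] := pact_spl K0 g f o; rewrite -(shape_of_relabel (g.1^-1)%g f o).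
exists 1%N, (fun=> c), (fun=> spl K (fun i => f ((g.1^-1)%g i)) o); rewrite big_ord1.
split=> // _; exists (tab_of (fun i => f ((g.1^-1)%g i)) o); first exact: is_bitableau_tab.
by rewrite specht_tab.
Qed.

(** Descending induction on [spldeg f o]. For a dominated shape the Specht polynomial is in [I] and
    divides every antisymmetrization; otherwise [alt_coefop_lower] leaves a matrix coefficient of an
    allowed shape and antisymmetrizers of larger degree. *)
Lemma Q_alt f o g h : Q (pact g (alt f o (pact h h0))).
Proof.
move: {2}(d - spldeg f o)%N (leqnn (d - spldeg f o)) => N.
elim: N f o g h => [|N IHN] f o g h hN.
  by move: hN; rewrite leqn0 subn_eq0 leqNgt spldeg_lt.
case: (pselect (bidominated (shape_of f o) Gam)) => [hb|nb].
  apply: QI; apply: hI; apply: alt_spl_ideal; apply: (spl_ideal_up K0 hI _ splG).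
  by apply: bidominated_psi; rewrite shG.
have [k k0 hL] := alt_coefop_lower K0 (spldeg_lt f o).
have -> : pact g (alt f o (pact h h0)) =
    pact g (alt f o (pact h h0) - k *: coefop d (spl K f o) (spl K f o) (pact h h0)) +
    k *: coefop d (pact g (spl K f o)) (pact h^-1%g (spl K f o)) h0.
  by rewrite coefop_pactl -coefop_pactr linearB [X in _ - X]linearZ /= subrK.
apply: QD; last first.
  by apply: QZ; apply: (Q_coefop _ nb); rewrite ?mem_BP ?is_bipartition_shape //;
    apply: pact_spl_specht.
move: hL; set F := fun v => _; rewrite -[_ - _]/(F (pact h h0)); move: F => F hF.
elim: hF => {F} [F hF|F F1 F2 _ h1 _ h2 hF|F c g' f' o' h' hd hF].
- by rewrite hF linear0.
- by rewrite hF linearD; apply: QD.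
rewrite hF linearZ /= -!pactM; apply: QZ; apply: IHN.
by move: hN hd (spldeg_lt f' o'); rewrite -/d; lia.
Qed.

Lemma Q_pact g : Q (pact g h0).
Proof.
have n0 : (2 ^ n)%:R != 0 :> K by rewrite (char0_natr K0) expn_eq0.
have -> : pact g h0 =
  (2 ^ n)%:R^-1 *: \sum_(o : {ffun 'I_n -> bool}) pact g (alt id o (pact 1%g h0)).
  by rewrite -linear_sum /= sum_alt_id linearZ /= scalerA mulVf // scale1r pact1.
by apply: QZ; elim/big_rec: _ => // o q _ hq; apply: QD => //; apply: Q_alt.
Qed.

End Good.

Local Notation inv := (@hyp_invariant K n).

Lemma generated_mod (s : seq poly) :
  (forall p, exists2 c : nat -> poly, (forall i, c i \in inv) &
     p - \sum_(i < size s) c i * s`_i \in I) ->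
  generated_by_at_most (quot_over_inv I : lmodType (inv_quot I)) (size s).
Proof.
move=> h; exists (map (qproj I) s : seq (quot_over_inv I)); first by rewrite size_map.
move=> x; have [c hc hp] := h (qrepr x).
pose C i : inv_ring K n := Sub (c i) (hc i).
exists (fun i => qproj (inv_ideal I) (C i)).
rewrite size_map; transitivity (qproj I (\sum_(i < size s) c i * s`_i)).
  by rewrite -[LHS]qreprK; apply/qprojE.
rewrite (raddf_sum (qproj I)); apply: eq_bigr => i _ /=.
rewrite (nth_map 0) // rmorphM /=; congr (_ * _).
by rewrite inv_quot_mapE.
Qed.

Lemma quotient_generators (Gam : seq nat * seq nat) fG oG :
  shape_of fG oG = Gam -> spl K fG oG \in I ->
  generated_by_at_most (quot_over_inv I : lmodType (inv_quot I))
    (\sum_(to <- BP n | ~~ `[< bidominated to Gam >]) lin_dim (specht_mod K n to) ^ 2)%N.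
Proof.
move=> shG splG; have [h0 hh0] := invariants_cyclic n K0.
pose e ab : 'I_(lin_dim (specht_mod K n ab)) -> poly := projT1 (cid (specht_mod_basis K n ab)).
have eB ab : is_basis (specht_mod K n ab) (@e ab) := projT2 (cid (specht_mod_basis K n ab)).
pose d := (2 * n * n + n).+1.
pose s := flatten [seq [seq coefop d (@e ab ij.1) (@e ab ij.2) h0 |
  ij <- enum {: 'I_(lin_dim (specht_mod K n ab)) * 'I_(lin_dim (specht_mod K n ab))}] |
  ab <- [seq ab <- BP n | ~~ `[< bidominated ab Gam >]]].
have -> : (\sum_(to <- BP n | ~~ `[< bidominated to Gam >])
    lin_dim (specht_mod K n to) ^ 2)%N = size s.
  rewrite size_flatten sumnE /shape -map_comp big_map big_filter; apply: eq_bigr => ab _ /=.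
  by rewrite size_map -cardE card_prod card_ord mulnn.
apply: generated_mod.
pose Q p := exists2 c : nat -> poly, (forall i, c i \in inv) &
  p - \sum_(i < size s) c i * s`_i \in I.
have QI p : p \in I -> Q p.
  move=> hp; exists (fun=> 0) => [i|]; first exact: rpred0.
  by rewrite big1 ?subr0 // => i _; rewrite mul0r.
have QD p q : Q p -> Q q -> Q (p + q).
  move=> [b hb hp] [c hc hq]; exists (fun i => b i + c i) => [i|]; first exact: rpredD.
  under eq_bigr => i _ do rewrite mulrDl.
  by rewrite big_split /= opprD addrACA; apply: rpredD.
have QM t p : t \in inv -> Q p -> Q (t * p).
  move=> ht [c hc hp]; exists (fun i => t * c i) => [i|]; first exact: rpredM.
  under eq_bigr => i _ do rewrite -mulrA.
  by rewrite -mulr_sumr -mulrBr; apply: idealM.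
have QZ c p : Q p -> Q (c *: p) by rewrite -mul_mpolyC; apply/QM/invC.
have Qgen ab i j : ab \in BP n -> ~ bidominated ab Gam -> Q (coefop d (@e ab i) (@e ab j) h0).
  move=> hab nb; set q := coefop _ _ _ _; have qs : q \in s.
    apply/flatten_mapP; exists ab; first by rewrite mem_filter hab andbT; apply/asboolP.
    by apply/mapP; exists (i, j) => //; rewrite mem_enum.
  exists (fun k => (k == index q s)%:R) => [k|]; first exact: rpred_nat.
  have lt : (index q s < size s)%N by rewrite index_mem.
  rewrite (bigD1 (Ordinal lt)) //= eqxx mul1r nth_index // big1 => [|k].
    by rewrite addr0 subrr rpred0.
  by rewrite -val_eqE /= => /negPf->; rewrite mul0r.
move=> p; rewrite -/(Q p); have [t ht ->] := hh0 p.
elim/big_rec: _ => [|g q _ hq]; first by apply: QI; apply: rpred0.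
apply: (QD _ _ _ hq); apply: (QM _ _ (ht g)).
exact: (Q_pact shG splG eB QI QD QZ Qgen).
Qed.

Lemma no_specht_submodule fG oG (U : set (quot_ring I)) :
  spl K fG oG \in I -> submodule (quot_repn hI) U ->
  ~ mod_iso (quot_repn hI) (poly_repn K n) U (specht_mod K n (shape_of fG oG)).
Proof.
move=> splG [U0 UD UG] [f [flin fact finj fim]].
have f0 : f 0 = 0.
  have := flin 1 0 0 U0 U0; rewrite !scale1r addr0 => /eqP.
  by rewrite -[X in X == _]addr0 (inj_eq (addrI _)) => /eqP <-.
have UZ c u : U u -> U (c *: u) by move=> hu; rewrite -[c *: u]addr0; apply: UD.
have fZ c u : U u -> f (c *: u) = c *: f u.
  by move=> hu; rewrite -[c *: u]addr0 flin // f0 addr0.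
have [u Uu fu] : exists2 u, U u & f u = spl K fG oG.
  have := spl_specht_mod K fG oG; rewrite -fim => -[u Uu fu]; exists u => //.
have anti g : g \in colgrp fG -> Defs.qact g u = colchar K fG oG g *: u.
  move=> hg; apply: finj; [exact: (UG g)|exact: UZ|].
  by rewrite (fact g) // fZ // fu /= spl_antisym.
(* In the quotient [u] is alternating, so the antisymmetrizer multiplies it by the order of the
   column group; yet the antisymmetrized lift is divisible by the Specht polynomial, hence in
   [I]. *)
have E : qproj I (alt fG oG (qrepr u)) = #|colgrp fG|%:R *: u.
  rewrite (raddf_sum (qproj I)) (eq_bigr (fun=> u)) => [|g hg /=].
    by rewrite sumr_const scaler_nat.
  rewrite -qscaleE -(Defs.qactE hI) qreprK anti //.
  by rewrite -[LHS]/(_ *: (_ *: u)) scalerA colchar_sq scale1r.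
have u0 : u = 0.
  have h : qproj I (alt fG oG (qrepr u)) = qproj I 0.
    by apply/qprojE; rewrite subr0; apply: alt_spl_ideal.
  move: E; rewrite h raddf0 => /esym/eqP;
    rewrite scaler_eq0 (negPf (natr_neq0 K0 (card_colgrp_gt0 fG))).
  by move/eqP.
have /eqP := fu; rewrite u0 f0 eq_sym; apply/negP; exact: spl_neq0.
Qed.

End Generators.

Theorem theorem9 (R : realType) (K : fieldType)
    (hK : K = R :> fieldType \/ K = R[i] :> fieldType)
    (n : nat) (I : ideal {mpoly K[n]}) (hI : hyp_stable I)
    (P : {mpoly K[n]}) (hP : P \in I)
    (m : 'X_{1..n}) (hm : m \in msupp (top_component P))
    (I1 I2 : {set 'I_n}) (k r : 'I_n -> nat)
    (hdisj : [disjoint I1 & I2])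
    (hk : forall i, i \in I1 -> (1 <= k i)%N)
    (hmE : 'X_[m] = (\prod_(i in I1) 'X_i ^+ (2 * k i)) *
                    (\prod_(i in I2) 'X_i ^+ (2 * r i + 1)) :> {mpoly K[n]})
    (hwt : (wt (top_component P) + \sum_(i in I1) k i + \sum_(i in I2) r i
              <= n)%N) :
  ~ (exists U : set (quot_ring I),
       irreducible (quot_repn hI) U /\
       mod_iso (quot_repn hI) (poly_repn K n) U
         (specht_mod K n (Gamma_star I1 I2 k r)))
  /\
  generated_by_at_most (quot_over_inv I : lmodType (inv_quot I))
    (\sum_(to <- BP n | ~~ `[< bidominated to (Gamma_star I1 I2 k r) >])
       lin_dim (specht_mod K n to) ^ 2)%N.
Proof.
have K0 : [pchar K] =i pred0 by case: hK => ->; apply: Num.Theory.pchar_num.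
(* The exponents are read off by comparing coefficients of the two monomials, whose equality is only
   given in the polynomial ring. *)
have mE i : m i = ((i \in I1) * (2 * k i) + (i \in I2) * (2 * r i + 1))%N.
  pose m' := [multinom ((i \in I1) * (2 * k i) + (i \in I2) * (2 * r i + 1))%N | i < n].
  suff -> : m = m' by rewrite mnmE.
  have /(congr1 (fun p : {mpoly K[n]} => p@_m')) : 'X_[m] = 'X_[m'] :> {mpoly K[n]}.
    rewrite hmE [RHS]mpolyXE_id big_mkcond [X in _ * X]big_mkcond -big_split.
    apply: eq_bigr => j _ /=; rewrite mnmE [RHS]exprD.
    by case: (j \in I1); case: (j \in I2); rewrite ?mul1n ?mul0n ?expr0.
  rewrite !mcoeffX eqxx; case: eqP => // _ /eqP.
  by rewrite eq_sym oner_eq0.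
have m1 i : i \in I1 -> m i = (2 * k i)%N.
  by move=> hi; rewrite mE hi (disjointFr hdisj hi) mul1n mul0n addn0.
have m2 i : i \in I2 -> m i = (2 * r i + 1)%N.
  by move=> hi; rewrite mE hi (disjointFl hdisj hi) mul1n mul0n.
have m0 i : i \notin I1 :|: I2 -> m i = 0%N.
  by rewrite mE inE => /norP[/negPf-> /negPf->].
have [f [splI f1 f2 f0]] := spl_base K0 hI hP hm hdisj hk m1 m2 m0 hwt.
have sh := shape_of_Gamma hdisj f1 f2 f0; split.
  by move=> [U [[subU _ _] iso]]; apply: (no_specht_submodule K0 splI subU); rewrite sh.
exact: (quotient_generators K0 hI sh splI).
Qed.
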